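(* For every integer $n\ge1$, the polynomial $G_n[U]$ of the Korteweg-de Vries hierarchy is equal to $$G_n[U]=\frac{(2n)!}{2\cdot n!}\sum_{j=0}^n\binom{n+\frac12}{j+\frac12}\frac{(-1)^j(2j)!}{4^j\,j!\,(j+n)!}\sum_{p=1}^{j+n}\ \sum_{\substack{k_1,\dots,k_p\\ k_1+\cdots+k_p=2(n-p)}}C_{k_1,\dots,k_p}\,U_{k_1}\cdots U_{k_p},$$ where $k_1,\dots,k_p$ are non-negative integers and $$C_{k_1,\dots,k_p}=\sum_{\substack{0\le l_0\le l_1\le\cdots\le l_{p-1}\le j+n-p\\ 2l_i\ge k_1+\cdots+k_{i+1},\ i=0,\dots,p-1}}\binom{2l_0}{k_1}\binom{2l_1-k_1}{k_2}\cdots\binom{2l_{p-1}-k_1-\cdots-k_{p-1}}{k_p},$$ the sum being over integers $l_0,\dots,l_{p-1}$ (so that $C_{k_1,\dots,k_p}$ depends also on $j$ and $n$).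
   Context: Let $L=\frac{\partial^2}{\partial x^2}+U(x)$ be the one-dimensional Schrödinger operator. Its heat kernel $H(t,x,y)$ is the fundamental solution of $\big(\frac{\partial}{\partial t}-L\big)f=0$. As $t\to0+$ it has on the diagonal the asymptotic representation $$H(t,x,x)\sim\frac{1}{\sqrt{4\pi t}}\sum_{n=0}^\infty h_n[U]\,t^n,$$ where the $h_n[U]$ are polynomials in $U(x)$ and its derivatives. Set $$G_n[U]=\frac{(2n)!}{2\cdot n!}h_n[U],\qquad n\in\mathbb{N};$$ the KdV hierarchy is $\frac{\partial U}{\partial t}=\frac{\partial}{\partial x}G_n[U]$. Notation: $U_0=U$, $U_n=\partial^nU/\partial x^n$; the $U_n$, $n\ge0$, are treated as formal variables, so $G_n[U]=G_n[U_0,U_1,U_2,\dots]$ (for example $G_1[U]=U_0$ and $G_2[U]=U_2+3U_0^2$). Generalized binomial coefficients: for $z\in\mathbb{R}$ and a positive integer $a$, $\binom za=\binom z{z-a}=\frac{\Gamma(z+1)}{\Gamma(a+1)\Gamma(z-a+1)}=\frac{z(z-1)\cdots(z-a+1)}{a!}$, and $\binom z0=\binom zz=1$. Thus $\binom{n+1/2}{j+1/2}=\binom{n+1/2}{n-j}$. An empty sum is $0$. *)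

(* Defs.v *)
From HB Require Import structures.
From mathcomp Require Import all_boot all_order all_algebra finmap.
From mathcomp Require Import all_classical all_reals all_analysis.
From mathcomp Require monalg.
(* The notations of monalg clash with those of MathComp-Analysis. *)
Export -(notations) monalg.

Set Implicit Arguments.
Unset Strict Implicit.
Unset Printing Implicit Defensive.

Import Order.TTheory GRing.Theory Num.Theory.
Import numFieldNormedType.Exports.

Local Open Scope ring_scope.
Local Open Scope classical_set_scope.

(* Polynomials over R in countably many indeterminates U_0, U_1, ... *)
Notation jetpoly R := (monalg.malg (monalg.cmonom nat) R).

Definition jetvar (R : realType) (k : nat) : jetpoly R :=
  monalg.mkmalgU (monalg.ucm k) 1.

Definition jet_eval (R : realType) (v : nat -> R) (P : jetpoly R) : R :=
  monalg.mmap idfun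
    (fun m : monalg.cmonom nat => \prod_(k <- finsupp m) v k ^+ m k) P.

Definition smooth (R : realType) (U : R -> R) : Prop :=
  forall (k : nat) (x : R), derivable U^`(k) x 1.

Definition schrodinger (R : realType) (U f : R -> R) (x : R) : R :=
  f^`(2)%classic x + U x * f x.

(* [f t x] is a solution of class C^{1,2} on t > 0 of (d/dt - L) f = 0;
   nothing is required of [f t] for t <= 0. *)
Record heat_solution (R : realType) (U : R -> R) (f : R -> R -> R) : Prop :=
  HeatSolution {
    hs_derivable_t : forall t x : R, 0 < t -> derivable (f ^~ x) t 1;
    hs_derivable_x : forall t x : R, 0 < t -> derivable (f t) x 1;
    hs_derivable_xx : forall t x : R, 0 < t -> derivable (f t)^`() x 1;
    hs_continuous : forall p : R * R, 0 < p.1 ->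
      {for p, continuous (fun q : R * R => f q.1 q.2)};
    hs_continuous_t : forall p : R * R, 0 < p.1 ->
      {for p, continuous (fun q : R * R => (f ^~ q.2)^`() q.1)};
    hs_continuous_x : forall p : R * R, 0 < p.1 ->
      {for p, continuous (fun q : R * R => (f q.1)^`() q.2)};
    hs_continuous_xx : forall p : R * R, 0 < p.1 ->
      {for p, continuous (fun q : R * R => (f q.1)^`(2) q.2)};
    hs_equation : forall t x : R, 0 < t ->
      (f ^~ x)^`()%classic t - schrodinger U (f t) x = 0 }.

(* [f t] tends to the Dirac mass at [y] as t -> 0+, tested against continuous
   functions of compact support. *)
Definition dirac_initial (R : realType) (y : R) (f : R -> R -> R) : Prop :=
  forall phi : R -> R, continuous phi ->
    (exists M : R, forall x : R, M < `|x| -> phi x = 0) ->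
    \int[lebesgue_measure]_(x in setT) (f t x * phi x) @[t --> 0^'+] --> phi y.

(* No growth at infinity is imposed, so [H] need not be unique.  The diagonal
   expansion does not depend on the choice: for a fixed y, the difference of two
   such kernels, extended by 0 to t <= 0, is a distributional solution of the
   heat equation on R^2, hence smooth by hypoellipticity, hence O(t^N) at
   x = y for every N. *)
Definition fundamental_solution (R : realType) (U : R -> R)
    (H : R -> R -> R -> R) : Prop :=
  forall y : R, heat_solution U (fun t x => H t x y) /\
                dirac_initial y (fun t x => H t x y).

(* The asymptotic expansion
     u t ~ (4 pi t)^(-1/2) * \sum_n a n * t^n   as t -> 0+
   in the sense of Poincare, both sides being multiplied by (4 pi t)^(1/2). *)
Definition heat_expansion (R : realType) (u : R -> R) (a : nat -> R) : Prop :=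
  forall N : nat,
    (Num.sqrt (4 * pi * t) * u t - \sum_(n < N.+1) a n * t ^+ n) / t ^+ N
      @[t --> 0^'+] --> (0 : R).

(* This determines the polynomials [h n], since the jet of a smooth [U] at a
   point is arbitrary. *)
Definition heat_coefficients (R : realType) (h : nat -> jetpoly R) : Prop :=
  forall (U : R -> R) (H : R -> R -> R -> R),
    smooth U -> fundamental_solution U H ->
    forall x : R,
      heat_expansion (fun t => H t x x)
        (fun n => jet_eval (fun k => U^`(k) x) (h n)).

Definition kdv_poly (R : realType) (h : nat -> jetpoly R) (n : nat) :
    jetpoly R :=
  ((2 * n)`!%:R / (2 * n`!%:R)) *: h n.

Definition gbinom (R : realType) (z : R) (a : nat) : R :=
  (\prod_(i < a) (z - i%:R)) / a`!%:R.

Definition psum (p : nat) (k : 'I_p -> nat) (i : nat) : nat :=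
  (\sum_(s < p | s < i) k s)%N.

(* The coefficient C_{k_1,...,k_p} for m = j + n; k_{i+1} is [k i], and both
   truncated subtractions are exact (p <= m, and 2 l_i >= k_1 + ... + k_i). *)
Definition Ccoef (m p : nat) (k : 'I_p -> nat) : nat :=
  (\sum_(l : {ffun 'I_p -> 'I_(m - p).+1} |
         [forall i : 'I_p, forall i' : 'I_p, (i <= i') ==> (l i <= l i')] &&
         [forall i : 'I_p, psum k i.+1 <= 2 * l i])
     \prod_(i < p) 'C(2 * l i - psum k i, k i))%N.

(* Main.v *)
Require Import Defs.
From HB Require Import structures.
From mathcomp Require Import all_boot all_order all_algebra finmap.
From mathcomp Require Import all_classical all_reals all_analysis.
From mathcomp Require Import measurable_realfun.
From mathcomp Require Import ring lra zify.

Set Implicit Arguments.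
Unset Strict Implicit.
Unset Printing Implicit Defensive.

Import Order.TTheory GRing.Theory Num.Theory.
Import numFieldNormedType.Exports.

(** The polynomials h_n are only known through heat kernels, so the identity is
    checked on a family of potentials whose heat kernel is elementary and whose
    jets are so many that no nonzero polynomial vanishes on all of them: the
    reflectionless (multi-soliton) potentials.

    For kappa_i > 0 and e_i(x) = gamma_i exp(- kappa_i x), let C be the positive
    semidefinite matrix (e_i e_j / (kappa_i + kappa_j)), B = (1 + C)^-1 and
    chi = B e.  With U = 4 \sum_i kappa_i chi_i^2 one has
    chi_i'' + U chi_i = kappa_i^2 chi_i ([state_eigen]), and
    \sum_i chi_i(x) chi_i(y) sinh (kappa_i (x - y)) splits as a function of y
    minus the same function of x, which expresses U(x) in a form involving an
    arbitrary y ([state_potential]).  These two facts make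
      G_t(x - y) + 2 \sum_i chi_i(x) chi_i(y) S_i(t, x - y),
    where G is the Gauss kernel and S_i(t, z) is the integral of
    G_t(w) sinh (kappa_i w) over w > z, a fundamental solution for U
    ([hker_fundamental]).  On the diagonal it is a combination of Dawson
    functions, whose Taylor coefficients give
      h_n[U](0) = 4^n (n-1)! / (2n-1)! \sum_i chi_i(0)^2 kappa_i^(2n-1)
    for n > 0 ([hker_expansion]).

    The same number has to come out of the right-hand side of the formula.
    There, the sum over k and l is the Leibniz expansion of
    L^(j+n) (x^(2j)) / (2j)! at 0: expand (d^2 + U)^(j+n) into words and let the
    derivatives act from left to right; l_i counts the letters d^2 in front of
    the (i+1)-st letter U, and k_{i+1} the derivatives that hit this letter
    ([schr_monomial]).  To evaluate this for a soliton potential, put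
      T f = f + 2 \sum_i chi_i(0) sinh (kappa_i x) \int_0^x chi_i f.
    Then T L f - (T f)'' is an odd function, hence
    (L^m f)(0) = (T f)^(2m)(0) ([iter_schr]).  For f = x^(2j) the right-hand
    side is explicit, and the weights in front are, up to a factor free of j,
    (-1)^j binom(n, j) times a polynomial of degree n - 1 in j.  As n-th
    differences kill polynomials of degree less than n, only one simple pole
    contributes and the sum over j collapses to the value above
    ([kdv_weight_sum], [soliton_coef_jets]).

    Finally a polynomial P in U_0, U_1, ... that vanishes on the jets of all
    these potentials is 0 ([jet_hom_soliton_eq0]).  For gamma = d g with d -> 0,
    U^(k)(0) is d^2 (\sum_i 4 kappa_i g_i^2 (- 2 kappa_i)^k + o(1)), so that the
    lowest homogeneous part of P vanishes at all these limits, which fill an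
    open cone because Vandermonde matrices are invertible. *)

Local Open Scope ring_scope.
Local Open Scope classical_set_scope.

(** * A heat kernel built from eigenfunctions *)

Definition gaussint (R : realType) (x : R) : R :=
  \int[lebesgue_measure]_(w in `]-oo, x]) gauss_fun w.

Lemma is_derive_gaussint (R : realType) (x : R) :
  is_derive x 1 (@gaussint R) (gauss_fun x).
Proof.
have [] := @continuous_FTC1 R (@gauss_fun R) -oo%O x (x + 1).
- by rewrite ltrDl.
- by apply: (integrableS _ _ (@subsetT _ _)) => //; exact: integrableT_gauss.
- by rewrite ltNyr.
- exact: continuous_gauss_fun.
move=> d e; apply: DeriveDef; first exact: d.
rewrite -derive1E; exact: e.
Qed.

Section kernels.
Variable R : realType.
Implicit Types (k t z : R).

Definition gker t z : R := (Num.sqrt (4 * pi * t))^-1 * expR (- (z ^+ 2 / (4 * t))).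

Definition sinhR (z : R) : R := (expR z - expR (- z)) / 2.
Definition coshR (z : R) : R := (expR z + expR (- z)) / 2.

(** The integral of G_t(w) sinh (k w) over w > z, G_t being the Gauss kernel
    [gker t], in the closed form obtained by completing the square. *)
Definition sker k t z : R :=
  expR (k ^+ 2 * t) / (2 * Num.sqrt pi) *
  (gaussint ((z + 2 * k * t) / (2 * Num.sqrt t)) -
   gaussint ((z - 2 * k * t) / (2 * Num.sqrt t))).

Lemma sqrt_4pit t : 0 <= t -> Num.sqrt (4 * pi * t) = 2 * Num.sqrt pi * Num.sqrt t :> R.
Proof.
move=> t0; rewrite -mulrA sqrtrM// sqrtrM ?pi_ge0// mulrA.
by rewrite (_ : 4 = 2 ^+ 2 :> R) ?sqrtr_sqr ?ger0_norm// -natrX.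
Qed.

Lemma gauss_fun_shift k t z : 0 < t ->
  gauss_fun ((z + 2 * k * t) / (2 * Num.sqrt t)) =
  expR (- (z ^+ 2 / (4 * t))) * expR (- (k * z)) * (expR (k ^+ 2 * t))^-1.
Proof.
move=> t0; rewrite /gauss_fun -expRN -!expRD; congr expR.
have [w w0 ->] : exists2 w : R, 0 < w & t = w ^+ 2.
  by exists (Num.sqrt t); rewrite ?sqrtr_gt0// sqr_sqrtr// ltW.
rewrite sqrtr_sqr ger0_norm ?(ltW w0)//.
by field; rewrite gt_eqF.
Qed.

Lemma is_derive_gker_x t z : 0 < t ->
  is_derive z 1 (gker t) (- (z / (2 * t)) * gker t z).
Proof.
move=> t0; rewrite /gker.
apply: is_derive_eq; rewrite ?scaler0 ?add0r /GRing.scale/=.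
have tn : t != 0 by rewrite gt_eqF.
have pn : Num.sqrt (4 * pi * t) != 0 :> R.
  by rewrite gt_eqF// sqrtr_gt0 !mulr_gt0 ?pi_gt0.
field.
by rewrite tn pn.
Qed.

Lemma is_derive_gaussint_comp (f : R -> R) (x df : R) : is_derive x 1 f df ->
  is_derive x 1 (fun y => gaussint (f y)) (gauss_fun (f x) * df).
Proof. by move=> fd; exact: (is_derive1_comp (is_derive_gaussint (f x)) fd). Qed.

Lemma is_derive_sker_x k t z : 0 < t ->
  is_derive z 1 (sker k t) (- gker t z * sinhR (k * z)).
Proof.
move=> t0; rewrite /sker.
have h c : is_derive z 1 (fun z => gaussint ((z + 2 * c * t) / (2 * Num.sqrt t)))
   (gauss_fun ((z + 2 * c * t) / (2 * Num.sqrt t)) * (2 * Num.sqrt t)^-1).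
  apply: is_derive_gaussint_comp.
  by apply: is_derive_eq; rewrite ?scaler0 ?add0r ?addr0 /GRing.scale/= mulr1.
have h2 := is_deriveB (h k) (h (- k)).
rewrite (_ : (fun z => gaussint ((z + 2 * - k * t) / (2 * Num.sqrt t))) =
  (fun z => gaussint ((z - 2 * k * t) / (2 * Num.sqrt t)))) in h2; last first.
  by apply/funext => y; rewrite mulrN mulNr.
apply: (is_derive_eq (is_deriveZ (expR (k ^+ 2 * t) / (2 * Num.sqrt pi)) h2)).
rewrite /GRing.scale/= !gauss_fun_shift// /gker /sinhR sqrt_4pit ?ltW// !sqrrN mulNr opprK.
have tn : Num.sqrt t != 0 by rewrite gt_eqF// sqrtr_gt0.
have pn : Num.sqrt pi != 0 :> R by rewrite gt_eqF// sqrtr_gt0 pi_gt0.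
have en : expR (k ^+ 2 * t) != 0 by rewrite gt_eqF// expR_gt0.
field.
by rewrite tn pn en.
Qed.

End kernels.

Section derivation_rules.
Variable R : realType.
Implicit Types (f g : R -> R) (x a b : R).

(** The derivation rules are restated for explicit functions of a real variable,
    with products in place of scalings, so that the derivatives of the kernels
    can be assembled term by term. *)
Lemma derive_mul f g x a b : is_derive x 1 f a -> is_derive x 1 g b ->
  is_derive x 1 (fun y => f y * g y) (a * g x + f x * b).
Proof.
by move=> fa gb; apply: is_derive_eq; rewrite /GRing.scale/= addrC [g x * a]mulrC.
Qed.

Lemma derive_affine x a b : is_derive x 1 (fun y => a + b * y) b.
Proof.
apply: (is_derive_eq
  (is_deriveD (is_derive_cst a x 1) (is_deriveZ b (is_derive_id x 1)))).
by rewrite add0r /GRing.scale/= mulr1.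
Qed.

Lemma derive_mulr f x a b : is_derive x 1 f a ->
  is_derive x 1 (fun y => f y * b) (a * b).
Proof.
move=> fa; apply: (is_derive_eq (derive_mul fa (is_derive_cst b x 1))).
by rewrite mulr0 addr0.
Qed.

Lemma derive_mull f x a b : is_derive x 1 f a ->
  is_derive x 1 (fun y => b * f y) (b * a).
Proof. by move=> fa; exact: (is_deriveZ b fa). Qed.

Lemma derive_add f g x a b : is_derive x 1 f a -> is_derive x 1 g b ->
  is_derive x 1 (fun y => f y + g y) (a + b).
Proof. by move=> fa gb; exact: is_deriveD. Qed.

Lemma derive_opp f x a : is_derive x 1 f a ->
  is_derive x 1 (fun y => - f y) (- a).
Proof. by move=> fa; exact: is_deriveN. Qed.

Lemma derive_inv f x a : f x != 0 -> is_derive x 1 f a ->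
  is_derive x 1 (fun y => (f y)^-1) (- a / f x ^+ 2).
Proof.
move=> f0 fa; apply: (is_derive_eq (is_deriveV f0 fa)).
by rewrite /GRing.scale/= !mulNr mulrC.
Qed.

Lemma derive_expR f x a : is_derive x 1 f a ->
  is_derive x 1 (fun y => expR (f y)) (expR (f x) * a).
Proof. by move=> fa; exact: (is_derive1_comp (is_derive_expR (f x)) fa). Qed.

Lemma derive_sum (n : nat) (f : 'I_n -> R -> R) (d : 'I_n -> R) x :
  (forall i, is_derive x 1 (f i) (d i)) ->
  is_derive x 1 (fun y => \sum_(i < n) f i y) (\sum_(i < n) d i).
Proof.
move=> fd; rewrite (_ : (fun y => _) = \sum_(i < n) f i).
  exact: is_derive_sum.
by apply/funext => y; rewrite fct_sumE.
Qed.

End derivation_rules.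

Section kernel_time_derivatives.
Variable R : realType.
Implicit Types (k t z : R).

Lemma is_derive_gker_t t z : 0 < t ->
  is_derive t 1 ((@gker R)^~ z) ((z ^+ 2 / (4 * t ^+ 2) - (2 * t)^-1) * gker t z).
Proof.
move=> t0; rewrite /gker.
have pn : 0 < 4 * pi * t :> R by rewrite !mulr_gt0 ?pi_gt0.
have sn : Num.sqrt (4 * pi * t) != 0 :> R by rewrite gt_eqF// sqrtr_gt0.
have tn : t != 0 by rewrite gt_eqF.
have h1 : is_derive t 1 (fun t : R => 4 * pi * t) (4 * pi).
  by apply: is_derive_eq; rewrite ?scaler0 ?addr0 /GRing.scale/= ?mulr1.
have h2 : is_derive t 1 (fun t : R => Num.sqrt (4 * pi * t))
    ((2 * Num.sqrt (4 * pi * t))^-1 * (4 * pi)).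
  exact: (is_derive1_comp (is_derive1_sqrt pn) h1).
have h3 : is_derive t 1 (fun t : R => 4 * t) 4.
  by apply: is_derive_eq; rewrite ?scaler0 ?addr0 /GRing.scale/= ?mulr1.
have t4 : 4 * t != 0 by rewrite mulf_neq0.
have h4 := @derive_inv _ (fun t : R => 4 * t) _ _ t4 h3.
have h5 := derive_expR (is_deriveN (is_deriveZ (z ^+ 2) h4)).
have h6 := @derive_inv _ (fun t : R => Num.sqrt (4 * pi * t)) _ _ sn h2.
apply: (is_derive_eq (derive_mul h6 h5)).
rewrite (_ : expR _ = expR (- (z ^+ 2 / (4 * t))))//.
rewrite /GRing.scale/=.
have s2 : Num.sqrt (4 * pi * t) ^+ 2 = 4 * pi * t by rewrite sqr_sqrtr// ltW.
rewrite s2.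
have pin : pi != 0 :> R by rewrite gt_eqF// pi_gt0.
move: sn s2 pin; move: (@pi R) => p sn s2 pin.
field.
by rewrite tn sn pin.
Qed.

(** Together with [is_derive_sker_x] this says that
    S_t - S_zz - k ^ 2 S = 2 k G cosh (k z) and S_z = - G sinh (k z), which is
    what makes the correction terms of the heat kernel fit. *)
Lemma is_derive_sker_t k t z : 0 < t ->
  is_derive t 1 ((@sker R k)^~ z)
    (k ^+ 2 * sker k t z +
     gker t z * (z / (2 * t) * sinhR (k * z) + k * coshR (k * z))).
Proof.
move=> t0; rewrite /sker.
have tn : t != 0 by rewrite gt_eqF.
have sn : Num.sqrt t != 0 by rewrite gt_eqF// sqrtr_gt0.
have pn : Num.sqrt pi != 0 :> R by rewrite gt_eqF// sqrtr_gt0 pi_gt0.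
have ss : Num.sqrt t ^+ 2 = t by rewrite sqr_sqrtr// ltW.
have en : expR (k ^+ 2 * t) != 0 by rewrite gt_eqF// expR_gt0.
have h1 : is_derive t 1 (fun t : R => 2 * Num.sqrt t) (Num.sqrt t)^-1.
  apply: (is_derive_eq (is_deriveZ 2 (is_derive1_sqrt t0))).
  by rewrite /GRing.scale/=; field.
have s2 : 2 * Num.sqrt t != 0 by rewrite mulf_neq0.
have h c : is_derive t 1 (fun t => gaussint ((z + 2 * c * t) / (2 * Num.sqrt t)))
   (gauss_fun ((z + 2 * c * t) / (2 * Num.sqrt t)) *
     (- z / (4 * t * Num.sqrt t) + c / (2 * Num.sqrt t))).
  apply: is_derive_gaussint_comp.
  have h3 : is_derive t 1 (fun t : R => z + 2 * c * t) (2 * c).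
    exact: derive_affine.
  apply: (is_derive_eq (derive_mul h3 (@derive_inv _ (fun t : R => 2 * Num.sqrt t) _ _ s2 h1))).
  clear -sn ss; move: sn ss; move: (Num.sqrt t) => w sn <-; field.
  by rewrite sn.
have h2 := is_deriveB (h k) (h (- k)).
rewrite (_ : (fun t => gaussint ((z + 2 * - k * t) / (2 * Num.sqrt t))) =
  (fun t => gaussint ((z - 2 * k * t) / (2 * Num.sqrt t)))) in h2; last first.
  by apply/funext => y; rewrite mulrN mulNr.
have h4 : is_derive t 1 (fun t => expR (k ^+ 2 * t) / (2 * Num.sqrt pi))
   (k ^+ 2 * (expR (k ^+ 2 * t) / (2 * Num.sqrt pi))).
  have h5 : is_derive t 1 (fun t : R => k ^+ 2 * t) (k ^+ 2).
    by apply: is_derive_eq; rewrite ?scaler0 ?addr0 /GRing.scale/= ?mulr1.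
  apply: (is_derive_eq (derive_mulr _ (derive_expR h5))).
  by rewrite [_ * k ^+ 2]mulrC mulrA.
have {}h2 : is_derive t 1 (fun t => gaussint ((z + 2 * k * t) / (2 * Num.sqrt t)) -
  gaussint ((z - 2 * k * t) / (2 * Num.sqrt t))) _ := h2.
apply: (is_derive_eq (derive_mul h4 h2)).
rewrite /= !gauss_fun_shift// /gker /sinhR /coshR sqrt_4pit ?ltW// !sqrrN !mulNr !opprK.
set ga := gaussint _; set gb := gaussint _.
move: sn ss; move: (Num.sqrt t) => w sn ss.
move: en ga gb; rewrite -ss => en ga gb.
field.
by rewrite sn pn en.
Qed.

End kernel_time_derivatives.

Section continuity_rules.
Variable R : realType.
Variable p : R * R.
Implicit Types f g : R * R -> R.
Local Notation cts f := {for p, continuous f}.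

(** As for derivatives, continuity at a point of the plane is restated for
    explicit functions of the pair. *)
Lemma ctsM f g : cts f -> cts g -> cts (fun q => f q * g q).
Proof. by move=> cf cg; apply: cvgM. Qed.
Lemma ctsD f g : cts f -> cts g -> cts (fun q => f q + g q).
Proof. by move=> cf cg; apply: cvgD. Qed.
Lemma ctsN f : cts f -> cts (fun q => - f q).
Proof. by move=> cf; apply: cvgN. Qed.
Lemma ctsC (a : R) : cts (fun q => a).
Proof. by apply: cvg_cst. Qed.
Lemma ctsV f : f p != 0 -> cts f -> cts (fun q => (f q)^-1).
Proof. by move=> f0 cf; apply: cvgV. Qed.
Lemma cts_comp (h : R -> R) f : continuous h -> cts f -> cts (fun q => h (f q)).
Proof. by move=> ch cf; apply: continuous_comp => //; exact: ch. Qed.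
Lemma cts_sum n (f : 'I_n -> R * R -> R) : (forall i, cts (f i)) ->
  cts (fun q => \sum_(i < n) f i q).
Proof.
elim: n f => [|n IH] f cf.
  rewrite (_ : (fun _ => _) = (fun=> 0)); first exact: ctsC.
  by apply/funext => q; rewrite big_ord0.
rewrite (_ : (fun _ => _) = (fun q => \sum_(i < n) f (widen_ord (leqnSn n) i) q + f ord_max q)).
  by apply: ctsD => //; apply: IH.
by apply/funext => q; rewrite big_ord_recr.
Qed.

Lemma cts_fst : cts fst. Proof. exact: cvg_fst. Qed.
Lemma cts_snd : cts snd. Proof. exact: cvg_snd. Qed.
End continuity_rules.

Section soliton_heat_kernel.
Variables (R : realType) (N : nat) (kappa : 'I_N -> R).
Variables (chi dchi ddchi : 'I_N -> R -> R) (U : R -> R).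
Hypothesis chi1 : forall i (x : R), is_derive x 1 (chi i) (dchi i x).
Hypothesis chi2 : forall i (x : R), is_derive x 1 (dchi i) (ddchi i x).
Hypothesis ddchi_continuous : forall i, continuous (ddchi i).
Hypothesis eigen : forall i x,
  ddchi i x + U x * chi i x = kappa i ^+ 2 * chi i x.
Hypothesis potential : forall x y,
  4 * (\sum_(i < N) chi i y * (dchi i x * sinhR (kappa i * (x - y)) +
    kappa i * chi i x * coshR (kappa i * (x - y)))) = U x.

(** On top of the free kernel, each eigenfunction contributes its rank one term
    chi_i(x) chi_i(y), with a time evolution that vanishes at t = 0. *)
Definition hker (t x y : R) : R :=
  gker t (x - y) +
  \sum_(i < N) 2 * chi i y * (chi i x * sker (kappa i) t (x - y)).

Lemma is_derive_sinhR (z : R) : is_derive z 1 (@sinhR R) (coshR z).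
Proof.
change (is_derive z 1 (fun z : R => (expR z - expR (- z)) / 2) (coshR z)).
have h : is_derive z 1 (fun z : R => expR z - expR (- z)) _ :=
  is_deriveB (is_derive_expR z) (derive_expR (is_deriveNid z 1)).
by apply: (is_derive_eq (derive_mulr _ h)); rewrite mulrN1 opprK.
Qed.

Lemma is_derive_coshR (z : R) : is_derive z 1 (@coshR R) (sinhR z).
Proof.
change (is_derive z 1 (fun z : R => (expR z + expR (- z)) / 2) (sinhR z)).
have h : is_derive z 1 (fun z : R => expR z + expR (- z)) _ :=
  is_deriveD (is_derive_expR z) (derive_expR (is_deriveNid z 1)).
by apply: (is_derive_eq (derive_mulr _ h)); rewrite mulrN1.
Qed.

Lemma derive_shift (f : R -> R) (x y a : R) : is_derive (x - y) 1 f a ->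
  is_derive x 1 (fun x => f (x - y)) a.
Proof.
move=> fa.
have h : is_derive x 1 (fun x : R => x - y) 1.
  apply: (is_derive_eq (is_deriveB (is_derive_id x 1) (is_derive_cst y x 1))).
  by rewrite subr0.
have h2 : is_derive x 1 (fun x => f (x - y)) (a * 1) :=
  @is_derive1_comp _ f (fun x => x - y) _ _ _ fa h.
by rewrite mulr1 in h2.
Qed.

Lemma derive_scale (f : R -> R) (x k a : R) : is_derive (k * x) 1 f a ->
  is_derive x 1 (fun x => f (k * x)) (k * a).
Proof.
move=> fa.
have h : is_derive x 1 (fun x : R => k * x) k.
  apply: (is_derive_eq (derive_mull k (is_derive_id x 1))).
  by rewrite mulr1.
have h2 : is_derive x 1 (fun x => f (k * x)) (a * k) :=
  @is_derive1_comp _ f (fun x => k * x) _ _ _ fa h.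
by rewrite mulrC in h2.
Qed.

Definition hker_x (t x y : R) : R :=
  - ((x - y) / (2 * t)) * gker t (x - y) +
  \sum_(i < N) 2 * chi i y * (dchi i x * sker (kappa i) t (x - y) +
     chi i x * (- gker t (x - y) * sinhR (kappa i * (x - y)))).

Definition hker_xx (t x y : R) : R :=
  ((x - y) ^+ 2 / (4 * t ^+ 2) - (2 * t)^-1) * gker t (x - y) +
  \sum_(i < N) 2 * chi i y * (ddchi i x * sker (kappa i) t (x - y) +
     2 * dchi i x * (- gker t (x - y) * sinhR (kappa i * (x - y))) +
     chi i x * (((x - y) / (2 * t)) * gker t (x - y) * sinhR (kappa i * (x - y)) -
       kappa i * gker t (x - y) * coshR (kappa i * (x - y)))).

Definition hker_t (t x y : R) : R :=
  ((x - y) ^+ 2 / (4 * t ^+ 2) - (2 * t)^-1) * gker t (x - y) +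
  \sum_(i < N) 2 * chi i y * (chi i x *
    (kappa i ^+ 2 * sker (kappa i) t (x - y) + gker t (x - y) *
      ((x - y) / (2 * t) * sinhR (kappa i * (x - y)) +
       kappa i * coshR (kappa i * (x - y))))).

Lemma is_derive_hker_x (t x y : R) : 0 < t ->
  is_derive x 1 (fun x => hker t x y) (hker_x t x y).
Proof.
move=> t0; rewrite /hker.
apply: derive_add; first exact: derive_shift (is_derive_gker_x _ t0).
apply: derive_sum => i; apply: derive_mull.
exact: derive_mul (chi1 i x) (derive_shift (is_derive_sker_x _ _ t0)).
Qed.

Lemma is_derive_hker_xx (t x y : R) : 0 < t ->
  is_derive x 1 (fun x => hker_x t x y) (hker_xx t x y).
Proof.
move=> t0; rewrite /hker_x.
have tn : t != 0 by rewrite gt_eqF.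
have hg : is_derive x 1 (fun x => gker t (x - y)) _ :=
  derive_shift (is_derive_gker_x _ t0).
have hl : is_derive x 1 (fun x : R => - ((x - y) / (2 * t))) (- (2 * t)^-1).
  apply: (@derive_shift (fun z => - (z / (2 * t)))).
  apply: (is_derive_eq (derive_opp (derive_mulr _ (is_derive_id (x - y) 1)))).
  by rewrite mul1r.
apply: derive_add.
  apply: (is_derive_eq (derive_mul hl hg)); by rewrite /=; field.
apply: derive_sum => i.
have hs : is_derive x 1 (fun x => sinhR (kappa i * (x - y))) _ :=
  derive_shift (derive_scale (is_derive_sinhR (kappa i * (x - y)))).
have hk : is_derive x 1 (fun x => sker (kappa i) t (x - y)) _ :=
  derive_shift (is_derive_sker_x (kappa i) _ t0).
have h : is_derive x 1 (fun x => dchi i x * sker (kappa i) t (x - y) +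
     chi i x * (- gker t (x - y) * sinhR (kappa i * (x - y)))) _ :=
  derive_add (derive_mul (chi2 i x) hk)
    (derive_mul (chi1 i x) (derive_mul (derive_opp hg) hs)).
apply: (is_derive_eq (derive_mull _ h)).
congr (_ * _); rewrite /=.
by field.
Qed.

Lemma is_derive_hker_t (t x y : R) : 0 < t ->
  is_derive t 1 (fun t => hker t x y) (hker_t t x y).
Proof.
move=> t0; rewrite /hker.
apply: derive_add; first exact: is_derive_gker_t.
apply: derive_sum => i.
apply: derive_mull; apply: derive_mull.
exact: is_derive_sker_t.
Qed.

(** The terms in S cancel by the eigenvalue equation; the remaining ones are
    multiples of G, and add up to 0 by the expression of the potential. *)
Lemma hker_heat (t x y : R) :
  hker_t t x y - (hker_xx t x y + U x * hker t x y) = 0.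
Proof.
rewrite /hker_t /hker_xx /hker mulrDr -{1}(potential x y).
set G := gker _ _; set A := (_ - _) * G.
rewrite !mulr_sumr mulr_suml.
set S1 := \sum_(i < N) _; set S2 := \sum_(i < N) _.
set S3 := \sum_(i < N) _; set S4 := \sum_(i < N) _.
rewrite (_ : A + S1 - (A + S2 + (S3 + S4)) = S1 - S2 - S3 - S4); last by ring.
rewrite -!sumrB big1// => i _.
have -> : ddchi i x = kappa i ^+ 2 * chi i x - U x * chi i x by rewrite -eigen addrK.
by ring.
Qed.

Lemma derive1_is_derive (f : R -> R) (g x : R) : is_derive x 1 f g -> f^`() x = g.
Proof. by move=> h; rewrite derive1E; exact: derive_val. Qed.

Lemma gker_continuous (p : R * R) (y : R) : 0 < p.1 ->
  {for p, continuous (fun q : R * R => gker q.1 (q.2 - y))}.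
Proof.
move=> p0; apply: ctsM.
  apply: ctsV; first by rewrite gt_eqF// sqrtr_gt0 !mulr_gt0// pi_gt0.
  apply: (cts_comp (@sqrt_continuous R)); apply: ctsM; [exact: ctsC|exact: cts_fst].
apply: (cts_comp (@continuous_expR R)); apply: ctsN; apply: ctsM.
  by apply: (cts_comp (@exprn_continuous R 2)); apply: ctsD; [exact: cts_snd|exact: ctsC].
apply: ctsV; first by rewrite gt_eqF// mulr_gt0.
by apply: ctsM; [exact: ctsC|exact: cts_fst].
Qed.

Lemma gaussint_continuous : continuous (@gaussint R).
Proof.
move=> x; apply: differentiable_continuous; apply/derivable1_diffP.
by case: (is_derive_gaussint x).
Qed.

Lemma sker_continuous (p : R * R) (y k : R) : 0 < p.1 ->
  {for p, continuous (fun q : R * R => sker k q.1 (q.2 - y))}.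
Proof.
move=> p0; apply: ctsM.
  apply: ctsM; last exact: ctsC.
  apply: (cts_comp (@continuous_expR R)); apply: ctsM; [exact: ctsC|exact: cts_fst].
have h c : {for p, continuous (fun q : R * R => gaussint ((q.2 - y + c * q.1) / (2 * Num.sqrt q.1)))}.
  apply: (cts_comp gaussint_continuous); apply: ctsM.
    apply: ctsD.
      by apply: ctsD; [exact: cts_snd|exact: ctsC].
    by apply: ctsM; [exact: ctsC|exact: cts_fst].
  apply: ctsV; first by rewrite gt_eqF// mulr_gt0// sqrtr_gt0.
  apply: ctsM; first exact: ctsC.
  apply: (cts_comp (@sqrt_continuous R)); exact: cts_fst.
apply: ctsD; first exact: h.
apply: ctsN.
rewrite (_ : (fun q : R * R => gaussint ((q.2 - y - 2 * k * q.1) / (2 * Num.sqrt q.1))) =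
  (fun q : R * R => gaussint ((q.2 - y + - (2 * k) * q.1) / (2 * Num.sqrt q.1)))); first exact: h.
by apply/funext => q; rewrite mulNr.
Qed.

Lemma derive_continuous (f df : R -> R) : (forall x : R, is_derive x 1 f (df x)) -> continuous f.
Proof.
move=> fd x; apply: differentiable_continuous; apply/derivable1_diffP.
by case: (fd x).
Qed.

Section joint_continuity.
Variables (p : R * R) (y : R).
Hypothesis p0 : 0 < p.1.
Let cg : {for p, continuous (fun q : R * R => gker q.1 (q.2 - y))} := @gker_continuous p y p0.
Let ck i : {for p, continuous (fun q : R * R => sker (kappa i) q.1 (q.2 - y))} :=
  @sker_continuous p y (kappa i) p0.
Let cz : {for p, continuous (fun q : R * R => q.2 - y)}.
Proof. by apply: ctsD; [exact: cts_snd|exact: ctsC]. Qed.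
Let csinh i : {for p, continuous (fun q : R * R => sinhR (kappa i * (q.2 - y)))}.
Proof.
apply: (cts_comp (derive_continuous is_derive_sinhR)).
by apply: ctsM; [exact: ctsC|exact: cz].
Qed.
Let ccosh i : {for p, continuous (fun q : R * R => coshR (kappa i * (q.2 - y)))}.
Proof.
apply: (cts_comp (derive_continuous is_derive_coshR)).
by apply: ctsM; [exact: ctsC|exact: cz].
Qed.
Let cchi i : {for p, continuous (fun q : R * R => chi i q.2)}.
Proof. by apply: (cts_comp (derive_continuous (chi1 i))); exact: cts_snd. Qed.
Let cdchi i : {for p, continuous (fun q : R * R => dchi i q.2)}.
Proof. by apply: (cts_comp (derive_continuous (chi2 i))); exact: cts_snd. Qed.
Let cddchi i : {for p, continuous (fun q : R * R => ddchi i q.2)}.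
Proof. by apply: (cts_comp (@ddchi_continuous i)); exact: cts_snd. Qed.
Let c2t : {for p, continuous (fun q : R * R => (2 * q.1)^-1)}.
Proof.
apply: ctsV; first by rewrite gt_eqF// mulr_gt0.
by apply: ctsM; [exact: ctsC|exact: cts_fst].
Qed.
Let ca : {for p, continuous (fun q : R * R => (q.2 - y) ^+ 2 / (4 * q.1 ^+ 2) - (2 * q.1)^-1)}.
Proof.
apply: ctsD; last exact: ctsN.
apply: ctsM; first exact: (cts_comp (@exprn_continuous R 2) cz).
apply: ctsV; first by rewrite gt_eqF// mulr_gt0// exprn_gt0.
by apply: ctsM; [exact: ctsC|apply: (cts_comp (@exprn_continuous R 2)); exact: cts_fst].
Qed.

Lemma hker_continuous : {for p, continuous (fun q : R * R => hker q.1 q.2 y)}.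
Proof.
apply: ctsD => //; apply: cts_sum => i; apply: ctsM; first exact: ctsC.
by apply: ctsM.
Qed.

Lemma hker_x_continuous : {for p, continuous (fun q : R * R => hker_x q.1 q.2 y)}.
Proof.
apply: ctsD.
  by apply: ctsM => //; apply: ctsN; apply: ctsM.
apply: cts_sum => i; apply: ctsM; first exact: ctsC.
apply: ctsD; apply: ctsM => //.
by apply: ctsM => //; apply: ctsN.
Qed.

Lemma hker_xx_continuous : {for p, continuous (fun q : R * R => hker_xx q.1 q.2 y)}.
Proof.
apply: ctsD; first by apply: ctsM.
apply: cts_sum => i; apply: ctsM; first exact: ctsC.
apply: ctsD.
  apply: ctsD; first by apply: ctsM.
  apply: ctsM; first by apply: ctsM => //; exact: ctsC.
  by apply: ctsM => //; apply: ctsN.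
apply: ctsM => //; apply: ctsD.
  by do 3 apply: ctsM => //.
apply: ctsN; apply: ctsM => //; apply: ctsM => //; exact: ctsC.
Qed.

Lemma hker_t_continuous : {for p, continuous (fun q : R * R => hker_t q.1 q.2 y)}.
Proof.
apply: ctsD; first by apply: ctsM.
apply: cts_sum => i; apply: ctsM; first exact: ctsC.
apply: ctsM => //; apply: ctsD.
  by apply: ctsM => //; exact: ctsC.
apply: ctsM => //; apply: ctsD.
  by do 2 apply: ctsM => //.
by apply: ctsM => //; exact: ctsC.
Qed.

End joint_continuity.

(** Agreement on the half plane t > 0 suffices, as it is open; the derivatives of
    the kernel are only known there. *)
Lemma continuous_pos (p : R * R) (f g : R * R -> R) : 0 < p.1 ->
  (forall q, 0 < q.1 -> f q = g q) -> {for p, continuous f} -> {for p, continuous g}.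
Proof.
move=> p0 fg cf; rewrite /prop_for /continuous_at -(fg p p0).
apply: cvg_trans cf; apply: near_eq_cvg.
have : \forall q \near p, 0 < q.1.
  by have /cvgr_gt/(_ _ p0) := @cts_fst R p.
by apply: filterS => q q0; rewrite fg.
Qed.

Lemma hker_heat_solution (y : R) : heat_solution U (fun t x => hker t x y).
Proof.
have dx t : 0 < t -> (fun x => hker t x y)^`() = (fun x => hker_x t x y).
  by move=> t0; apply/funext => x; apply: derive1_is_derive; exact: is_derive_hker_x.
have dxx t : 0 < t -> (fun x => hker t x y)^`(2)%classic = (fun x => hker_xx t x y).
  move=> t0; apply/funext => x; rewrite /derive1n /= dx//.
  by apply: derive1_is_derive; exact: is_derive_hker_xx.
have dt t x : 0 < t -> (fun t => hker t x y)^`() t = hker_t t x y.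
  by move=> t0; apply: derive1_is_derive; exact: is_derive_hker_t.
split.
- by move=> t x t0; have [] := is_derive_hker_t x y t0.
- by move=> t x t0; have [] := is_derive_hker_x x y t0.
- move=> t x t0; change (derivable (fun x => hker t x y)^`() x 1).
  by rewrite (dx t t0); case: (is_derive_hker_xx x y t0).
- by move=> p p0; exact: (@hker_continuous p y p0).
- move=> p p0.
  apply: (@continuous_pos p (fun q => hker_t q.1 q.2 y) _ p0).
    by move=> q q0; rewrite dt.
  exact: (@hker_t_continuous p y p0).
- move=> p p0.
  apply: (@continuous_pos p (fun q => hker_x q.1 q.2 y) _ p0).
    by move=> q q0; rewrite dx.
  exact: (@hker_x_continuous p y p0).
- move=> p p0.
  apply: (@continuous_pos p (fun q => hker_xx q.1 q.2 y) _ p0).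
    by move=> q q0; rewrite dxx.
  exact: (@hker_xx_continuous p y p0).
- move=> t x t0; rewrite /schrodinger dxx// dt//.
  exact: hker_heat.
Qed.

End soliton_heat_kernel.

(** * The initial condition *)

Section dirac.
Variable R : realType.
Local Notation mu := (@lebesgue_measure R).
Implicit Types (k t x y z : R).

(** The Gauss kernel is a normal density of variance 2 t, whose total mass is
    known. *)
Lemma gker_normal t x y : 0 < t ->
  gker t (x - y) = normal_pdf y (Num.sqrt (2 * t)) x.
Proof.
move=> t0; rewrite normal_pdfE; last by rewrite gt_eqF// sqrtr_gt0 mulr_gt0.
rewrite /gker /normal_peak /normal_fun sqr_sqrtr ?mulr_ge0 ?ltW//.
congr ((Num.sqrt _)^-1 * expR _); first by ring.
by rewrite mulNr (_ : 2 * t *+ 2 = 4 * t)//; ring.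
Qed.

Lemma integrable_gker t y : 0 < t ->
  mu.-integrable setT (EFin \o (fun x => gker t (x - y))).
Proof.
move=> t0; rewrite (_ : _ \o _ = (fun x => (normal_pdf y (Num.sqrt (2 * t)) x)%:E)).
  exact: integrable_normal_pdf.
by apply/funext => x /=; rewrite gker_normal.
Qed.

Lemma Rintegral_gker t y : 0 < t -> \int[mu]_(x in setT) gker t (x - y) = 1.
Proof.
move=> t0; rewrite /Rintegral.
under eq_integral do rewrite gker_normal//.
by rewrite integral_normal_pdf.
Qed.

Lemma gker_ge0 t z : 0 <= gker t z.
Proof. by rewrite mulr_ge0 ?expR_ge0// invr_ge0 sqrtr_ge0. Qed.

(** Away from the diagonal the kernel at time t is bounded by the one at time
    2 t, which has mass 1, with a factor exp (- z ^ 2 / (8 t)) that is at most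
    8 t / d ^ 2. *)
Lemma gker_tail t z d : 0 < t -> 0 < d -> d <= `|z| ->
  gker t z <= Num.sqrt 2 * (8 * t / d ^+ 2) * gker (2 * t) z.
Proof.
move=> t0 d0 dz; rewrite /gker (_ : 4 * pi * (2 * t) = 2 * (4 * pi * t)); last by ring.
rewrite (@sqrtrM _ 2 (4 * pi * t)) ?ler0n// [(Num.sqrt 2 * _)^-1]invfM.
rewrite [leRHS](_ : _ = (Num.sqrt (4 * pi * t))^-1 *
  (8 * t / d ^+ 2 * expR (- (z ^+ 2 / (4 * (2 * t)))))); last first.
  have s2 : Num.sqrt 2 != 0 :> R by rewrite gt_eqF// sqrtr_gt0.
  move: (Num.sqrt (4 * pi * t))^-1 (expR _) => a b.
  field.
  by rewrite s2 gt_eqF.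
apply: ler_wpM2l; first by rewrite invr_ge0 sqrtr_ge0.
rewrite (_ : - (z ^+ 2 / (4 * t)) = - (z ^+ 2 / (8 * t)) + - (z ^+ 2 / (4 * (2 * t)))); last first.
  by field; rewrite gt_eqF.
rewrite expRD ler_wpM2r ?expR_ge0//.
have u0 : 0 < d ^+ 2 / (8 * t) by rewrite divr_gt0 ?mulr_gt0 ?exprn_gt0.
rewrite -(invf_div (d ^+ 2)) expRN lef_pV2 ?posrE ?expR_gt0//.
apply: (@le_trans _ _ (z ^+ 2 / (8 * t))).
  rewrite ler_pM2r ?invr_gt0 ?mulr_gt0// -[leRHS]real_normK ?num_real//.
  by rewrite ler_pXn2r ?nnegrE ?(ltW d0) ?normr_ge0.
by apply: le_trans (expR_ge1Dx _); rewrite lerDr.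
Qed.

Lemma gaussint_lipschitz (a b : R) : `|gaussint a - gaussint b| <= `|a - b|.
Proof.
wlog ab : a b / a <= b.
  move=> h; case: (leP a b) => [|/ltW] ab; first exact: h.
  by rewrite distrC [leRHS]distrC; exact: h.
have [] := @MVT_segment R (@gaussint R) (@gauss_fun R) a b ab.
- by move=> x _; exact: is_derive_gaussint.
- by apply: continuous_subspaceT; exact: gaussint_continuous.
move=> c _ e; rewrite distrC e normrM [leRHS]distrC ler_piMl//.
by rewrite ger0_norm ?gauss_fun_ge0// gauss_fun_le1.
Qed.

(** The two limits of integration are 2 k sqrt t apart, so that S is uniformly
    O(sqrt t) and carries no Dirac mass. *)
Lemma sker_bound k t z : 0 < t ->
  `|sker k t z| <= expR (k ^+ 2 * t) * `|k| * Num.sqrt t / Num.sqrt pi.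
Proof.
move=> t0; have s0 : 0 < Num.sqrt t by rewrite sqrtr_gt0.
have p0 : 0 < Num.sqrt pi :> R by rewrite sqrtr_gt0 pi_gt0.
rewrite /sker normrM [X in X * _]ger0_norm; last first.
  by rewrite divr_ge0 ?expR_ge0// mulr_ge0// ltW.
rewrite [leRHS](_ : _ = expR (k ^+ 2 * t) / (2 * Num.sqrt pi) * (2 * `|k| * Num.sqrt t)); last first.
  by field; rewrite gt_eqF.
apply: ler_wpM2l; first by rewrite divr_ge0 ?expR_ge0// mulr_ge0// ltW.
apply: le_trans (gaussint_lipschitz _ _) _.
rewrite [X in `|X|](_ : _ = 2 * k * Num.sqrt t).
  by rewrite !normrM (ger0_norm (ltW s0)) ger0_norm.
have tt : t = Num.sqrt t ^+ 2 by rewrite sqr_sqrtr// ltW.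
rewrite {1 3}tt; move: (Num.sqrt t) s0 => w w0; field.
by rewrite gt_eqF.
Qed.

Section test_function.
Variables (psi : R -> R).
Hypothesis psi_continuous : continuous psi.
Hypothesis psi_compact : exists M : R, forall x, M < `|x| -> psi x = 0.

(** A Gaussian majorant of the test function makes all integrals against it
    converge, and serves as the dominating function. *)
Lemma gauss_majorant : exists2 B : R, 0 <= B & forall x, `|psi x| <= B * gauss_fun x.
Proof.
have [M hM] := psi_compact.
(* The support bound M may be negative. *)
pose M1 := `|M|.
have [B hB] : exists B : R, forall x, x \in `[- M1, M1]%R -> `|psi x| <= B.
  have cf : {within `[- M1, M1], continuous (fun x => `|psi x|)}.
    apply: continuous_subspaceT => x; apply: continuous_comp; first exact: psi_continuous.
    exact: norm_continuous.
  have [c _ hc] := @EVT_max R (fun x => `|psi x|) (- M1) M1 (ge0_cp (normr_ge0 M)).2 cf.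
  by exists `|psi c|.
have B0 : 0 <= B.
  apply: le_trans (hB 0 _); first exact: normr_ge0.
  by rewrite in_itv/= oppr_le0 normr_ge0.
exists (B * expR (M1 ^+ 2)); first by rewrite mulr_ge0// expR_ge0.
move=> x; case: (leP `|x| M1) => xM; last first.
  rewrite hM; last by apply: le_lt_trans xM; exact: ler_norm.
  by rewrite normr0 !mulr_ge0// ?expR_ge0 ?gauss_fun_ge0.
apply: (@le_trans _ _ B); first by apply: hB; rewrite in_itv/= -ler_norml.
rewrite -mulrA ler_peMr// /gauss_fun -expRD -[leLHS]expR0 ler_expR subr_ge0.
by rewrite -[leLHS]real_normK ?num_real// ler_pXn2r ?nnegrE ?normr_ge0.
Qed.

Lemma psi_measurable : measurable_fun setT psi.
Proof. exact: continuous_measurable_fun. Qed.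

Lemma gker_measurable t y : 0 < t -> measurable_fun setT (fun x : R => gker t (x - y)).
Proof.
move=> t0; apply: continuous_measurable_fun.
apply: (@derive_continuous _ _ (fun x => - ((x - y) / (2 * t)) * gker t (x - y))) => x.
exact: derive_shift (is_derive_gker_x _ t0).
Qed.

Lemma integrable_gker_mul t y : 0 < t ->
  mu.-integrable setT (EFin \o (fun x => gker t (x - y) * psi x)).
Proof.
move=> t0; have [B B0 hB] := gauss_majorant.
have hB1 x : `|psi x| <= B.
  by apply: le_trans (hB x) _; rewrite ler_piMr// gauss_fun_le1.
have h := integrableZl measurableT B (integrable_gker y t0).
apply: (le_integrable measurableT _ _ h).
  by apply/measurable_EFinP; apply: measurable_funM; [exact: gker_measurable|exact: psi_measurable].
move=> x _ /=; rewrite lee_fin [X in X <= _]normrM [X in _ <= X]normrM mulrC (ger0_norm (gker_ge0 _ _)).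
by rewrite ler_wpM2r ?gker_ge0// (le_trans (hB1 x))// ler_norm.
Qed.

Lemma gker_dirac y :
  \int[mu]_(x in setT) (gker t (x - y) * psi x) @[t --> 0^'+] --> psi y.
Proof.
have [B B0 hB] := gauss_majorant.
have hB1 x : `|psi x| <= B.
  by apply: le_trans (hB x) _; rewrite ler_piMr// gauss_fun_le1.
apply/cvgrPdist_le => e e0.
have e20 : 0 < e / 2 by rewrite divr_gt0.
have [d d0 hd] : exists2 d : R, 0 < d & forall x, `|y - x| < d -> `|psi y - psi x| <= e / 2.
  have /cvgrPdist_le/(_ _ e20) := @psi_continuous y.
  by move=> [d d0 hd]; exists d.
(* Beyond distance d the integrand is at most 2 B times the Gauss kernel, and
   the other factors are those of the tail bound. *)
pose K := 2 * B * Num.sqrt 2 * (8 / d ^+ 2).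
have K0 : 0 <= K by rewrite !mulr_ge0 ?sqrtr_ge0 ?invr_ge0 ?sqr_ge0.
near=> t.
have t0 : 0 < t by near: t; exact: nbhs_right_gt.
have t20 : 0 < 2 * t by rewrite mulr_gt0.
have i1 := integrable_gker y t0.
have i2 := integrable_gker y t20.
rewrite -[X in X - _]mulr1 -(Rintegral_gker y t0) -RintegralZl//.
rewrite -RintegralB//; last exact: integrable_gker_mul; last exact: (integrableZl measurableT (psi y) i1).
have i3 := integrableZl measurableT (e / 2) i1.
have i4 := integrableZl measurableT (K * t) i2.
have i5 : mu.-integrable setT (EFin \o (fun x => psi y * gker t (x - y) - gker t (x - y) * psi x)).
  exact: (integrableB measurableT (integrableZl measurableT (psi y) i1) (integrable_gker_mul y t0)).
have i6 : mu.-integrable setT (EFin \o (fun x => e / 2 * gker t (x - y) + K * t * gker (2 * t) (x - y))).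
  exact: (integrableD measurableT i3 i4).
apply: le_trans (le_normr_Rintegral measurableT i5) _.
apply: (@le_trans _ _ (\int[mu]_(x in setT) (e / 2 * gker t (x - y) + K * t * gker (2 * t) (x - y)))).
  apply: le_Rintegral => //.
    exact: (integrable_norm i5).
  move=> x _; rewrite [gker t _ * psi x]mulrC -mulrBl normrM (ger0_norm (gker_ge0 _ _)).
  have [xd|xd] := ltP `|y - x| d.
    apply: (@le_trans _ _ (e / 2 * gker t (x - y))).
      by apply: ler_wpM2r; [exact: gker_ge0|exact: hd].
    by rewrite lerDl; apply: mulr_ge0 (gker_ge0 _ _); apply: mulr_ge0 => //; exact: ltW.
  apply: (@le_trans _ _ (K * t * gker (2 * t) (x - y))); last first.
    by rewrite lerDr; apply: mulr_ge0 (gker_ge0 _ _); exact: ltW.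
  rewrite distrC in xd.
  apply: (@le_trans _ _ (2 * B * gker t (x - y))).
    apply: ler_wpM2r; first exact: gker_ge0.
    apply: le_trans (ler_normB _ _) _.
    by rewrite mulr_natl mulr2n lerD.
  rewrite (_ : K * t * _ = 2 * B * (Num.sqrt 2 * (8 * t / d ^+ 2) * gker (2 * t) (x - y))); last by rewrite /K; ring.
  apply: ler_wpM2l; first by rewrite mulr_ge0.
  exact: gker_tail.
have e1 : \int[mu]_(x in setT) (e / 2 * gker t (x - y)) = e / 2.
  by apply: etrans (RintegralZl _ measurableT i1) _; rewrite Rintegral_gker// mulr1.
have e2 : \int[mu]_(x in setT) (K * t * gker (2 * t) (x - y)) = K * t.
  by apply: etrans (RintegralZl _ measurableT i2) _; rewrite Rintegral_gker// mulr1.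
rewrite RintegralD// e1 e2.
rewrite [leRHS](splitr e) lerD2l.
have tK : t <= e / 2 / (K + 1).
  by near: t; apply: nbhs_right_le; rewrite divr_gt0// ltr_wpDl.
apply: (@le_trans _ _ ((K + 1) * t)); first by rewrite ler_pM2r// lerDl.
by rewrite mulrC -ler_pdivlMr// ltr_wpDl.
Unshelve. all: by end_near. Qed.

Lemma sker_measurable k t y : 0 < t -> measurable_fun setT (fun x : R => sker k t (x - y)).
Proof.
move=> t0; apply: continuous_measurable_fun.
apply: (@derive_continuous _ _ (fun x => - gker t (x - y) * sinhR (k * (x - y)))) => x.
exact: derive_shift (is_derive_sker_x _ _ t0).
Qed.

Lemma integrable_sker k t y : 0 < t ->
  mu.-integrable setT (EFin \o (fun x => psi x * sker k t (x - y))).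
Proof.
move=> t0; have [B B0 hB] := gauss_majorant.
pose C := expR (k ^+ 2 * t) * `|k| * Num.sqrt t / Num.sqrt pi.
have h := integrableZl measurableT (B * C) (@integrableT_gauss R).
apply: (le_integrable measurableT _ _ h).
  by apply/measurable_EFinP; apply: measurable_funM; [exact: psi_measurable|exact: sker_measurable].
move=> x _ /=; rewrite lee_fin normrM.
apply: le_trans (ler_norm _); rewrite mulrAC.
by apply: ler_pM => //; exact: sker_bound.
Qed.

Lemma sker_dirac k y :
  \int[mu]_(x in setT) (psi x * sker k t (x - y)) @[t --> 0^'+] --> (0 : R).
Proof.
have [B B0 hB] := gauss_majorant.
pose C t := expR (k ^+ 2 * t) * `|k| * Num.sqrt t / Num.sqrt pi * (B * Num.sqrt pi).
have C0 : C t @[t --> 0^'+] --> (0 : R).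
  apply: cvg_at_right_filter.
  have C00 : C 0 = 0 by rewrite /C sqrtr0 mulr0 !mul0r.
  suff : C t @[t --> (0 : R)] --> C 0 by rewrite C00.
  have c1 : {for 0, continuous (fun t : R => expR (k ^+ 2 * t))}.
    apply: continuous_comp; last exact: continuous_expR.
    by apply: cvgM; [exact: cvg_cst|exact: cvg_id].
  apply: cvgM; last exact: cvg_cst.
  apply: cvgM; last exact: cvg_cst.
  apply: cvgM; last exact: (@sqrt_continuous R 0).
  apply: cvgM; last exact: cvg_cst.
  exact: c1.
apply/norm_cvg0P.
apply: (@squeeze_cvgr _ _ _ _ (cst 0) C) => //; last exact: cvg_cst.
near=> t.
have t0 : 0 < t by near: t; exact: nbhs_right_gt.
rewrite normr_ge0/=.
apply: le_trans (le_normr_Rintegral measurableT (integrable_sker k y t0)) _.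
pose c := expR (k ^+ 2 * t) * `|k| * Num.sqrt t / Num.sqrt pi.
have h := integrableZl measurableT (c * B) (@integrableT_gauss R).
apply: (@le_trans _ _ (\int[mu]_(x in setT) (c * B * gauss_fun x))).
  apply: le_Rintegral => //.
    exact: (integrable_norm (integrable_sker k y t0)).
  move=> x _; rewrite normrM mulrC -mulrA.
  by apply: ler_pM => //; exact: sker_bound.
rewrite RintegralZl//; last exact: integrableT_gauss.
by rewrite /Rintegral integralT_gauss/= /C mulrA.
Unshelve. all: by end_near. Qed.
End test_function.

End dirac.

Section fundamental.
Variables (R : realType) (N : nat) (kappa : 'I_N -> R).
Variables (chi dchi ddchi : 'I_N -> R -> R) (U : R -> R).
Hypothesis chi1 : forall i (x : R), is_derive x 1 (chi i) (dchi i x).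
Hypothesis chi2 : forall i (x : R), is_derive x 1 (dchi i) (ddchi i x).
Hypothesis ddchi_continuous : forall i, continuous (ddchi i).
Hypothesis eigen : forall i x,
  ddchi i x + U x * chi i x = kappa i ^+ 2 * chi i x.
Hypothesis potential : forall x y,
  4 * (\sum_(i < N) chi i y * (dchi i x * sinhR (kappa i * (x - y)) +
    kappa i * chi i x * coshR (kappa i * (x - y)))) = U x.
Local Notation mu := (@lebesgue_measure R).

Lemma Rintegral_sum_ord n (f : 'I_n -> R -> R) :
  (forall i, mu.-integrable setT (EFin \o f i)) ->
  mu.-integrable setT (EFin \o (fun x => \sum_(i < n) f i x)) /\
  \int[mu]_(x in setT) (\sum_(i < n) f i x) = \sum_(i < n) \int[mu]_(x in setT) f i x.
Proof.
elim: n f => [|n IH] f fi.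
  split.
    rewrite (_ : _ \o _ = cst 0%E); first exact: integrable0.
    by apply/funext => x /=; rewrite big_ord0.
  rewrite big_ord0 (_ : (fun _ => _) = (fun=> 0)); first by rewrite Rintegral_cst// mul0r.
  by apply/funext => x; rewrite big_ord0.
have [i1 i2] := IH (fun i => f (widen_ord (leqnSn n) i)) (fun i => fi _).
rewrite (_ : (fun x => \sum_(i < n.+1) f i x) =
  (fun x => \sum_(i < n) f (widen_ord (leqnSn n) i) x + f ord_max x)); last first.
  by apply/funext => x; rewrite big_ord_recr.
split; first exact: (integrableD measurableT i1 (fi ord_max)).
by rewrite RintegralD// i2 big_ord_recr.
Qed.

(** Only the free kernel contributes in the limit: the factor chi_i is absorbed
    in the test function, and [sker_dirac] applies to what remains. *)
Lemma hker_dirac y : dirac_initial y (fun t x => hker kappa chi t x y).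
Proof.
move=> phi cphi [M hM].
have ephi : exists M : R, forall x, M < `|x| -> phi x = 0 by exists M.
pose psi i x := chi i x * phi x.
have cpsi i : continuous (psi i).
  move=> x; apply: cvgM; last exact: cphi.
  exact: (derive_continuous (chi1 i)).
have epsi i : exists M : R, forall x, M < `|x| -> psi i x = 0.
  by exists M => x /hM h; rewrite /psi h mulr0.
have : \int[mu]_(x in setT) (gker t (x - y) * phi x) +
    \sum_(i < N) 2 * chi i y * \int[mu]_(x in setT) (psi i x * sker (kappa i) t (x - y))
    @[t --> 0^'+] --> phi y + \sum_(i < N) 2 * chi i y * 0.
  apply: cvgD; first exact: gker_dirac.
  apply: cvg_big; first exact: add_continuous.
  move=> i _; apply: cvgM; first exact: cvg_cst.
  exact: sker_dirac.
rewrite [X in _ + X]big1; last by move=> i _; rewrite mulr0.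
rewrite addr0; apply: cvg_trans; apply: near_eq_cvg.
near=> t.
have t0 : 0 < t by near: t; exact: nbhs_right_gt.
rewrite (_ : (fun x => hker kappa chi t x y * phi x) = (fun x => gker t (x - y) * phi x +
  \sum_(i < N) 2 * chi i y * (psi i x * sker (kappa i) t (x - y)))); last first.
  apply/funext => x; rewrite mulrDl mulr_suml; congr (_ + _).
  by apply: eq_bigr => i _; rewrite /psi; ring.
have ik i := integrable_sker (cpsi i) (epsi i) (kappa i) y t0.
have ik2 i : mu.-integrable setT (EFin \o (fun x => 2 * chi i y * (psi i x * sker (kappa i) t (x - y)))).
  exact: (integrableZl measurableT (2 * chi i y) (ik i)).
have [i1 i2] := Rintegral_sum_ord ik2.
rewrite RintegralD//; last exact: integrable_gker_mul.
rewrite i2; congr (_ + _); apply: eq_bigr => i _.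
by rewrite -RintegralZl.
Unshelve. all: by end_near. Qed.

Lemma hker_fundamental : fundamental_solution U (hker kappa chi).
Proof.
move=> y; split; last exact: hker_dirac.
exact: (hker_heat_solution chi1 chi2 ddchi_continuous eigen potential).
Qed.

End fundamental.

(** * Expansion on the diagonal *)

Section diagonal.
Variable R : realType.
Implicit Types (k t u x y : R).

Definition gauss_odd u : R := gaussint u - gaussint (- u).

(** The Taylor coefficients of F(u) = exp (u ^ 2) \int_(-u)^u exp (- w ^ 2) dw,
    a multiple of the Dawson function at i u: they are read off from
    F' = 2 + 2 u F. *)
Definition dawson_coef (m : nat) : R := 2 * 4 ^+ m * m`!%:R / (2 * m).+1`!%:R.

Lemma dawson_coef0 : dawson_coef 0 = 2.
Proof. by rewrite /dawson_coef muln0 !fact0 factS fact0 expr0 divr1 !mulr1. Qed.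

Lemma dawson_coefS m :
  (2 * m.+1).+1%:R * dawson_coef m.+1 = 2 * dawson_coef m.
Proof.
rewrite /dawson_coef (_ : (2 * m.+1) = (2 * m).+2)%N; last by lia.
rewrite !factS !natrM exprS.
have f0 : (2 * m)`!%:R != 0 :> R by rewrite pnatr_eq0 -lt0n fact_gt0.
field.
have m0 : 0 <= m%:R :> R by [].
rewrite f0 /=; apply/and3P; split; apply: lt0r_neq0; lra.
Qed.

Lemma dawson_coef_ge0 m : 0 <= dawson_coef m.
Proof. by rewrite /dawson_coef divr_ge0// !mulr_ge0// exprn_ge0. Qed.

Definition dawson_poly (M : nat) u : R := \sum_(m < M) dawson_coef m * u ^+ (2 * m).+1.

Lemma derive_exprS n u :
  is_derive u 1 (fun v : R => v ^+ n.+1) (n.+1%:R * u ^+ n).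
Proof.
rewrite (_ : (fun v : R => v ^+ n.+1) = id ^+ n.+1).
  by apply: (is_derive_eq (is_deriveX n.+1 (is_derive_id u 1))); rewrite /GRing.scale/= mulr1.
by apply/funext => v; rewrite exprfctE.
Qed.

Lemma is_derive_dawson_poly M u : is_derive u 1 (dawson_poly M)
  (2 + 2 * u * dawson_poly M u - (2 * M).+1%:R * dawson_coef M * u ^+ (2 * M)).
Proof.
elim: M => [|M IH].
  rewrite /dawson_poly big_ord0 dawson_coef0 muln0 expr0 (_ : (fun u => _) = cst 0).
    by apply: is_derive_eq; ring.
  by apply/funext => v; rewrite big_ord0.
rewrite /dawson_poly big_ord_recr /= (_ : (fun u => _) =
  (fun u => dawson_poly M u + dawson_coef M * u ^+ (2 * M).+1)); last first.
  by apply/funext => v; rewrite /dawson_poly big_ord_recr.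
have hX := derive_exprS (2 * M) u.
apply: (is_derive_eq (derive_add IH (derive_mull _ hX))).
rewrite dawson_coefS -/(dawson_poly M u) (_ : (2 * M.+1)%N = (2 * M).+2); last by lia.
rewrite !exprS; ring.
Qed.

(** The truncated series solves F' = 2 + 2 u F up to its last term, so that the
    difference on the left has derivative exp (- u ^ 2) times that term; the
    mean value theorem bounds it. *)
Lemma gauss_odd_expansion M u : 0 <= u ->
  `|gauss_odd u - gauss_fun u * dawson_poly M u| <=
  (2 * M).+1%:R * dawson_coef M * u ^+ (2 * M).+1.
Proof.
move=> u0.
pose g v := gauss_odd v - gauss_fun v * dawson_poly M v.
pose dg v : R := gauss_fun v * ((2 * M).+1%:R * dawson_coef M * v ^+ (2 * M)).
have hg (v : R) : is_derive v 1 g (dg v).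
  have h1 : is_derive v 1 (fun v : R => - v) (- 1) := is_deriveNid v 1.
  have h2 := is_derive_gaussint_comp h1.
  have h3 := derive_exprS 1 v.
  have h4 : is_derive v 1 (@gauss_fun R) _ := derive_expR (derive_opp h3).
  have h5 := derive_mul h4 (is_derive_dawson_poly M v).
  apply: (is_derive_eq (derive_add (derive_add (is_derive_gaussint v) (derive_opp h2)) (derive_opp h5))).
  rewrite /dg (_ : gauss_fun (- v) = gauss_fun v); last by rewrite /gauss_fun sqrrN.
  rewrite -/(gauss_fun v); ring.
have [c + e] := @MVT_segment R g dg 0 u u0 (fun x _ => hg x)
  (continuous_subspaceT (derive_continuous hg)).
rewrite in_itv/= => /andP[c0 cu].
have -> : gauss_odd u - gauss_fun u * dawson_poly M u = g u - g 0.
  rewrite /g /gauss_odd oppr0 subrr (_ : dawson_poly M 0 = 0) ?mulr0 ?subr0//.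
  by rewrite /dawson_poly big1// => i _; rewrite expr0n mulr0.
rewrite e subr0 ger0_norm; last first.
  rewrite mulr_ge0// /dg mulr_ge0 ?gauss_fun_ge0// mulr_ge0 ?exprn_ge0 ?(ltW c0)//.
  by rewrite mulr_ge0// dawson_coef_ge0.
rewrite exprSr mulrA ler_wpM2r//.
apply: (@le_trans _ _ ((2 * M).+1%:R * dawson_coef M * c ^+ (2 * M))).
  rewrite /dg ler_piMl ?gauss_fun_le1// mulr_ge0 ?exprn_ge0 ?(ltW c0)//.
  by rewrite mulr_ge0// dawson_coef_ge0.
by rewrite ler_wpM2l ?lerXn2r ?nnegrE ?(ltW c0) ?(ltW cu)// mulr_ge0// dawson_coef_ge0.
Qed.

Lemma sker_diagonal k t : 0 < t ->
  Num.sqrt (4 * pi * t) * sker k t 0 =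
  Num.sqrt t * (gauss_fun (k * Num.sqrt t))^-1 * gauss_odd (k * Num.sqrt t).
Proof.
move=> t0; rewrite /sker !add0r sqrt_4pit ?ltW// /gauss_odd /gauss_fun.
have tt : t = Num.sqrt t ^+ 2 by rewrite sqr_sqrtr// ltW.
have w0 : Num.sqrt t != 0 by rewrite gt_eqF// sqrtr_gt0.
have p0 : Num.sqrt pi != 0 :> R by rewrite gt_eqF// sqrtr_gt0 pi_gt0.
have -> : 2 * k * t / (2 * Num.sqrt t) = k * Num.sqrt t.
  rewrite {1}tt; move: (Num.sqrt t) w0 => w w0; field.
  by rewrite w0.
have -> : - (2 * k * t) / (2 * Num.sqrt t) = - (k * Num.sqrt t).
  rewrite {1}tt; move: (Num.sqrt t) w0 => w w0; field.
  by rewrite w0.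
rewrite -expRN opprK exprMn -tt.
by field.
Qed.

(** At z = 0 the kernel is sqrt t F(k sqrt t) with the function F of
    [dawson_coef], odd in its argument, so that only integral powers of t occur. *)
Lemma sker_expansion k (N : nat) : 0 < k ->
  (Num.sqrt (4 * pi * t) * sker k t 0 -
   \sum_(m < N) dawson_coef m * k ^+ (2 * m).+1 * t ^+ m.+1) / t ^+ N
   @[t --> 0^'+] --> (0 : R).
Proof.
move=> k0.
pose C t : R := (gauss_fun (k * Num.sqrt t))^-1 *
   ((2 * N).+1%:R * dawson_coef N * k ^+ (2 * N).+1) * t.
have C0 : C t @[t --> 0^'+] --> (0 : R).
  apply: cvg_at_right_filter.
  have C00 : C 0 = 0 by rewrite /C mulr0.
  suff : C t @[t --> (0 : R)] --> C 0 by rewrite C00.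
  apply: cvgM; last exact: cvg_id.
  apply: cvgM; last exact: cvg_cst.
  apply: cvgV; first by rewrite gt_eqF// expR_gt0.
  apply: continuous_comp; last exact: continuous_gauss_fun.
  apply: cvgM; first exact: cvg_cst.
  exact: (@sqrt_continuous R 0).
apply/norm_cvg0P.
apply: (@squeeze_cvgr _ _ _ _ (cst 0) C) => //; last exact: cvg_cst.
near=> t.
have t0 : 0 < t by near: t; exact: nbhs_right_gt.
rewrite normr_ge0/= normrM normfV (ger0_norm (exprn_ge0 _ (ltW t0))).
rewrite ler_pdivrMr ?exprn_gt0// sker_diagonal//.
set w := Num.sqrt t.
have w0 : 0 < w by rewrite sqrtr_gt0.
have tt : t = w ^+ 2 by rewrite sqr_sqrtr// ltW.
have g0 : 0 < gauss_fun (k * w) by exact: expR_gt0.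
have -> : \sum_(m < N) dawson_coef m * k ^+ (2 * m).+1 * t ^+ m.+1 =
    w * (gauss_fun (k * w))^-1 * (gauss_fun (k * w) * dawson_poly N (k * w)).
  rewrite -mulrA mulKf ?gt_eqF// /dawson_poly mulr_sumr; apply: eq_bigr => m _.
  rewrite exprMn tt -exprM (_ : (2 * m.+1 = (2 * m).+2)%N) ?[w ^+ _.+2]exprS; last by lia.
  by ring.
rewrite -mulrBr !normrM (ger0_norm (ltW w0)) ger0_norm ?invr_ge0 ?(ltW g0)//.
rewrite /C -/w [w * _]mulrC -!mulrA ler_wpM2l ?invr_ge0 ?(ltW g0)//.
apply: le_trans (ler_wpM2l (ltW w0) (gauss_odd_expansion N _)) _.
  by rewrite mulr_ge0// ltW.
rewrite exprMn [X in _ <= X](_ : _ = w * ((2 * N).+1%:R * dawson_coef N * (k ^+ (2 * N).+1 * w ^+ (2 * N).+1)))//.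
by rewrite tt -exprM [w ^+ (2 * N).+1]exprS /dawson_coef; ring.
Unshelve. all: by end_near. Qed.

(** The coefficient of t ^ n on the diagonal, times sqrt (4 pi t); the 1 comes from
    the free kernel. *)
Definition soliton_coef N (kappa chi : 'I_N -> R) (n : nat) : R :=
  if n is m.+1 then 2 * \sum_(i < N) chi i ^+ 2 * (dawson_coef m * kappa i ^+ (2 * m).+1)
  else 1.

Lemma hker_expansion N (kappa : 'I_N -> R) (chi : 'I_N -> R -> R) y :
  (forall i, 0 < kappa i) ->
  heat_expansion (fun t => hker kappa chi t y y)
    (soliton_coef kappa (fun i => chi i y)).
Proof.
move=> k0 M.
have : \sum_(i < N) 2 * chi i y ^+ 2 *
   ((Num.sqrt (4 * pi * t) * sker (kappa i) t 0 -
   \sum_(m < M) dawson_coef m * kappa i ^+ (2 * m).+1 * t ^+ m.+1) / t ^+ M)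
    @[t --> 0^'+] --> \sum_(i < N) 2 * chi i y ^+ 2 * 0.
  apply: cvg_big; first exact: add_continuous.
  move=> i _; apply: cvgM; first exact: cvg_cst.
  exact: sker_expansion.
rewrite [X in _ --> X]big1; last by move=> i _; rewrite mulr0.
apply: cvg_trans; apply: near_eq_cvg.
near=> t.
have t0 : 0 < t by near: t; exact: nbhs_right_gt.
rewrite /hker subrr (mulrDr (Num.sqrt _)) big_ord_recl expr0 mulr1 /=.
have -> : Num.sqrt (4 * pi * t) * gker t 0 = 1.
  rewrite /gker expr0n/= mul0r oppr0 expR0 mulr1 divff// gt_eqF// sqrtr_gt0.
  by rewrite !mulr_gt0// pi_gt0.
rewrite opprD addrACA subrr add0r mulr_sumr.
have -> : \sum_(n < M) 2 * (\sum_(i < N) chi i y ^+ 2 *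
     (dawson_coef n * kappa i ^+ (2 * n).+1)) * t ^+ n.+1 =
   \sum_(i < N) \sum_(n < M) 2 * chi i y ^+ 2 *
     (dawson_coef n * kappa i ^+ (2 * n).+1 * t ^+ n.+1).
  rewrite exchange_big; apply: eq_bigr => n _.
  by rewrite mulr_sumr mulr_suml; apply: eq_bigr => i _; ring.
rewrite -sumrB mulr_suml; apply: eq_bigr => i _.
by rewrite -mulr_sumr; ring.
Unshelve. all: by end_near. Qed.
End diagonal.

(** * Reflectionless potentials *)

Section derivable_matrix.
Variable R : realType.
Implicit Types x : R.

Lemma derivable_bigsum (I : Type) (r : seq I) (P : pred I) (F : I -> R -> R) x :
  (forall i, derivable (F i) x 1) ->
  derivable (fun y => \sum_(i <- r | P i) F i y) x 1.
Proof.
move=> dF; elim: r => [|i r IH].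
  rewrite (_ : (fun _ => _) = cst 0); first exact: derivable_cst.
  by apply/funext => y; rewrite big_nil.
rewrite (_ : (fun _ => _) = (fun y => (if P i then F i y else 0) + \sum_(i <- r | P i) F i y)).
  apply: derivableD; last exact: IH.
  by case: (P i); [exact: dF|exact: derivable_cst].
by apply/funext => y; rewrite big_cons; case: (P i); rewrite ?add0r.
Qed.

Lemma derivable_bigprod (I : Type) (r : seq I) (P : pred I) (F : I -> R -> R) x :
  (forall i, derivable (F i) x 1) ->
  derivable (fun y => \prod_(i <- r | P i) F i y) x 1.
Proof.
move=> dF; elim: r => [|i r IH].
  rewrite (_ : (fun _ => _) = cst 1); first exact: derivable_cst.
  by apply/funext => y; rewrite big_nil.
rewrite (_ : (fun _ => _) = (fun y => (if P i then F i y else 1) * \prod_(i <- r | P i) F i y)).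
  apply: derivableM; last exact: IH.
  by case: (P i); [exact: dF|exact: derivable_cst].
by apply/funext => y; rewrite big_cons; case: (P i); rewrite ?mul1r.
Qed.

Lemma derivable_det n (A : R -> 'M[R]_n) x :
  (forall i j, derivable (fun y => A y i j) x 1) ->
  derivable (fun y => \det (A y)) x 1.
Proof.
move=> dA; apply: derivable_bigsum => s.
by apply: derivableM; [exact: derivable_cst|exact: derivable_bigprod].
Qed.

(** By Cramer's rule, the entries of the inverse are quotients of determinants. *)
Lemma derivable_invmx n (A : R -> 'M[R]_n) x :
  (forall y, A y \in unitmx) ->
  (forall i j, derivable (fun y => A y i j) x 1) ->
  forall i j, derivable (fun y => invmx (A y) i j) x 1.
Proof.
move=> uA dA i j.
rewrite (_ : (fun y => _) = (fun y => (\det (A y))^-1 * \adj (A y) i j)); last first.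
  by apply/funext => y; rewrite /invmx uA !mxE.
apply: derivableM.
  apply: derivableV; last exact: derivable_det.
  by have := uA x; rewrite unitmxE unitfE.
rewrite (_ : (fun y => _) = (fun y => (-1) ^+ (j + i) * \det (row' j (col' i (A y))))); last first.
  by apply/funext => y; rewrite mxE.
apply: derivableM; first exact: derivable_cst.
apply: derivable_det => k l.
rewrite (_ : (fun y => _) = (fun y => A y (lift j k) (lift i l)))//.
by apply/funext => y; rewrite !mxE.
Qed.

End derivable_matrix.

Section soliton.
Variables (R : realType) (N : nat) (kappa gamma : 'I_N -> R).
Hypothesis kappa_gt0 : forall i, 0 < kappa i.
Implicit Types x y : R.

Definition expo i x : R := gamma i * expR (- kappa i * x).

Definition gram x : 'M[R]_N :=
  \matrix_(i, j) (expo i x * expo j x / (kappa i + kappa j)).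

Lemma is_derive_expo i x : is_derive x 1 (expo i) (- kappa i * expo i x).
Proof.
apply: (is_derive_eq (derive_mull _ (derive_expR (derive_mull (- kappa i) (is_derive_id x 1))))).
by rewrite /expo; ring.
Qed.

Lemma kappaD_neq0 i j : kappa i + kappa j != 0.
Proof. by rewrite gt_eqF// addr_gt0. Qed.

Lemma is_derive_gram i j x :
  is_derive x 1 (fun y => gram y i j) (- (expo i x * expo j x)).
Proof.
rewrite (_ : (fun y => _) = (fun y => expo i y * expo j y * (kappa i + kappa j)^-1)); last first.
  by apply/funext => y; rewrite mxE.
apply: (is_derive_eq (derive_mulr _ (derive_mul (is_derive_expo i x) (is_derive_expo j x)))).
have := kappaD_neq0 i j; move: (expo i x) (expo j x) => a b h.
by field.
Qed.

Section gram_form.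
Variable v : 'I_N -> R.

Definition gram_form x : R := \sum_(i < N) \sum_(j < N) v i * v j * gram x i j.

Lemma is_derive_gram_form x :
  is_derive x 1 gram_form (- (\sum_(i < N) v i * expo i x) ^+ 2).
Proof.
rewrite /gram_form.
have h : is_derive x 1 (fun x => \sum_(i < N) \sum_(j < N) v i * v j * gram x i j)
  (\sum_(i < N) \sum_(j < N) v i * v j * - (expo i x * expo j x)).
  by do 2 apply: derive_sum => ?; apply: derive_mull; exact: is_derive_gram.
apply: (is_derive_eq h).
rewrite expr2 big_distrlr/= -sumrN; apply: eq_bigr => i _.
by rewrite -sumrN; apply: eq_bigr => j _; ring.
Qed.

Lemma cvg_expR_scaleN (k : R) : 0 < k -> expR (- k * x) @[x --> +oo%R] --> (0 : R).
Proof.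
move=> k0; rewrite (_ : (fun x => _) = (fun x => expR (- x)) \o (fun x => k * x)); last first.
  by apply/funext => x /=; rewrite mulNr.
apply: cvg_comp; last exact: cvgr_expR.
by apply: gt0_cvgMry => //; exact: cvg_id.
Qed.

Lemma cvg_gram_form : gram_form x @[x --> +oo%R] --> (0 : R).
Proof.
have ce i : expo i x @[x --> +oo%R] --> (0 : R).
  rewrite -[X in _ --> X](mulr0 (gamma i)); apply: cvgM; first exact: cvg_cst.
  exact: cvg_expR_scaleN.
have : \sum_(i < N) \sum_(j < N) v i * v j * (expo i x * expo j x * (kappa i + kappa j)^-1)
   @[x --> +oo%R] --> \sum_(i < N) \sum_(j < N) v i * v j * (0 * 0 * (kappa i + kappa j)^-1).
  apply: cvg_big => [|i _]; first exact: add_continuous.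
  apply: cvg_big => [|j _]; first exact: add_continuous.
  apply: cvgM; first exact: cvg_cst.
  apply: cvgM; last exact: cvg_cst.
  exact: cvgM.
rewrite [\sum_(i < N) \sum_(j < N) _ * (0 * 0 * _)]big1; last first.
  by move=> i _; rewrite big1// => j _; rewrite !mul0r mulr0.
rewrite (_ : (fun x => _) = gram_form)//; apply/funext => x.
by apply: eq_bigr => i _; apply: eq_bigr => j _; rewrite mxE.
Qed.

(** The derivative of the form is minus a square, and the form tends to 0 at
    infinity: it is the integral of that square over a half line. *)
Lemma gram_form_ge0 x : 0 <= gram_form x.
Proof.
have dec y : x <= y -> gram_form y <= gram_form x.
  move=> xy; have [c _ e] := @MVT_segment R gram_form _ x y xy (fun z _ => is_derive_gram_form z)
    (continuous_subspaceT (derive_continuous is_derive_gram_form)).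
  rewrite -subr_le0 e mulr_le0_ge0 ?subr_ge0//.
  by rewrite oppr_le0 sqr_ge0.
rewrite -(cvg_lim (@Rhausdorff R) cvg_gram_form).
apply: limr_le; first by apply/cvg_ex; exists 0; exact: cvg_gram_form.
by near=> y; apply: dec; near: y; apply: nbhs_pinfty_ge; exact: num_real.
Unshelve. all: by end_near. Qed.

End gram_form.

(** The potential below is twice the second logarithmic derivative of the
    determinant of this matrix. *)
Definition soliton_mx x : 'M[R]_N := 1%:M + gram x.

(** The identity plus a positive semidefinite matrix. *)
Lemma soliton_mx_unit x : soliton_mx x \in unitmx.
Proof.
rewrite unitmxE unitfE; apply/det0P => -[v v0 vA].
have : (v *m soliton_mx x *m v^T) 0 0 = 0 by rewrite vA mul0mx mxE.
rewrite mulmxDr mulmx1 mulmxDl mxE.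
have -> : (v *m gram x *m v^T) 0 0 = gram_form (v 0) x.
  rewrite mxE /gram_form exchange_big; apply: eq_bigr => j _.
  by rewrite !mxE mulr_suml; apply: eq_bigr => i _; ring.
move=> /eqP; rewrite paddr_eq0 ?gram_form_ge0//; last first.
  by rewrite mxE sumr_ge0// => i _; rewrite mxE -expr2 sqr_ge0.
move=> /andP[+ _]; rewrite mxE psumr_eq0; last first.
  by move=> i _; rewrite mxE -expr2 sqr_ge0.
move=> /allP h; move/eqP: v0; apply; apply/rowP => i.
by have := h i (mem_index_enum _); rewrite !mxE mulf_eq0 orbb => /eqP.
Qed.

Definition resolvent x : 'M[R]_N := invmx (soliton_mx x).
Definition expo_cV x : 'cV[R]_N := \col_i expo i x.
Definition state_cV x : 'cV[R]_N := resolvent x *m expo_cV x.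
Definition kappa_mx : 'M[R]_N := diag_mx (\row_i kappa i).

Lemma soliton_mxK x : soliton_mx x *m resolvent x = 1%:M.
Proof. by rewrite mulmxV// soliton_mx_unit. Qed.

Lemma soliton_Kmx x : resolvent x *m soliton_mx x = 1%:M.
Proof. by rewrite mulVmx// soliton_mx_unit. Qed.

Lemma resolvent_sym x : (resolvent x)^T = resolvent x.
Proof.
rewrite /resolvent trmx_inv; congr invmx; rewrite /soliton_mx linearD /= trmx1; congr (_ + _).
by apply/matrixP => i j; rewrite !mxE [kappa j + _]addrC [expo j x * _]mulrC.
Qed.

Lemma state_trE x : (state_cV x)^T = (expo_cV x)^T *m resolvent x.
Proof. by rewrite trmx_mul resolvent_sym. Qed.

Lemma kappa_soliton x :
  kappa_mx *m soliton_mx x + soliton_mx x *m kappa_mx =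
  kappa_mx + kappa_mx + expo_cV x *m (expo_cV x)^T.
Proof.
rewrite /soliton_mx mulmxDr mulmxDl mulmx1 mul1mx addrACA; congr (_ + _).
apply/matrixP => i j.
rewrite /kappa_mx mul_diag_mx mul_mx_diag !mxE big_ord_recl big_ord0 !mxE addr0.
have := kappaD_neq0 i j; move: (expo i x) (expo j x) => a b h.
by field.
Qed.

(** The relation [kappa_soliton], whose rank one term comes from the denominators
    of C, is multiplied by the inverse on both sides.  The whole algebra of
    solitons rests on it. *)
Lemma kappa_resolvent x :
  resolvent x *m kappa_mx + kappa_mx *m resolvent x =
  resolvent x *m kappa_mx *m resolvent x + resolvent x *m kappa_mx *m resolvent x +
  state_cV x *m (state_cV x)^T.
Proof.
have := kappa_soliton x; rewrite state_trE /state_cV.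
move: (soliton_mx x) (resolvent x) (soliton_mxK x) (soliton_Kmx x) => A B AB BA e.
have := congr1 (fun M => B *m M *m B) e.
rewrite /= !mulmxDr !mulmxDl -!mulmxA AB mulmx1.
by rewrite [B *m (A *m _)]mulmxA BA mul1mx !mulmxA.
Qed.

Lemma is_derive_soliton_mx i j x :
  is_derive x 1 (fun y => soliton_mx y i j) (- (expo_cV x *m (expo_cV x)^T) i j).
Proof.
rewrite (_ : (fun y => _) = (fun y => (i == j)%:R + gram y i j)); last first.
  by apply/funext => y; rewrite !mxE.
apply: (is_derive_eq (derive_add (is_derive_cst _ x 1) (is_derive_gram i j x))).
by rewrite add0r !mxE big_ord_recl big_ord0 !mxE addr0.
Qed.

(** Differentiate (1 + C) B = 1, where C' = - e e^T. *)
Lemma is_derive_resolvent i j x :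
  is_derive x 1 (fun y => resolvent y i j) (state_cV x i 0 * state_cV x j 0).
Proof.
have dS k l : derivable (fun y => soliton_mx y k l) x 1.
  by case: (is_derive_soliton_mx k l x).
have dB k l := @derivable_invmx _ _ _ _ soliton_mx_unit dS k l.
pose dR : 'M[R]_N := \matrix_(k, l) 'D_1 (fun y => resolvent y k l) x.
have hR k l : is_derive x 1 (fun y => resolvent y k l) (dR k l).
  by apply: DeriveDef; [exact: dB|rewrite mxE].
have e : - (expo_cV x *m (expo_cV x)^T) *m resolvent x + soliton_mx x *m dR = 0.
  apply/matrixP => k l.
  have h : is_derive x 1 (fun y => \sum_(m < N) soliton_mx y k m * resolvent y m l)
    (\sum_(m < N) (- (expo_cV x *m (expo_cV x)^T) k m * resolvent x m l +
                   soliton_mx x k m * dR m l)).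
    by apply: derive_sum => m; apply: derive_mul => //; exact: is_derive_soliton_mx.
  have h0 : is_derive x 1 (fun y => \sum_(m < N) soliton_mx y k m * resolvent y m l) 0.
    rewrite (_ : (fun y => _) = cst ((1%:M : 'M[R]_N) k l)); first exact: is_derive_cst.
    by apply/funext => y; rewrite -(soliton_mxK y) mxE.
  have := @derive_val _ _ _ _ _ _ _ h; rewrite (@derive_val _ _ _ _ _ _ _ h0) => e0.
  rewrite [RHS]mxE e0 big_split mxE [X in X + _]mxE [X in _ + X]mxE.
  by congr (_ + _); apply: eq_bigr => m _; rewrite !mxE.
(* Multiply the derivative of the identity by the inverse on the left. *)
have dRE : dR = state_cV x *m (state_cV x)^T.
  move/eqP: e; rewrite mulNmx addrC subr_eq0 => /eqP e.
  have := congr1 (fun M => resolvent x *m M) e.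
  by rewrite /= mulmxA soliton_Kmx mul1mx => ->; rewrite state_trE /state_cV !mulmxA.
apply: (is_derive_eq (hR i j)).
by rewrite dRE mxE big_ord_recl big_ord0 addr0 !mxE.
Qed.

Definition state i x : R := state_cV x i 0.

(** The derivative of chi = B e, simplified by [kappa_resolvent] to
    K chi - 2 B K chi with K the diagonal matrix of the kappa_i; in this form the
    exponentials e have disappeared. *)
Definition dstate i x : R :=
  kappa i * state i x - 2 * \sum_(j < N) resolvent x i j * (kappa j * state j x).

Definition ddstate i x : R :=
  kappa i * dstate i x -
  2 * \sum_(j < N) (state i x * state j x * (kappa j * state j x) +
                    resolvent x i j * (kappa j * dstate j x)).

Definition potential x : R := 4 * \sum_(j < N) kappa j * state j x ^+ 2.

Lemma stateE i x : state i x = \sum_(j < N) resolvent x i j * expo j x.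
Proof. by rewrite /state mxE; apply: eq_bigr => j _; rewrite !mxE. Qed.

Definition dstate_cV x : 'cV[R]_N :=
  kappa_mx *m state_cV x - (resolvent x *m (kappa_mx *m state_cV x)) *+ 2.

Lemma kappa_mxE (w : 'cV[R]_N) i : (kappa_mx *m w) i 0 = kappa i * w i 0.
Proof. by rewrite /kappa_mx mul_diag_mx mxE [X in X * _]mxE. Qed.

Lemma dstate_cVE i x : dstate_cV x i 0 = dstate i x.
Proof.
rewrite /dstate_cV mxE [X in _ + X]mxE mulmxnE /dstate mulr_natl kappa_mxE.
by congr (_ - _ *+ 2); rewrite mxE; apply: eq_bigr => j _; rewrite kappa_mxE.
Qed.

Lemma is_derive_state i x : is_derive x 1 (state i) (dstate i x).
Proof.
rewrite (_ : state i = (fun x => \sum_(j < N) resolvent x i j * expo j x)); last first.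
  by apply/funext => y; exact: stateE.
have h : is_derive x 1 (fun x => \sum_(j < N) resolvent x i j * expo j x)
    (\sum_(j < N) (state_cV x i 0 * state_cV x j 0 * expo j x +
                   resolvent x i j * (- kappa j * expo j x))).
  by apply: derive_sum => j; apply: derive_mul; [exact: is_derive_resolvent|exact: is_derive_expo].
apply: (is_derive_eq h); rewrite -dstate_cVE.
have -> : dstate_cV x = state_cV x *m ((state_cV x)^T *m expo_cV x) -
    resolvent x *m (kappa_mx *m expo_cV x).
  rewrite /dstate_cV; have := kappa_resolvent x; have : state_cV x = resolvent x *m expo_cV x by [].
  move: (state_cV x) (resolvent x) (expo_cV x) kappa_mx => c B E K cE.
  move=> /(congr1 (fun M => M *m E)); rewrite /= !mulmxDl -!mulmxA -cE.
  move: (K *m c) (B *m (K *m c)) (B *m (K *m E)) (c *m _) => a1 a2 a3 a4 e.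
  rewrite mulr2n -[a1](addKr a3) e [- _ + _]addrC addrAC.
  by rewrite [a2 + a2 + _ - _]addrAC subrr add0r.
rewrite big_split/= [RHS]mxE; congr (_ + _).
  rewrite [RHS]mxE big_ord_recl big_ord0 addr0 [X in _ = _ * X]mxE mulr_sumr.
  by apply: eq_bigr => j _; rewrite [X in _ = _ * (X * _)]mxE [X in _ = _ * (_ * X)]mxE mulrA.
rewrite [RHS]mxE [X in _ = - X]mxE -sumrN; apply: eq_bigr => j _.
by rewrite kappa_mxE [X in _ = - (_ * (_ * X))]mxE mulNr mulrN.
Qed.

Lemma is_derive_dstate i x : is_derive x 1 (dstate i) (ddstate i x).
Proof.
apply: derive_add; first by apply: derive_mull; exact: is_derive_state.
apply: derive_opp; apply: derive_mull; apply: derive_sum => j.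
apply: derive_mul; first exact: is_derive_resolvent.
by apply: derive_mull; exact: is_derive_state.
Qed.

(** Differentiating chi' = K chi - 2 B K chi once more, the claim becomes
    [kappa_resolvent] applied to K chi. *)
Lemma state_eigen i x :
  ddstate i x + potential x * state i x = kappa i ^+ 2 * state i x.
Proof.
pose c := state_cV x; pose B := resolvent x; pose K := kappa_mx.
pose q : 'M[R]_1 := c^T *m (K *m c).
have qE : q 0 0 = \sum_(j < N) kappa j * state j x ^+ 2.
  rewrite mxE; apply: eq_bigr => j _.
  by rewrite kappa_mxE mxE expr2 mulrCA.
have ddE : ddstate i x = kappa i * dstate i x -
    2 * (state i x * q 0 0 + (B *m (K *m dstate_cV x)) i 0).
  rewrite /ddstate big_split /=; congr (_ - _ * (_ + _)).
    by rewrite qE mulr_sumr; apply: eq_bigr => j _; ring.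
  by rewrite [RHS]mxE; apply: eq_bigr => j _; rewrite kappa_mxE dstate_cVE.
have dE : dstate_cV x = K *m c - (B *m (K *m c) + B *m (K *m c)).
  by rewrite -mulr2n.
have eB (u v : 'cV[R]_N) : (u - (v + v)) i 0 = u i 0 - 2 * v i 0.
  by rewrite !mxE; ring.
have e0 : dstate i x = kappa i * state i x - 2 * (B *m (K *m c)) i 0.
  by rewrite -dstate_cVE dE eB kappa_mxE.
have e1 : (B *m (K *m dstate_cV x)) i 0 = (B *m (K *m (K *m c))) i 0 -
    2 * (B *m (K *m (B *m (K *m c)))) i 0.
  by rewrite dE mulmxBr mulmxBr !mulmxDr eB.
(* The commutation relation applied to the vector K chi. *)
have e2 : (B *m (K *m (K *m c))) i 0 + kappa i * (B *m (K *m c)) i 0 =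
    2 * (B *m (K *m (B *m (K *m c)))) i 0 + state i x * q 0 0.
  have -> : state i x * q 0 0 = (c *m q) i 0.
    by rewrite [RHS]mxE big_ord_recl big_ord0 addr0.
  rewrite -kappa_mxE -/K; have := kappa_resolvent x; rewrite -/c -/B -/K /q.
  move: (c) (B) (K) => c' B' K' /(congr1 (fun M => (M *m (K' *m c')) i 0)).
  rewrite /= !mulmxDl -!mulmxA.
  move: (B' *m (K' *m (K' *m c'))) (K' *m (B' *m _)) (B' *m (K' *m (B' *m _))) (c' *m _) => a1 a2 a3 a4.
  by rewrite !mxE => ->; ring.
rewrite ddE e1 e0 /potential -qE; move: e2.
move: (q 0 0) ((B *m (K *m (K *m c))) i 0) ((B *m (K *m c)) i 0)
  ((B *m (K *m (B *m (K *m c)))) i 0) => q0 a1 a2 a3 e.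
have -> : a1 = 2 * a3 + state i x * q0 - kappa i * a2 by rewrite -e addrK.
by ring.
Qed.

(** The equation (1 + C) chi = e gives
    chi_i(x) = e_i(x) (1 - \sum_j e_j(x) chi_j(x) / (kappa_i + kappa_j)), and
    the factor exp (kappa_i (x - y)) turns e_i(x) into e_i(y).  The double sum is
    symmetric in x and y. *)
Lemma sum_state_exp x y :
  \sum_(i < N) state i y * state i x * expR (kappa i * (x - y)) =
  \sum_(i < N) expo i y * state i y -
  \sum_(i < N) \sum_(j < N) (expo i y * state i y) * (expo j x * state j x) / (kappa i + kappa j).
Proof.
rewrite -sumrB; apply: eq_bigr => i _.
have stE : state i x = expo i x * (1 - \sum_(j < N) expo j x * state j x / (kappa i + kappa j)).
  have : (soliton_mx x *m state_cV x) i 0 = expo_cV x i 0.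
    by rewrite /state_cV mulmxA soliton_mxK mul1mx.
  rewrite /soliton_mx mulmxDl mul1mx mxE -/(state i x) [X in _ + X]mxE [RHS]mxE => e.
  rewrite mulrBr mulr1 -[X in _ = X - _]e mulr_sumr.
  rewrite (eq_bigr (fun j => expo i x * (expo j x * state j x / (kappa i + kappa j)))) ?addrK//.
  by move=> j _; rewrite mxE -/(state j x); ring.
have ee : expo i x * expR (kappa i * (x - y)) = expo i y.
  by rewrite /expo -mulrA -expRD; congr (_ * expR _); ring.
rewrite stE; set p := \sum_(j < N) expo j x * state j x / _.
transitivity (state i y * (expo i x * expR (kappa i * (x - y))) * (1 - p)); first by ring.
rewrite ee mulrBr mulr1 mulrC; congr (_ - _).
by rewrite mulr_sumr; apply: eq_bigr => j _; ring.
Qed.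

Lemma sum_state_sinh x y :
  \sum_(i < N) state i y * state i x * sinhR (kappa i * (x - y)) =
  (\sum_(i < N) expo i y * state i y - \sum_(i < N) expo i x * state i x) / 2.
Proof.
have h1 := sum_state_exp x y; have h2 := sum_state_exp y x.
have -> : \sum_(i < N) state i y * state i x * sinhR (kappa i * (x - y)) =
   (\sum_(i < N) state i y * state i x * expR (kappa i * (x - y)) -
    \sum_(i < N) state i x * state i y * expR (kappa i * (y - x))) / 2.
  rewrite -sumrB mulr_suml; apply: eq_bigr => i _.
  by rewrite /sinhR -mulrN opprB; ring.
rewrite h1 h2.
set S := \sum_(i < N) \sum_(j < N) _; set T := \sum_(i < N) \sum_(j < N) _.
have -> : T = S.
  rewrite /T exchange_big; apply: eq_bigr => i _; apply: eq_bigr => j _.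
  by rewrite [kappa j + _]addrC; ring.
congr (_ / 2); ring.
Qed.

Lemma is_derive_potential_primitive x :
  is_derive x 1 (fun x => \sum_(i < N) expo i x * state i x) (- potential x / 2).
Proof.
have h : is_derive x 1 (fun x => \sum_(i < N) expo i x * state i x)
   (\sum_(i < N) (- kappa i * expo i x * state i x + expo i x * dstate i x)).
  by apply: derive_sum => i; apply: derive_mul; [exact: is_derive_expo|exact: is_derive_state].
apply: (is_derive_eq h).
have -> : - potential x / 2 = - (2 * \sum_(j < N) kappa j * state j x ^+ 2).
  by rewrite /potential; field.
have e : \sum_(i < N) expo i x * \sum_(j < N) resolvent x i j * (kappa j * state j x) =
    \sum_(j < N) kappa j * state j x ^+ 2.
  under eq_bigr do rewrite mulr_sumr.
  rewrite exchange_big; apply: eq_bigr => j _ /=.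
  have -> : state j x ^+ 2 = (\sum_(i < N) resolvent x i j * expo i x) * state j x.
    rewrite expr2; congr (_ * _); rewrite stateE; apply: eq_bigr => i _.
    by rewrite -{1}(resolvent_sym x) mxE.
  by rewrite mulr_suml mulr_sumr; apply: eq_bigr => i _; ring.
rewrite -e mulr_sumr -sumrN; apply: eq_bigr => i _.
by rewrite /dstate; ring.
Qed.

(** This is the derivative in x of [sum_state_sinh], whose right-hand side
    depends on x only through a primitive of the potential. *)
Lemma state_potential x y :
  4 * (\sum_(i < N) state i y * (dstate i x * sinhR (kappa i * (x - y)) +
    kappa i * state i x * coshR (kappa i * (x - y)))) = potential x.
Proof.
have h1 : is_derive x 1 (fun x => \sum_(i < N) state i y * state i x * sinhR (kappa i * (x - y)))
  (\sum_(i < N) state i y * (dstate i x * sinhR (kappa i * (x - y)) +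
    kappa i * state i x * coshR (kappa i * (x - y)))).
  apply: derive_sum => i.
  have hs : is_derive x 1 (fun x => sinhR (kappa i * (x - y))) _ :=
    derive_shift (derive_scale (is_derive_sinhR (kappa i * (x - y)))).
  apply: (is_derive_eq (derive_mul (derive_mull (state i y) (is_derive_state i x)) hs)).
  by ring.
have h2 : is_derive x 1 (fun x => \sum_(i < N) state i y * state i x * sinhR (kappa i * (x - y)))
   (potential x / 4).
  rewrite (_ : (fun x => _) = (fun x => (\sum_(i < N) expo i y * state i y -
     \sum_(i < N) expo i x * state i x) / 2)); last first.
    by apply/funext => z; exact: sum_state_sinh.
  apply: (is_derive_eq (derive_mulr _ (derive_add (is_derive_cst _ x 1)
    (derive_opp (is_derive_potential_primitive x))))).
  by field.
have e1 := @derive_val _ _ _ _ _ _ _ h1; rewrite (@derive_val _ _ _ _ _ _ _ h2) in e1.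
by rewrite -e1; field.
Qed.

Lemma ddstate_continuous i : continuous (ddstate i).
Proof.
have cs j : continuous (state j) := derive_continuous (is_derive_state j).
have cd j : continuous (dstate j) := derive_continuous (is_derive_dstate j).
have cr j : continuous (fun y => resolvent y i j) := derive_continuous (is_derive_resolvent i j).
move=> x; apply: cvgD.
  by apply: cvgM; [exact: cvg_cst|exact: cd].
apply: cvgN; apply: cvgM; first exact: cvg_cst.
apply: cvg_big => [|j _]; first exact: add_continuous.
apply: cvgD.
  apply: cvgM; first by apply: cvgM; exact: cs.
  by apply: cvgM; [exact: cvg_cst|exact: cs].
by apply: cvgM; [exact: cr|apply: cvgM; [exact: cvg_cst|exact: cd]].
Qed.

End soliton.

(** * Jets and the dressing transformation *)

Section jets.
Variable R : comNzRingType.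

(** Formal Taylor data: [a n] stands for the n-th derivative at the base point, so
    that the product is a binomial convolution and the derivation a shift. *)
Definition jet := nat -> R.
Implicit Types a b c : jet.

Definition jmul a b : jet :=
  fun n => \sum_(k < n.+1) 'C(n, k)%:R * a k * b (n - k)%N.
Definition jderiv a : jet := fun n => a n.+1.
Definition jconst (x : R) : jet := fun n => if n is 0 then x else 0.
Definition jint a : jet := fun n => if n is m.+1 then a m else 0.

HB.instance Definition _ := GRing.Zmodule.copy jet (nat -> R).

Lemma jetDE a b n : (a + b) n = a n + b n. Proof. by []. Qed.
Lemma jetNE a n : (- a) n = - a n. Proof. by []. Qed.

Lemma jmul0 a b : jmul a b 0 = a 0 * b 0.
Proof. by rewrite /jmul big_ord_recl big_ord0 bin0 mul1r addr0 subnn. Qed.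

Lemma jderivD a b : jderiv (a + b) = jderiv a + jderiv b. Proof. by []. Qed.

Lemma jderiv_mul a b : jderiv (jmul a b) = jmul (jderiv a) b + jmul a (jderiv b).
Proof.
apply/funext => n.
rewrite [RHS](_ : _ = jmul (jderiv a) b n + jmul a (jderiv b) n)// /jderiv /jmul.
rewrite big_ord_recl /= bin0 mul1r subn0.
under eq_bigr => i _ do rewrite /bump /= binS natrD 2!mulrDl subSS.
rewrite big_split /= addrA addrC; congr (_ + _).
rewrite [in RHS]big_ord_recl bin0 mul1r subn0; congr (_ + _).
rewrite big_ord_recr /= bin_small // !mul0r addr0; apply: eq_bigr => i _.
by rewrite /bump /= add1n subnSK.
Qed.

Lemma jmulDl a b c : jmul (a + b) c = jmul a c + jmul b c.
Proof.
apply/funext => n; rewrite /jmul jetDE -big_split /=; apply: eq_bigr => i _.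
by rewrite jetDE mulrDr mulrDl.
Qed.

(** The ring laws hold at order 0 and propagate through the Leibniz rule. *)
Lemma jmulC a b : jmul a b = jmul b a.
Proof.
apply/funext => n; elim: n a b => [|n IH] a b; first by rewrite !jmul0 mulrC.
have e x y : jmul x y n.+1 = jderiv (jmul x y) n by [].
by rewrite !e !jderiv_mul !jetDE addrC IH [X in _ + X]IH.
Qed.

Lemma jmulDr a b c : jmul a (b + c) = jmul a b + jmul a c.
Proof. by rewrite jmulC jmulDl jmulC [jmul c a]jmulC. Qed.

Lemma jmulA a b c : jmul a (jmul b c) = jmul (jmul a b) c.
Proof.
apply/funext => n; elim: n a b c => [|n IH] a b c; first by rewrite !jmul0 mulrA.
have e x y : jmul x y n.+1 = jderiv (jmul x y) n by [].
by rewrite !e !jderiv_mul jmulDl jmulDr !jetDE !IH addrA.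
Qed.

Lemma jconst_mul x a n : jmul (jconst x) a n = x * a n.
Proof.
rewrite /jmul big_ord_recl bin0 mul1r subn0 big1 ?addr0// => i _.
by rewrite mulr0 mul0r.
Qed.

Lemma jmul1l a : jmul (jconst 1) a = a.
Proof. by apply/funext => n; rewrite jconst_mul mul1r. Qed.

Lemma jconst1_neq0 : jconst 1 != 0 :> jet.
Proof. by apply/eqP => /(congr1 (fun a : jet => a 0)) /eqP; rewrite (oner_eq0 R). Qed.

HB.instance Definition _ := GRing.Zmodule_isComNzRing.Build jet
  jmulA jmulC jmul1l jmulDl jconst1_neq0.

Lemma jmulE a b n : (a * b) n = \sum_(k < n.+1) 'C(n, k)%:R * a k * b (n - k)%N.
Proof. by []. Qed.

Lemma jmulE0 a b : (a * b) 0 = a 0 * b 0.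
Proof. exact: jmul0. Qed.

Lemma jconstM x a n : (jconst x * a) n = x * a n.
Proof. exact: jconst_mul. Qed.

Lemma jderivM a b : jderiv (a * b) = jderiv a * b + a * jderiv b.
Proof. exact: jderiv_mul. Qed.

Lemma jderivB a b : jderiv (a - b) = jderiv a - jderiv b. Proof. by []. Qed.

Lemma jderiv_const x : jderiv (jconst x) = 0. Proof. by []. Qed.

Lemma jderiv_sum (I : Type) (r : seq I) (F : I -> jet) :
  jderiv (\sum_(i <- r) F i) = \sum_(i <- r) jderiv (F i).
Proof. by elim/big_rec2: _ => // i x y _ <-. Qed.

Lemma jet_sumE (I : Type) (r : seq I) (F : I -> jet) n :
  (\sum_(i <- r) F i) n = \sum_(i <- r) F i n.
Proof. by elim/big_rec2: _ => // i x y _ <-. Qed.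

Lemma jderiv_int a : jderiv (jint a) = a. Proof. by []. Qed.

Lemma jintD a b : jint (a + b) = jint a + jint b.
Proof. by apply/funext => -[|n] //=; rewrite ?(jetDE, jetNE) addr0. Qed.

Lemma jint_deriv a : jint (jderiv a) = a - jconst (a 0).
Proof. by apply/funext => -[|n] /=; rewrite ?(jetDE, jetNE) /= ?subrr // subr0. Qed.

Lemma jint_const x a : jint (jconst x * a) = jconst x * jint a.
Proof. by apply/funext => -[|n]; rewrite [RHS]jconstM /= ?mulr0 // jconstM. Qed.

Lemma jet2E : 2 = jconst 2 :> jet.
Proof. by apply/funext => -[|n]; rewrite !mulr2n jetDE //= addr0. Qed.

Section dressing.
Variables (N : nat) (kappa : 'I_N -> R) (chi sh ch : 'I_N -> jet) (u : jet).
Hypothesis eigen : forall i,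
  jderiv (jderiv (chi i)) = jconst (kappa i) * jconst (kappa i) * chi i - u * chi i.
Hypothesis dsh : forall i, jderiv (sh i) = jconst (kappa i) * ch i.
Hypothesis dch : forall i, jderiv (ch i) = jconst (kappa i) * sh i.
Hypothesis sh_even : forall i m, sh i (2 * m)%N = 0.
Hypothesis potential : u = 4 * \sum_(i < N) jconst (chi i 0) *
  (jderiv (chi i) * sh i + jconst (kappa i) * chi i * ch i).

Definition jschr a : jet := jderiv (jderiv a) + u * a.

(** On functions: T f = f + 2 \sum_i chi_i(0) sinh (kappa_i x) \int_0^x chi_i f,
    with [sh] and [ch] in the place of sinh (kappa_i x) and cosh (kappa_i x). *)
Definition dress a : jet :=
  a + 2 * \sum_(i < N) jconst (chi i 0) * (sh i * jint (chi i * a)).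

Definition wronskian i a : R := chi i 0 * a 1 - chi i 1 * a 0.

(** T L = d^2 T up to a combination of the odd functions [sh i]: integrating
    chi_i L f by parts twice moves L to chi_i, which is an eigenfunction, and the
    boundary terms at 0 are Wronskians. *)
Lemma dress_schr a :
  dress (jschr a) = jderiv (jderiv (dress a)) -
    2 * \sum_(i < N) jconst (chi i 0) * (sh i * jconst (wronskian i a)).
Proof.
have d2 x : jderiv (2 * x) = 2 * jderiv x.
  by rewrite jet2E jderivM jderiv_const mul0r add0r.
have dc x y : jderiv (jconst x * y) = jconst x * jderiv y.
  by rewrite jderivM jderiv_const mul0r add0r.
(* Two integrations by parts, using the eigenvalue equation. *)
have hi i : jint (chi i * jschr a) = chi i * jderiv a - jderiv (chi i) * a -
   jconst (wronskian i a) + jconst (kappa i) * jconst (kappa i) * jint (chi i * a).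
  have -> : chi i * jschr a = jderiv (chi i * jderiv a - jderiv (chi i) * a) +
      jconst (kappa i) * (jconst (kappa i) * (chi i * a)).
    by rewrite jderivB !jderivM eigen /jschr; ring.
  by rewrite jintD jint_deriv !jint_const mulrA jetDE jetNE !jmulE0.
have e : jderiv (jderiv (dress a)) = jderiv (jderiv a) +
    2 * \sum_(i < N) jconst (chi i 0) *
      (jconst (kappa i) * jconst (kappa i) * sh i * jint (chi i * a) +
       2 * jconst (kappa i) * ch i * (chi i * a) +
       sh i * (jderiv (chi i) * a + chi i * jderiv a)).
  rewrite /dress 2!jderivD 2!d2 2!jderiv_sum; congr (_ + 2 * _).
  apply: eq_bigr => i _; rewrite 2!dc; congr (_ * _).
  rewrite jderivM jderiv_int dsh jderivD !jderivM jderiv_int dsh dch.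
  by rewrite jderiv_const; ring.
rewrite e /dress {1}/jschr {1}potential.
apply/eqP; rewrite -subr_eq0; apply/eqP.
rewrite (_ : 4 = 2 * 2 :> jet); last by ring.
under [X in _ + 2 * X - _]eq_bigr => i _ do rewrite hi.
set S1 := \sum_(i < N) _; set S2 := \sum_(i < N) _; set S3 := \sum_(i < N) _; set S4 := \sum_(i < N) _.
rewrite (_ : _ - _ = 2 * (2 * S1 * a + S2 - S3 + S4)); last by ring.
rewrite mulr_sumr mulr_suml /S2 /S3 /S4 -big_split -sumrB -big_split /= big1 ?mulr0 // => i _.
by ring.
Qed.

(** (T f)(0) = f(0), and the even derivatives of the defect in [dress_schr] vanish
    at 0. *)
Lemma iter_schr m a : (iter m jschr a) 0 = dress a (2 * m)%N.
Proof.
have h k b : dress (jschr b) (2 * k)%N = dress b (2 * k.+1)%N.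
  rewrite dress_schr jetDE jetNE jet2E jconstM jet_sumE big1 ?mulr0 ?oppr0 ?addr0 ?mulnS //.
  by move=> i _; rewrite jconstM [sh i * _]mulrC jconstM sh_even !mulr0.
have h0 b : dress b 0 = b 0.
  rewrite /dress jetDE jet2E jconstM jet_sumE big1 ?mulr0 ?addr0 // => i _.
  by rewrite jconstM jmulE0 mulr0 mulr0.
rewrite -h0.
have : forall k, dress (iter m jschr a) (2 * k)%N = dress a (2 * (k + m))%N.
  elim: m => [|m IH] k; first by rewrite addn0.
  by rewrite iterS h IH addSnnS.
by move=> /(_ 0%N); rewrite add0n muln0.
Qed.

End dressing.

End jets.

(** * Finite differences and the coefficients of the formula *)

Section differences.
Variable R : realType.
Implicit Types (f : nat -> R) (h c : R) (s : seq R).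

(** Up to the sign (-1)^n, the n-th forward difference of [f] at 0. *)
Definition altsum n f : R := \sum_(j < n.+1) (-1) ^+ j * 'C(n, j)%:R * f j.

Lemma altsumS n f : altsum n.+1 f = altsum n f - altsum n (fun j => f j.+1).
Proof.
rewrite /altsum big_ord_recl bin0.
under eq_bigr => i _ do rewrite lift0 binS natrD mulrDr mulrDl exprS.
rewrite big_split /= addrA -sumrN; congr (_ + _); last first.
  by apply: eq_bigr => i _; ring.
rewrite [in RHS]big_ord_recl bin0; congr (_ + _).
rewrite big_ord_recr /= bin_small // mulr0 mul0r addr0; apply: eq_bigr => i _.
by rewrite /bump /= add1n exprS.
Qed.

Lemma eq_altsum n f g : f =1 g -> altsum n f = altsum n g.
Proof. by move=> e; apply: eq_bigr => j _; rewrite e. Qed.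

Lemma altsumD n f g : altsum n (fun j => f j + g j) = altsum n f + altsum n g.
Proof. by rewrite /altsum -big_split; apply: eq_bigr => j _; rewrite mulrDr. Qed.

Lemma altsumZ n c f : altsum n (fun j => c * f j) = c * altsum n f.
Proof. by rewrite /altsum mulr_sumr; apply: eq_bigr => j _; ring. Qed.

Lemma altsum_index n f :
  altsum n.+1 (fun j => j%:R * f j) = - n.+1%:R * altsum n (fun j => f j.+1).
Proof.
rewrite /altsum big_ord_recl mul0r mulr0 add0r mulr_sumr; apply: eq_bigr => i _.
have e : i.+1%:R * 'C(n.+1, i.+1)%:R = n.+1%:R * 'C(n, i)%:R :> R.
  by rewrite -!natrM mul_bin_diag.
rewrite lift0 exprS.
transitivity (- (-1) ^+ i * (i.+1%:R * 'C(n.+1, i.+1)%:R) * f i.+1); first by ring.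
by rewrite e; ring.
Qed.

(** An n-th difference kills polynomials of degree less than n.  The polynomial
    is given by its linear factors, as this is how it occurs and how the
    induction on the degree proceeds. *)
Lemma altsum_prod n s : (size s < n)%N ->
  altsum n (fun j => \prod_(c <- s) (j%:R + c)) = 0.
Proof.
move: {2}(size s) (leqnn (size s)) => k; elim: k s n => [|k IH] [|c s] [|n] //= sk sn.
- rewrite altsumS (@eq_altsum n _ (fun=> 1)) => [|j]; last by rewrite big_nil.
  by rewrite [X in _ - X](@eq_altsum n _ (fun=> 1)) ?subrr // => j; rewrite big_nil.
- rewrite altsumS (@eq_altsum n _ (fun=> 1)) => [|j]; last by rewrite big_nil.
  by rewrite [X in _ - X](@eq_altsum n _ (fun=> 1)) ?subrr // => j; rewrite big_nil.
have sk' : (size s <= k)%N by [].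
rewrite (@eq_altsum _ _ (fun j => j%:R * \prod_(c <- s) (j%:R + c) +
    c * \prod_(c <- s) (j%:R + c))); last first.
  by move=> j; rewrite big_cons mulrDl.
rewrite altsumD altsum_index altsumZ (IH s) ?mulr0 ?addr0 //; last by rewrite ltnS ltnW.
rewrite (@eq_altsum _ _ (fun j => \prod_(c <- map (fun c => c + 1) s) (j%:R + c))).
  by rewrite IH ?mulr0 // size_map.
by move=> j; rewrite big_map; apply: eq_bigr => d _; rewrite -natr1; ring.
Qed.

Lemma altsum_inv n h : 0 < h ->
  altsum n (fun j => (j%:R + h)^-1) = n`!%:R / \prod_(q < n.+1) (q%:R + h).
Proof.
elim: n h => [|n IH] h h0.
  by rewrite /altsum !big_ord_recl !big_ord0 bin0 expr0 !mul1r addr0 mulr1.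
rewrite altsumS IH // (@eq_altsum _ _ (fun j => (j%:R + (h + 1))^-1)); last first.
  by move=> j; rewrite -natr1; congr (_^-1); ring.
rewrite IH ?addr_gt0 //.
rewrite [X in _ - _ / X](_ : _ = \prod_(q < n.+1) (q.+1%:R + h)); last first.
  by apply: eq_bigr => q _; rewrite -natr1; ring.
have p0 m (g : 'I_m -> nat) : \prod_(q < m) ((g q)%:R + h) != 0.
  by rewrite gt_eqF// prodr_gt0 // => q _; rewrite ltr_wpDl.
have pE : \prod_(q < n.+1) (q%:R + h) * (n.+1%:R + h) = h * \prod_(q < n.+1) (q.+1%:R + h).
  have := @big_ord_recr R 1 *%R n.+1 (fun q => q%:R + h).
  by rewrite big_ord_recl /= add0r => <-; congr (_ * _); apply: eq_bigr => q _; rewrite lift0.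
rewrite [X in _ = _ / X]big_ord_recr /= factS natrM.
have h1 : n.+1%:R + h != 0 by rewrite gt_eqF// ltr_wpDl.
have := p0 n.+1 (fun q => q : nat); have := p0 n.+1 (fun q => q.+1).
move: pE; set a := \prod_(q < _) (q%:R + h); set b := \prod_(q < _) _ => pE b0 a0.
have -> : a = h * b / (n.+1%:R + h) by rewrite -pE mulfK.
clear pE; move: (n.+1%:R : R) h1 => d h1; field.
by rewrite b0 h1 gt_eqF.
Qed.

(** The residue at the pole j = - h is the product of the entries of s; the rest
    of the partial fraction expansion is a polynomial of degree less than n. *)
Lemma altsum_prod_div n s h : 0 < h -> (size s <= n)%N ->
  altsum n (fun j => (\prod_(c <- s) (j%:R + h + c)) / (j%:R + h)) =
  (\prod_(c <- s) c) * (n`!%:R / \prod_(q < n.+1) (q%:R + h)).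
Proof.
move=> h0; rewrite -altsum_inv //; elim: s => [|c s IH] /= sn.
  by rewrite big_nil mul1r; apply: eq_altsum => j; rewrite big_nil mul1r.
rewrite (@eq_altsum _ _ (fun j => \prod_(d <- map (fun d => h + d) s) (j%:R + d) +
    c * (\prod_(d <- s) (j%:R + h + d) / (j%:R + h)))).
  by rewrite altsumD altsumZ IH ?(ltnW sn) // altsum_prod ?size_map // add0r big_cons mulrA.
move=> j; rewrite big_cons big_map.
rewrite [X in _ = X + _](eq_bigr (fun d => j%:R + h + d)) => [|d _]; last by rewrite addrA.
have jh : j%:R + h != 0 by rewrite gt_eqF// ltr_wpDl.
by field.
Qed.

(** Gamma(b + 1/2) / Gamma(a + 1/2), for a <= b. *)
Definition half_prod a b : R := \prod_(a <= q < b) (q%:R + 1 / 2).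

Lemma half_prod_neq0 a b : half_prod a b != 0.
Proof.
by rewrite gt_eqF// /half_prod prodr_gt0 // => q _; rewrite ltr_wpDl.
Qed.

Lemma half_prod_cat (a b c : nat) : (a <= b)%N -> (b <= c)%N ->
  half_prod a c = half_prod a b * half_prod b c.
Proof. by move=> ab bc; rewrite /half_prod (big_cat_nat ab bc). Qed.

Lemma gbinom_half n j : (j <= n)%N ->
  gbinom (n%:R + 1 / 2 : R) (n - j)%N = half_prod j.+1 n.+1 / (n - j)`!%:R.
Proof.
move=> jn; rewrite /gbinom; congr (_ / _).
have [m ->] : exists m, n = (j + m)%N by exists (n - j)%N; rewrite subnKC.
rewrite addKn => {n jn}.
elim: m => [|m IH]; first by rewrite big_ord0 addn0 /half_prod big_geq.
rewrite big_ord_recl addnS /half_prod big_nat_recr /=; last by rewrite ltnS leq_addr.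
rewrite -/(half_prod _ _) -IH mulrC subr0; congr (_ * _).
by apply: eq_bigr => i _; rewrite /bump /= natrD addrAC; rewrite -!natr1; ring.
Qed.

Lemma double_fact r : (2 * r)`!%:R = r`!%:R * 4 ^+ r * half_prod 0 r :> R.
Proof.
elim: r => [|r IH]; first by rewrite muln0 /half_prod big_geq // fact0 expr0 !mulr1.
rewrite (_ : (2 * r.+1)%N = (2 * r).+2); last by lia.
rewrite !factS !natrM IH /half_prod big_nat_recr //= exprS.
rewrite -!natr1 natrM.
by field.
Qed.

(** The coefficient of the formula without its factor (2 j)!, which is the one
    that [schr_monomial] produces. *)
Definition kdv_weight n j : R :=
  gbinom (n%:R + 1 / 2 : R) (n - j)%N * ((-1) ^+ j / (4 ^+ j * j`!%:R * (j + n)`!%:R)).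

(** The last factor is the product of the j + 1/2 + q for 1 <= q < n, a
    polynomial of degree n - 1 in j. *)
Lemma kdv_weightE n j : (0 < n)%N -> (j <= n)%N ->
  kdv_weight n j * (2 * (n + j))`!%:R = 4 ^+ n / n`!%:R * half_prod 0 n.+1 *
    ((-1) ^+ j * 'C(n, j)%:R * half_prod j.+1 (n + j)).
Proof.
move=> n0 jn; rewrite /kdv_weight gbinom_half // double_fact.
have fn m : m`!%:R != 0 :> R by rewrite pnatr_eq0 -lt0n fact_gt0.
have -> : 'C(n, j)%:R = n`!%:R / (j`!%:R * (n - j)`!%:R) :> R.
  by rewrite -(bin_fact jn) natrM natrM mulfK // mulf_neq0.
rewrite (@half_prod_cat 0 j.+1 n.+1) // (@half_prod_cat 0 j.+1 (n + j)) //; last by lia.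
rewrite exprD [(j + n)%N]addnC.
have f4 m : 4 ^+ m != 0 :> R by rewrite expf_neq0.
field.
by rewrite !fn f4.
Qed.

(** For 0 < l < n the denominator cancels a factor of the polynomial in
    [kdv_weightE], and an n-th difference of a polynomial of degree n - 2 is left.
    For l = 0 there is one simple pole, at j = - 1/2. *)
Lemma kdv_weight_sum n l : (l < n)%N ->
  \sum_(j < n.+1) kdv_weight n j * (2 * (n + j))`!%:R / (2 * (l + j)).+1%:R =
  if l == 0%N then 4 ^+ n * n.-1`!%:R / 2 else 0.
Proof.
move=> ln; have n0 : (0 < n)%N by case: (n) ln.
have fn m : m`!%:R != 0 :> R by rewrite pnatr_eq0 -lt0n fact_gt0.
pose g j := half_prod j.+1 (n + j) / (j%:R + (l%:R + 1 / 2)).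
transitivity (4 ^+ n / n`!%:R * half_prod 0 n.+1 / 2 * altsum n g).
  rewrite /altsum mulr_sumr; apply: eq_bigr => -[j jn] _ /=.
  have jl : j%:R + (l%:R + 1 / 2) != 0 :> R by rewrite gt_eqF// ltr_wpDl // ltr_wpDl.
  rewrite kdv_weightE // /g (_ : (2 * (l + j)).+1%:R = 2 * (j%:R + (l%:R + 1 / 2)) :> R); last first.
    by rewrite -[LHS]natr1 natrM natrD; field.
  by move: jl; move: (_ + _) => d jl; field; rewrite fn jl.
have hE j : half_prod j.+1 (n + j) = \prod_(1 <= q < n) (j%:R + 1 / 2 + q%:R).
  rewrite /half_prod -(addn1 j) [(j + 1)%N]addnC big_addn addnK.
  by apply: eq_bigr => q _; rewrite natrD; ring.
have [l0|l0] := eqVneq l 0%N.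
  rewrite (@eq_altsum n _ (fun j => (\prod_(c <- [seq q%:R | q <- index_iota 1 n]) (j%:R + 1 / 2 + c)) / (j%:R + 1 / 2))); last first.
    by move=> j; rewrite /g hE l0 add0r big_map.
  rewrite altsum_prod_div ?divr_gt0 //; last by rewrite size_map size_iota subn1 leq_pred.
  have -> : \prod_(q < n.+1) (q%:R + 1 / 2) = half_prod 0 n.+1.
    by rewrite /half_prod big_mkord.
  have -> : \prod_(c <- [seq q%:R | q <- index_iota 1 n]) c = n.-1`!%:R :> R.
    by rewrite big_map fact_prod natr_prod prednK.
  have hp := half_prod_neq0 0 n.+1.
  by field; rewrite fn hp.
rewrite (@eq_altsum n _ (fun j => \prod_(c <- [seq 1 / 2 + q%:R | q <- rem l (index_iota 1 n)]) (j%:R + c))).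
  rewrite altsum_prod ?mulr0 // size_map size_rem ?size_iota; first by lia.
  by rewrite mem_index_iota lt0n l0.
move=> j; rewrite /g hE big_map.
have lin : l \in index_iota 1 n by rewrite mem_index_iota lt0n l0.
rewrite (perm_big _ (perm_to_rem lin)) big_cons /= mulrAC.
have jl : j%:R + (l%:R + 1 / 2) != 0 :> R by rewrite gt_eqF// ltr_wpDl // ltr_wpDl.
rewrite (_ : j%:R + 1 / 2 + l%:R = j%:R + (l%:R + 1 / 2)); last by ring.
by rewrite divff // [LHS]mul1r; apply: eq_bigr => q _; rewrite addrA.
Qed.

End differences.

Section monomial_jets.
Variables (R : realType) (N : nat) (kappa : 'I_N -> R) (chi : 'I_N -> jet R).

Definition sinh_jet (k : R) : jet R := fun m => if odd m then k ^+ m else 0.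

(** The jet of x ^ (2 j) at 0. *)
Definition monomial_jet j : jet R := fun k => if (k == 2 * j)%N then (2 * j)`!%:R else 0.

Lemma sum_double n (F : nat -> R) :
  \sum_(l < 2 * n) F l = \sum_(i < n) (F (2 * i)%N + F (2 * i).+1).
Proof.
elim: n => [|n IH]; first by rewrite muln0 !big_ord0.
rewrite (_ : (2 * n.+1)%N = (2 * n).+2); last by lia.
by rewrite 2!big_ord_recr IH [in RHS]big_ord_recr /= addrA.
Qed.

(** The Leibniz rule for sinh (k x) \int_0^x a(w) w^(2j) dw.  Only odd derivatives
    of sinh are nonzero at 0, so that only the even derivatives of a remain. *)
Lemma sinh_int_monomial (k : R) (a : jet R) n j : (0 < n)%N ->
  (sinh_jet k * jint (a * monomial_jet j)) (2 * (n + j))%N =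
  \sum_(i < n) (2 * (n + j))`!%:R / (2 * (i + j)).+1%:R *
    (a (2 * i)%N / (2 * i)`!%:R * (k ^+ (2 * (n - i)).-1 / (2 * (n - i)).-1`!%:R)).
Proof.
move=> n0; have fn m : m`!%:R != 0 :> R by rewrite pnatr_eq0 -lt0n fact_gt0.
have mE s : (a * monomial_jet j) s = if (2 * j <= s)%N then 'C(s, 2 * j)%:R * (2 * j)`!%:R * a (s - 2 * j)%N else 0.
  rewrite [a * _]mulrC jmulE; case: leqP => sj.
    rewrite (bigD1 (Ordinal (sj : (2 * j < s.+1)%N))) //= /monomial_jet eqxx big1 ?addr0 // => i.
    by rewrite -val_eqE /= => /negbTE ->; rewrite mulr0 mul0r.
  rewrite big1 // => -[i /= hi] _; rewrite /monomial_jet.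
  by case: eqP => [e|_]; [lia|rewrite mulr0 mul0r].
rewrite [sinh_jet k * _]mulrC jmulE big_ord_recl /= mulr0 mul0r add0r.
rewrite mulnDr addnC big_split_ord /= big1 ?add0r; last first.
  by move=> i _; rewrite mE leqNgt ltn_ord /= mulr0 mul0r.
pose F l : R := 'C(2 * j + 2 * n, (2 * j + l).+1)%:R * (a * monomial_jet j) (2 * j + l)%N *
  sinh_jet k (2 * j + 2 * n - (2 * j + l).+1)%N.
transitivity (\sum_(l < 2 * n) F l); first by apply: eq_bigr => l _.
rewrite sum_double; apply: eq_bigr => -[i /= hi] _.
rewrite [X in _ + X](_ : F _ = 0) ?addr0; last first.
  rewrite /F /sinh_jet (_ : odd _ = false) ?mulr0 //; lia.
rewrite /F mE leq_addr /sinh_jet.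
have -> : (2 * j + 2 * n - (2 * j + 2 * i).+1 = (2 * (n - i)).-1)%N by lia.
have -> : odd (2 * (n - i)).-1 by lia.
have -> : (2 * j + 2 * i - 2 * j = 2 * i)%N by lia.
have b1 := @bin_fact (2 * j + 2 * n) (2 * j + 2 * i).+1; have b2 := @bin_fact (2 * j + 2 * i) (2 * j).
have {}b1 : 'C(2 * j + 2 * n, (2 * j + 2 * i).+1)%:R = (2 * j + 2 * n)`!%:R /
   ((2 * (i + j)).+1%:R * (2 * j + 2 * i)`!%:R * (2 * (n - i)).-1`!%:R) :> R.
  rewrite -b1; last by lia.
  rewrite (_ : (2 * j + 2 * n - (2 * j + 2 * i).+1 = (2 * (n - i)).-1)%N); last by lia.
  rewrite factS !natrM (_ : (2 * j + 2 * i).+1 = (2 * (i + j)).+1); last by lia.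
  by rewrite mulfK // !mulf_neq0 // pnatr_eq0.
have {}b2 : 'C(2 * j + 2 * i, 2 * j)%:R = (2 * j + 2 * i)`!%:R / ((2 * j)`!%:R * (2 * i)`!%:R) :> R.
  rewrite -b2 ?leq_addr // addKn !natrM mulfK // !mulf_neq0 //.
rewrite b1 b2.
have s0 : (2 * (i + j)).+1%:R != 0 :> R by rewrite pnatr_eq0.
have := fn (2 * j + 2 * i)%N; have := fn (2 * j)%N; have := fn (2 * i)%N; have := fn (2 * (n - i)).-1; move: s0.
move: ((2 * (i + j)).+1%:R : R) => d; do 4 move: (_`!%:R : R) => ?.
by move=> h1 h2 h3 h4 h5; field; rewrite h1 h2 h3 h4 h5.
Qed.

(** After exchanging the sums, [kdv_weight_sum] leaves the term l = 0 only, which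
    involves the values chi_i(0) and no derivative of chi_i. *)
Lemma kdv_weight_dress n : (0 < n)%N ->
  \sum_(j < n.+1) kdv_weight R n j *
    dress chi (fun i => sinh_jet (kappa i)) (monomial_jet j) (2 * (n + j))%N =
  soliton_coef kappa (fun i => chi i 0%N) n.
Proof.
move=> n0.
have fn m : m`!%:R != 0 :> R by rewrite pnatr_eq0 -lt0n fact_gt0.
have dE j : dress chi (fun i => sinh_jet (kappa i)) (monomial_jet j) (2 * (n + j))%N =
   2 * \sum_(i < N) chi i 0%N * \sum_(l < n) (2 * (n + j))`!%:R / (2 * (l + j)).+1%:R *
    (chi i (2 * l)%N / (2 * l)`!%:R * (kappa i ^+ (2 * (n - l)).-1 / (2 * (n - l)).-1`!%:R)).
  rewrite /dress jetDE jet2E jconstM jet_sumE {1}/monomial_jet.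
  rewrite (_ : (2 * (n + j) == 2 * j)%N = false) ?add0r; last by lia.
  by congr (_ * _); apply: eq_bigr => i _; rewrite jconstM sinh_int_monomial.
under eq_bigr => j _ do rewrite dE mulrCA mulr_sumr.
rewrite -mulr_sumr exchange_big /=.
have -> : soliton_coef kappa (fun i => chi i 0%N) n = 2 * \sum_(i < N) chi i 0%N ^+ 2 *
    (dawson_coef R n.-1 * kappa i ^+ (2 * n.-1).+1) by case: (n) n0.
congr (2 * _); apply: eq_bigr => i _.
transitivity (chi i 0%N * \sum_(l < n) (\sum_(j < n.+1) kdv_weight R n j * (2 * (n + j))`!%:R / (2 * (l + j)).+1%:R) *
    (chi i (2 * l)%N / (2 * l)`!%:R * (kappa i ^+ (2 * (n - l)).-1 / (2 * (n - l)).-1`!%:R))).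
  under [in RHS]eq_bigr => l _ do rewrite mulr_suml.
  rewrite [in RHS]exchange_big mulr_sumr; apply: eq_bigr => j _.
  by rewrite mulrCA mulr_sumr; congr (_ * _); apply: eq_bigr => l _; rewrite !mulrA.
rewrite (bigD1 (Ordinal n0)) //= [X in _ + X]big1 ?addr0; last first.
  move=> l l0; rewrite kdv_weight_sum // (_ : (l == 0%N :> nat) = false) ?mul0r //.
  by apply: negbTE; move: l0; rewrite -val_eqE.
rewrite kdv_weight_sum // eqxx muln0 subn0 fact0 divr1.
case: n n0 {dE} => // m _; rewrite (_ : (2 * m.+1).-1 = (2 * m).+1); last by lia.
rewrite !succnK.
rewrite /dawson_coef exprS.
by field; rewrite fn.
Qed.

End monomial_jets.

(** * Powers of the Schroedinger operator as sums of words *)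

Section words.
Variables (R : realType) (u : jet R) (a : jet R).

Lemma iter_jderiv m (b : jet R) k : iter m (@jderiv R) b k = b (m + k)%N.
Proof. by elim: m k => [//|m IH] k; rewrite iterS /jderiv IH addSnnS. Qed.

(** The sum of all words with q letters u and b letters d^2, applied to a; the
    first letter u has 2 c derivatives in front of it. *)
Fixpoint words (q b : nat) : jet R :=
  if q is q'.+1 then
    \sum_(c < b.+1) iter (2 * c) (@jderiv R) (u * words q' (b - c)%N)
  else iter (2 * b) (@jderiv R) a.

Lemma wordsS q b : jderiv (jderiv (words q.+1 b)) + u * words q b.+1 = words q.+1 b.+1.
Proof.
rewrite [RHS](_ : _ = \sum_(c < b.+2) iter (2 * c) (@jderiv R) (u * words q (b.+1 - c)%N)) //.
rewrite big_ord_recl muln0 subn0 addrC; congr (_ + _).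
by rewrite !jderiv_sum; apply: eq_bigr => c _; rewrite lift0 subSS mulnS.
Qed.

Lemma iter_jschr_words m : iter m (jschr u) a = \sum_(q < m.+1) words q (m - q)%N.
Proof.
elim: m => [|m IH]; first by rewrite big_ord_recl big_ord0 addr0.
rewrite iterS IH /jschr !jderiv_sum mulr_sumr.
rewrite [in RHS]big_ord_recl subn0 [X in _ = _ + X]big_ord_recr.
rewrite [X in X + _]big_ord_recl subn0 -addrA; congr (_ + _).
  by rewrite [LHS]/= -!iterS -[(2 * m).+2]/(2 + 2 * m)%N -mulnS.
rewrite [X in _ + X]big_ord_recr addrA -big_split; congr (_ + _).
  apply: eq_bigr => i _; rewrite !lift0 subSS.
  have -> : (m - i = (m - i.+1).+1)%N by have := ltn_ord i; lia.
  exact: wordsS.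
rewrite lift0 !subSS subnn (_ : words m.+1 0 = \sum_(c < 1) iter (2 * c) (@jderiv R) (u * words m (0 - c)%N)) //.
by rewrite big_ord_recl big_ord0 addr0.
Qed.

End words.

Section finite_functions.
Variable T : finType.

Definition fcons q (x : T) (g : {ffun 'I_q -> T}) : {ffun 'I_q.+1 -> T} :=
  [ffun i => if unlift ord0 i is Some j then g j else x].

Lemma fcons0 q x (g : {ffun 'I_q -> T}) : fcons x g ord0 = x.
Proof. by rewrite ffunE unlift_none. Qed.

Lemma fconsS q x (g : {ffun 'I_q -> T}) i : fcons x g (lift ord0 i) = g i.
Proof. by rewrite ffunE liftK. Qed.

Lemma sum_fcons (V : nmodType) q (F : {ffun 'I_q.+1 -> T} -> V) :
  \sum_f F f = \sum_x \sum_(g : {ffun 'I_q -> T}) F (fcons x g).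
Proof.
rewrite pair_bigA (reindex (fun p : T * {ffun 'I_q -> T} => fcons p.1 p.2)) //=.
exists (fun f => (f ord0, [ffun i => f (lift ord0 i)])) => [[x g] _|f _] /=.
  by rewrite fcons0; congr pair; apply/ffunP => i; rewrite ffunE fconsS.
apply/ffunP => i; case: (unliftP ord0 i) => [j ->|->]; first by rewrite fconsS ffunE.
by rewrite fcons0.
Qed.

Lemma sum_ffun0 (V : nmodType) (F : {ffun 'I_0 -> T} -> V) (g : {ffun 'I_0 -> T}) : \sum_f F f = F g.
Proof.
rewrite (bigD1 g) //= big1 ?addr0 // => f /eqP []; apply/ffunP => -[].
by [].
Qed.

End finite_functions.

Section expansion.
Variables (R : realType) (u : jet R) (j M K : nat).
Hypothesis MK : (2 * M <= K + 2 * j)%N.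

(** The condition on l in the coefficients C, relative to a word that is already
    read in part: lo letters d^2 have been met, and s of their 2 lo derivatives
    have been spent on the letters u met so far. *)
Definition admissible q (lo s : nat) (k : 'I_q -> nat) (l : {ffun 'I_q -> 'I_M.+1}) : bool :=
  [&& [forall i : 'I_q, forall i' : 'I_q, (i <= i') ==> (l i <= l i')],
      [forall i : 'I_q, lo <= l i] &
      [forall i : 'I_q, s + psum k i.+1 <= 2 * l i]]%N.

(** The condition on the total says that exactly 2 j derivatives are left for
    x^(2j); with fewer or more its value at 0 is zero. *)
Definition path_term q (lo s : nat) (k : {ffun 'I_q -> 'I_K.+1})
    (l : {ffun 'I_q -> 'I_M.+1}) : R :=
  if admissible lo s (fun i => k i : nat) l && (s + \sum_(i < q) k i + 2 * j == 2 * M)%N then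
    (\prod_(i < q) 'C(2 * l i - (s + psum (fun i => k i : nat) i), k i)%N)%:R *
    \prod_(i < q) u (k i)
  else 0.

Definition path_sum q (lo s : nat) : R :=
  \sum_(k : {ffun 'I_q -> 'I_K.+1}) \sum_l path_term lo s k l.

Lemma psum0 q (k : 'I_q -> nat) : psum k 0 = 0%N.
Proof. by rewrite /psum big_pred0. Qed.

Lemma psum_fcons q (x : 'I_K.+1) (k : {ffun 'I_q -> 'I_K.+1}) i :
  psum (fun i => fcons x k i : nat) i.+1 = (x + psum (fun i => k i : nat) i)%N.
Proof.
rewrite /psum big_mkcond big_ord_recl /= fcons0; congr (_ + _)%N.
rewrite [in RHS]big_mkcond; apply: eq_bigr => m _.
by rewrite fconsS /bump /= add1n ltnS.
Qed.

Lemma admissible_fcons q lo s (x : 'I_K.+1) (y : 'I_M.+1) (k : {ffun 'I_q -> 'I_K.+1}) l :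
  admissible lo s (fun i => fcons x k i : nat) (fcons y l) =
  [&& (lo <= y)%N, (s + x <= 2 * y)%N & admissible y (s + x) (fun i => k i : nat) l].
Proof.
apply/and3P/and3P => [[/forallP h1 /forallP h2 /forallP h3]|[h1 h2 /and3P[/forallP h3 /forallP h4 /forallP h5]]].
  split.
  - by have := h2 ord0; rewrite fcons0.
  - by have := h3 ord0; rewrite fcons0 psum_fcons psum0 addn0.
  - apply/and3P; split; apply/forallP => i.
    + apply/forallP => i'; have /forallP/(_ (lift ord0 i')) := h1 (lift ord0 i).
      by rewrite !fconsS /= /bump /= !add1n ltnS.
    + by have /forallP/(_ (lift ord0 i)) := h1 ord0; rewrite fcons0 fconsS.
    + by have := h3 (lift ord0 i); rewrite fconsS lift0 psum_fcons addnA.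
split; apply/forallP => i.
- apply/forallP => i'; case: (unliftP ord0 i) => [i1 ->|->]; case: (unliftP ord0 i') => [i2 ->|->].
  + by rewrite !fconsS /= /bump /= !add1n ltnS; have /forallP := h3 i1; apply.
  + by rewrite /= /bump.
  + by rewrite fcons0 fconsS; apply/implyP => _; exact: h4.
  + by rewrite !leqnn.
- case: (unliftP ord0 i) => [i1 ->|->]; rewrite ?fcons0 ?fconsS //.
  exact: leq_trans h1 (h4 i1).
- case: (unliftP ord0 i) => [i1 ->|->]; rewrite ?fcons0 ?fconsS ?lift0 psum_fcons.
    by rewrite addnA; exact: h5.
  by rewrite psum0 addn0.
Qed.

Lemma path_term_fcons q lo s (x : 'I_K.+1) (y : 'I_M.+1) (k : {ffun 'I_q -> 'I_K.+1}) l :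
  path_term lo s (fcons x k) (fcons y l) =
  if ((lo <= y) && (s + x <= 2 * y))%N then
    'C(2 * y - s, x)%:R * u x * path_term y (s + x) k l else 0.
Proof.
rewrite /path_term admissible_fcons big_ord_recl fcons0.
under eq_bigr => i _ do rewrite fconsS.
rewrite addnA -!andbA.
case: (lo <= y)%N => //=; case: (s + x <= 2 * y)%N => //=.
case: ifP => _; last by rewrite mulr0.
rewrite 2!big_ord_recl !fcons0 psum0 addn0 natrM.
rewrite (eq_bigr (fun i => 'C(2 * l i - (s + x + psum (fun i => k i : nat) i), k i)%N)) => [|i _]; last first.
  by rewrite !fconsS lift0 psum_fcons addnA.
rewrite [X in _ * _ * (_ * X)](eq_bigr (fun i => u (k i))) => [|i _]; last by rewrite fconsS.
by ring.
Qed.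

Lemma path_sumS q lo s :
  path_sum q.+1 lo s = \sum_(x < K.+1) \sum_(y < M.+1)
    if ((lo <= y) && (s + x <= 2 * y))%N then
      'C(2 * y - s, x)%:R * u x * path_sum q y (s + x) else 0.
Proof.
rewrite /path_sum sum_fcons; apply: eq_bigr => x _.
under eq_bigr => k _ do rewrite sum_fcons.
rewrite exchange_big; apply: eq_bigr => y _ /=.
under eq_bigr => k _ do under eq_bigr => l _ do rewrite path_term_fcons.
case: ifP => _; last by rewrite big1 // => k _; rewrite big1.
rewrite mulr_sumr; apply: eq_bigr => k _.
by rewrite mulr_sumr.
Qed.

Lemma path_sum_large q lo s : (2 * M < s + 2 * j)%N -> path_sum q lo s = 0.
Proof.
move=> h; rewrite /path_sum big1 // => k _; rewrite big1 // => l _.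
by rewrite /path_term (_ : (_ == 2 * M)%N = false) ?andbF //; lia.
Qed.

(** Induction on the number of letters u: if y letters d^2 stand in front of the
    next letter u, there are 2 y - s derivatives to share between that letter and
    what follows it, which produces the binomial coefficient. *)
Lemma words_path_sum q lo s : (lo <= M)%N -> (s <= 2 * lo)%N ->
  words u (monomial_jet R j) q (M - lo)%N (2 * lo - s)%N = (2 * j)`!%:R * path_sum q lo s.
Proof.
elim: q lo s => [|q IH] lo s loM slo.
  rewrite /= iter_jderiv /monomial_jet /path_sum.
  rewrite (sum_ffun0 _ [ffun=> ord0]) (sum_ffun0 _ [ffun=> ord0]) /path_term !big_ord0 addn0.
  rewrite (_ : admissible _ _ _ _ = true) /=; last by apply/and3P; split; apply/forallP => -[].
  rewrite mulr1; have -> : (2 * (M - lo) + (2 * lo - s) == 2 * j)%N = (s + 2 * j == 2 * M)%N by lia.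
  by case: ifP => _; rewrite ?mulr1 ?mulr0.
rewrite path_sumS exchange_big /= jet_sumE mulr_sumr.
pose F y : R := \sum_(x < K.+1) if (s + x <= 2 * y)%N then
      'C(2 * y - s, x)%:R * u x * path_sum q y (s + x) else 0.
rewrite [RHS](_ : _ = \sum_(y < M.+1 | (lo <= y)%N) (2 * j)`!%:R * F y); last first.
  rewrite [RHS]big_mkcond; apply: eq_bigr => y _; rewrite /F.
  case: (lo <= y)%N => //=; by rewrite big1 ?mulr0.
rewrite -(big_mkord (fun y => (lo <= y)%N) (fun y => (2 * j)`!%:R * F y)).
rewrite (@big_cat_nat _ _ _ lo) //; last by rewrite (leq_trans loM).
rewrite [\big[_/_]_(0 <= i < lo | _) _]big1_seq /= ?add0r; last first.
  by move=> y /andP[h1]; rewrite mem_index_iota => /andP[_ h2]; lia.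
rewrite [RHS](_ : _ = \sum_((0 + lo)%N <= i < M.+1 | (lo <= i)%N) (2 * j)`!%:R * F i) //.
rewrite big_addn subSn // big_mkord [RHS]big_mkcond.
apply: eq_bigr => c _ /=; rewrite iter_jderiv leq_addl.
have cM : (c + lo <= M)%N by have := ltn_ord c; lia.
rewrite jmulE /F mulr_sumr.
(* Both sides are sums of G over initial segments; G vanishes beyond the
   shorter one, either by its binomial coefficient or because more derivatives
   would be spent than there are. *)
pose G x : R := 'C(2 * (c + lo) - s, x)%:R * u x * ((2 * j)`!%:R * path_sum q (c + lo)%N (s + x)).
have -> : (2 * c + (2 * lo - s) = 2 * (c + lo) - s)%N by lia.
transitivity (\sum_(x < (2 * (c + lo) - s).+1) G x).
  apply: eq_bigr => x _; rewrite /G -IH //; last by have := ltn_ord x; lia.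
  congr (_ * words _ _ _ _ _); lia.
have G0 x : (2 * (c + lo) < s + x)%N -> G x = 0.
  by move=> h; rewrite /G bin_small ?mul0r //; lia.
have G1 x : (K < x)%N -> G x = 0.
  by move=> h; rewrite /G path_sum_large ?mulr0 //; lia.
transitivity (\sum_(x < K.+1) G x); last first.
  apply: eq_bigr => x _; case: leqP => h; last by rewrite mulr0 G0.
  by rewrite /G mulrCA.
set A := (2 * (c + lo) - s).+1.
have hA x : (A <= x)%N -> G x = 0 by rewrite /A => h; apply: G0; lia.
have extend (B C : nat) : (B <= C)%N -> (forall x, (B <= x)%N -> G x = 0) ->
    \sum_(x < B) G x = \sum_(x < C) G x.
  move=> BC hB; rewrite -(subnKC BC) big_split_ord /= [X in _ + X]big1 ?addr0 // => x _.
  by rewrite hB // leq_addr.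
have [AK|KA] := leqP A K.+1; first exact: extend.
by apply/esym; apply: extend; [exact: ltnW|exact: G1].
Qed.

End expansion.

Section monomial_expansion.
Variable R : realType.

(** A word with p letters u has j + n - p letters d^2.  The word without u
    contributes nothing, as it differentiates x^(2j) more than 2 j times. *)
Lemma schr_monomial (u : jet R) n j : (0 < n)%N ->
  iter (j + n) (jschr u) (monomial_jet R j) 0%N = (2 * j)`!%:R *
  \sum_(1 <= p < (j + n).+1)
    \sum_(k : {ffun 'I_p -> 'I_(2 * n).+1} | (\sum_(i < p) k i + 2 * p == 2 * n)%N)
      (Ccoef (j + n) (fun i : 'I_p => nat_of_ord (k i)))%:R * \prod_(i < p) u (k i).
Proof.
move=> n0; rewrite iter_jschr_words jet_sumE.
have wE q : (q <= j + n)%N -> words u (monomial_jet R j) q (j + n - q)%N 0%N =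
    (2 * j)`!%:R * path_sum u j (j + n - q) (2 * n) q 0 0.
  by move=> qn; rewrite -words_path_sum ?muln0 ?subn0 //; lia.
rewrite (eq_bigr (fun q : 'I_(j + n).+1 => (2 * j)`!%:R * path_sum u j (j + n - q) (2 * n) q 0 0)); last first.
  by move=> q _; apply: wE; rewrite -ltnS.
rewrite -mulr_sumr; congr (_ * _).
rewrite -(big_mkord xpredT (fun q => path_sum u j (j + n - q) (2 * n) q 0 0)).
rewrite big_ltn // [X in X + _](_ : _ = 0) ?add0r; last first.
  rewrite /path_sum big1 // => k _; rewrite big1 // => l _; rewrite /path_term big_ord0.
  by rewrite (_ : (_ == _) = false) ?andbF //; lia.
rewrite big_seq [in RHS]big_seq; apply: eq_bigr => p; rewrite mem_index_iota => /andP[p0 pn].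
rewrite /path_sum [RHS]big_mkcond; apply: eq_bigr => k _.
rewrite /path_term.
rewrite (_ : (0 + \sum_(i < p) k i + 2 * j == 2 * (j + n - p))%N = (\sum_(i < p) k i + 2 * p == 2 * n)%N); last by lia.
case: ifP => _; last by rewrite big1 // => l _; rewrite andbF.
rewrite /Ccoef natr_sum mulr_suml [RHS]big_mkcond; apply: eq_bigr => l _.
rewrite andbT /admissible (_ : [forall i : 'I_p, 0 <= l i]%N = true) //; last exact/forallP.
Qed.

End monomial_expansion.

(** * Jets of reflectionless potentials *)

Section differential_closure.
Variable R : realType.
Implicit Types (f g : R -> R) (x : R).

Section closure.
Variable gen : (R -> R) -> Prop.

(** Polynomials in the generators.  As soon as the generators have their
    derivatives in it, this algebra is closed under differentiation, which gives
    smoothness and the Leibniz rule to all orders at once. *)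
Inductive poly_closure : (R -> R) -> Prop :=
| pc_gen g : gen g -> poly_closure g
| pc_cst (c : R) : poly_closure (fun=> c)
| pc_add f g : poly_closure f -> poly_closure g -> poly_closure (fun x => f x + g x)
| pc_mul f g : poly_closure f -> poly_closure g -> poly_closure (fun x => f x * g x).

Hypothesis gen_derive : forall g, gen g ->
  exists2 g', poly_closure g' & forall x : R, is_derive x 1 g (g' x).

Lemma pc_sum n (F : 'I_n -> R -> R) : (forall i, poly_closure (F i)) ->
  poly_closure (fun x => \sum_(i < n) F i x).
Proof.
elim: n F => [|n IH] F hF.
  rewrite (_ : (fun _ => _) = (fun=> 0)); first exact: pc_cst.
  by apply/funext => x; rewrite big_ord0.
rewrite (_ : (fun _ => _) = (fun x => \sum_(i < n) F (widen_ord (leqnSn n) i) x + F ord_max x)).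
  by apply: pc_add => //; apply: IH.
by apply/funext => x; rewrite big_ord_recr.
Qed.

Lemma pc_derive f : poly_closure f ->
  exists2 f', poly_closure f' & forall x : R, is_derive x 1 f (f' x).
Proof.
elim=> {f} [g|c|f g pf [f' pf' df] pg [g' pg' dg]|f g pf [f' pf' df] pg [g' pg' dg]].
- exact: gen_derive.
- by exists (fun=> 0); [exact: pc_cst|move=> x; exact: is_derive_cst].
- exists (fun x => f' x + g' x); first exact: pc_add.
  by move=> x; apply: derive_add.
- exists (fun x => f' x * g x + f x * g' x); first by apply: pc_add; apply: pc_mul.
  by move=> x; apply: derive_mul.
Qed.

Lemma pc_derive1 f : poly_closure f ->
  poly_closure f^`() /\ forall x, is_derive x 1 f (f^`() x).
Proof.
move=> /pc_derive [f' pf' df]; suff -> : f^`() = f' by [].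
by apply/funext => x; exact: derive1_is_derive.
Qed.

Lemma pc_derive1n f k : poly_closure f -> poly_closure f^`(k)%classic.
Proof. by move=> pf; elim: k => [//|k IH]; exact: (pc_derive1 IH).1. Qed.

Lemma pc_smooth f : poly_closure f -> smooth f.
Proof.
by move=> pf k x; have [_ /(_ x) []] := pc_derive1 (pc_derive1n k pf).
Qed.

Definition jet_of f : jet R := fun k => f^`(k)%classic 0.

Lemma jet_of_derive f g : (forall x : R, is_derive x 1 f (g x)) ->
  jet_of g = jderiv (jet_of f).
Proof.
move=> fg; apply/funext => k; rewrite /jet_of /jderiv /derive1n iterSr.
by congr (iter _ _ _ _); apply/funext => x; rewrite (derive1_is_derive (fg x)).
Qed.

Lemma jet_of_cst (c : R) : jet_of (fun=> c) = jconst c.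
Proof.
have d0 (d : R) : (fun=> d : R)^`() = (fun=> 0 : R).
  by apply/funext => x; apply: derive1_is_derive; exact: is_derive_cst.
apply/funext => -[//|k]; rewrite /jet_of /derive1n iterSr d0.
by elim: k => [//|k IH]; rewrite iterSr d0.
Qed.

Lemma jet_of_add f g : poly_closure f -> poly_closure g ->
  jet_of (fun x => f x + g x) = jet_of f + jet_of g.
Proof.
move=> pf pg; apply/funext => k; elim: k f g pf pg => [//|k IH] f g pf pg.
have [pf' df] := pc_derive1 pf; have [pg' dg] := pc_derive1 pg.
have e : forall x : R, is_derive x 1 (fun x => f x + g x) (derive1 f x + derive1 g x).
  by move=> x; exact: derive_add.
have eS h : jet_of h k.+1 = jderiv (jet_of h) k by [].
rewrite jetDE !eS -(jet_of_derive e) -(jet_of_derive df) -(jet_of_derive dg).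
by rewrite IH.
Qed.

Lemma jet_of_mul f g : poly_closure f -> poly_closure g ->
  jet_of (fun x => f x * g x) = jet_of f * jet_of g.
Proof.
move=> pf pg; apply/funext => k; elim: k f g pf pg => [|k IH] f g pf pg.
  by rewrite jmulE0.
have [pf' df] := pc_derive1 pf; have [pg' dg] := pc_derive1 pg.
have e : forall x : R, is_derive x 1 (fun x => f x * g x) (derive1 f x * g x + f x * derive1 g x).
  by move=> x; exact: derive_mul.
have eS h : jet_of h k.+1 = jderiv (jet_of h) k by [].
have eS2 (a : jet R) : a k.+1 = jderiv a k by [].
rewrite eS [RHS]eS2 -(jet_of_derive e) jderivM -(jet_of_derive df) -(jet_of_derive dg).
rewrite jet_of_add; [|exact: pc_mul|exact: pc_mul].
by rewrite !jetDE !IH.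
Qed.

Lemma jet_of_sum n (F : 'I_n -> R -> R) : (forall i, poly_closure (F i)) ->
  jet_of (fun x => \sum_(i < n) F i x) = \sum_(i < n) jet_of (F i).
Proof.
elim: n F => [|n IH] F hF.
  rewrite big_ord0 (_ : (fun _ => _) = (fun=> 0)).
    by rewrite jet_of_cst; apply/funext => -[].
  by apply/funext => x; rewrite big_ord0.
rewrite (_ : (fun _ => _) = (fun x => \sum_(i < n) F (widen_ord (leqnSn n) i) x + F ord_max x)).
  rewrite jet_of_add //; last by apply: pc_sum.
  by rewrite IH // big_ord_recr.
by apply/funext => x; rewrite big_ord_recr.
Qed.

End closure.

End differential_closure.

Section soliton_jets.
Variables (R : realType) (N : nat) (kappa gamma : 'I_N -> R).
Hypothesis kappa_gt0 : forall i, 0 < kappa i.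
Local Notation state := (state kappa gamma).
Local Notation resolvent := (resolvent kappa gamma).
Local Notation potential := (potential kappa gamma).

Inductive soliton_gen : (R -> R) -> Prop :=
| gen_resolvent i j : soliton_gen (fun x => resolvent x i j)
| gen_state i : soliton_gen (state i)
| gen_sinh i : soliton_gen (fun x => sinhR (kappa i * x))
| gen_cosh i : soliton_gen (fun x => coshR (kappa i * x)).

Local Notation pc := (poly_closure soliton_gen).

Lemma pc_state i : pc (state i). Proof. by apply: pc_gen; exact: gen_state. Qed.
Lemma pc_resolvent i j : pc (fun x => resolvent x i j).
Proof. by apply: pc_gen; exact: gen_resolvent. Qed.
Lemma pc_sinh i : pc (fun x => sinhR (kappa i * x)).
Proof. by apply: pc_gen; exact: gen_sinh. Qed.
Lemma pc_cosh i : pc (fun x => coshR (kappa i * x)).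
Proof. by apply: pc_gen; exact: gen_cosh. Qed.

Lemma pc_dressed i : pc (fun x => \sum_(j < N) resolvent x i j * (kappa j * state j x)).
Proof.
apply: pc_sum => j; apply: pc_mul; first exact: pc_resolvent.
by apply: pc_mul; [exact: pc_cst|exact: pc_state].
Qed.

Lemma pc_dstate i : pc (dstate kappa gamma i).
Proof.
rewrite (_ : dstate _ _ _ = (fun x => kappa i * state i x +
  - 2 * \sum_(j < N) resolvent x i j * (kappa j * state j x))); last first.
  by apply/funext => x; rewrite /dstate mulNr.
apply: pc_add; apply: pc_mul; try exact: pc_cst; first exact: pc_state.
exact: pc_dressed.
Qed.

Lemma pc_potential : pc potential.
Proof.
apply: pc_mul; first exact: pc_cst.
apply: pc_sum => i; apply: pc_mul; first exact: pc_cst.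
rewrite (_ : (fun x => _) = (fun x => state i x * state i x)); last first.
  by apply/funext => x; rewrite expr2.
by apply: pc_mul; exact: pc_state.
Qed.

Lemma soliton_gen_derive g : soliton_gen g ->
  exists2 g', pc g' & forall x : R, is_derive x 1 g (g' x).
Proof.
case=> [i j|i|i|i].
- exists (fun x => state i x * state j x); first by apply: pc_mul; exact: pc_state.
  by move=> x; exact: is_derive_resolvent.
- exists (dstate kappa gamma i); first exact: pc_dstate.
  by move=> x; exact: is_derive_state.
- exists (fun x => kappa i * coshR (kappa i * x)).
    by apply: pc_mul; [exact: pc_cst|exact: pc_cosh].
  by move=> x; exact: (derive_scale (is_derive_sinhR _)).
- exists (fun x => kappa i * sinhR (kappa i * x)).
    by apply: pc_mul; [exact: pc_cst|exact: pc_sinh].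
  by move=> x; exact: (derive_scale (is_derive_coshR _)).
Qed.

Lemma potential_smooth : smooth potential.
Proof. exact: (pc_smooth soliton_gen_derive pc_potential). Qed.

Let jmulP f g : pc f -> pc g -> _ := @jet_of_mul R _ soliton_gen_derive f g.
Let jaddP f g : pc f -> pc g -> _ := @jet_of_add R _ soliton_gen_derive f g.
Let jsumP n F : _ -> _ := @jet_of_sum R _ soliton_gen_derive n F.

Definition cosh_jet (k : R) : jet R := fun m => if odd m then 0 else k ^+ m.

Lemma jderiv_sinh_jet (k : R) : jderiv (sinh_jet k) = jconst k * cosh_jet k.
Proof.
apply/funext => m; rewrite jconstM /jderiv /sinh_jet /cosh_jet /= exprS.
by case: (odd m); rewrite //= mulr0.
Qed.

Lemma jderiv_cosh_jet (k : R) : jderiv (cosh_jet k) = jconst k * sinh_jet k.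
Proof.
apply/funext => m; rewrite jconstM /jderiv /sinh_jet /cosh_jet /= exprS.
by case: (odd m); rewrite //= mulr0.
Qed.

Lemma jet_of_sinh i : jet_of (fun x => sinhR (kappa i * x)) = sinh_jet (kappa i) /\
  jet_of (fun x => coshR (kappa i * x)) = cosh_jet (kappa i).
Proof.
pose s := jet_of (fun x => sinhR (kappa i * x)); pose c := jet_of (fun x => coshR (kappa i * x)).
have ds : jderiv s = jconst (kappa i) * c.
  have d (x : R) : is_derive x 1 (fun x => sinhR (kappa i * x)) (kappa i * coshR (kappa i * x)).
    exact: (derive_scale (is_derive_sinhR _)).
  rewrite -(jet_of_derive d) jmulP ?jet_of_cst //; [exact: pc_cst|exact: pc_cosh].
have dc : jderiv c = jconst (kappa i) * s.
  have d (x : R) : is_derive x 1 (fun x => coshR (kappa i * x)) (kappa i * sinhR (kappa i * x)).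
    exact: (derive_scale (is_derive_coshR _)).
  rewrite -(jet_of_derive d) jmulP ?jet_of_cst //; [exact: pc_cst|exact: pc_sinh].
have h m : s m = sinh_jet (kappa i) m /\ c m = cosh_jet (kappa i) m.
  elim: m => [|m [IHs IHc]].
    by rewrite /s /c /jet_of /= mulr0 /sinhR /coshR oppr0 expR0 subrr mul0r -mulr2n divff.
  split.
    by rewrite -[s m.+1]/(jderiv s m) -[sinh_jet _ m.+1]/(jderiv (sinh_jet _) m) ds jderiv_sinh_jet !jconstM IHc.
  by rewrite -[c m.+1]/(jderiv c m) -[cosh_jet _ m.+1]/(jderiv (cosh_jet _) m) dc jderiv_cosh_jet !jconstM IHs.
by split; apply/funext => m; have [] := h m.
Qed.

Lemma jet_state_eigen i :
  jderiv (jderiv (jet_of (state i))) =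
  jconst (kappa i) * jconst (kappa i) * jet_of (state i) - jet_of potential * jet_of (state i).
Proof.
rewrite -(jet_of_derive (is_derive_state gamma kappa_gt0 i)) -(jet_of_derive (is_derive_dstate gamma kappa_gt0 i)).
rewrite (_ : ddstate _ _ _ = (fun x => (kappa i * kappa i) * state i x + - 1 * (potential x * state i x))); last first.
  by apply/funext => x; rewrite -expr2 -(state_eigen gamma kappa_gt0) mulN1r addrK.
have ps := pc_state i; have pp := pc_mul pc_potential ps.
rewrite jaddP; [|by apply: pc_mul => //; exact: pc_cst|by apply: pc_mul => //; exact: pc_cst].
rewrite (jmulP (pc_cst _ (kappa i * kappa i)) ps) (jmulP (pc_cst _ (-1)) pp).
rewrite (jmulP pc_potential ps) !jet_of_cst.
have -> : jconst (kappa i * kappa i) = jconst (kappa i) * jconst (kappa i).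
  by apply/funext => -[|m]; rewrite jconstM //= mulr0.
have -> : jconst (-1) = -1 :> jet R by apply/funext => -[|m] //; rewrite jetNE /= oppr0.
by rewrite mulN1r.
Qed.

Lemma jet_potential : jet_of potential = 4 * \sum_(i < N) jconst (jet_of (state i) 0%N) *
  (jderiv (jet_of (state i)) * sinh_jet (kappa i) +
   jconst (kappa i) * jet_of (state i) * cosh_jet (kappa i)).
Proof.
have e4 : 4 = jconst 4 :> jet R.
  by apply/funext => -[|m] //=; rewrite (_ : 4 = jconst 2 * 2 :> jet R) ?jconstM ?jet2E ?mulr0 // -jet2E; ring.
rewrite {1}(_ : potential = (fun x => 4 * \sum_(i < N) state i 0 * (dstate kappa gamma i x * sinhR (kappa i * x) +
    kappa i * state i x * coshR (kappa i * x)))); last first.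
  apply/funext => x; rewrite -(state_potential gamma kappa_gt0 x 0); congr (_ * _).
  by apply: eq_bigr => i _; rewrite subr0.
have h1 i : pc (fun x => dstate kappa gamma i x * sinhR (kappa i * x)).
  by apply: pc_mul; [exact: pc_dstate|exact: pc_sinh].
have h0 i : pc (fun x => kappa i * state i x).
  by apply: pc_mul; [exact: pc_cst|exact: pc_state].
have h2 i : pc (fun x => kappa i * state i x * coshR (kappa i * x)).
  by apply: pc_mul; [exact: h0|exact: pc_cosh].
have h3 i : pc (fun x => state i 0 * (dstate kappa gamma i x * sinhR (kappa i * x) +
    kappa i * state i x * coshR (kappa i * x))).
  by apply: pc_mul; [exact: pc_cst|exact: pc_add].
rewrite jmulP; [|exact: pc_cst|exact: pc_sum].
rewrite jet_of_cst e4 jsumP //; congr (_ * _); apply: eq_bigr => i _.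
rewrite jmulP; [|exact: pc_cst|exact: pc_add].
rewrite jet_of_cst jaddP // jmulP; [|exact: pc_dstate|exact: pc_sinh].
rewrite (jmulP (h0 i) (pc_cosh i)) (jmulP (pc_cst _ _) (pc_state i)) jet_of_cst.
have [-> ->] := jet_of_sinh i.
by rewrite (jet_of_derive (is_derive_state gamma kappa_gt0 i)).
Qed.

(** The heat coefficient on the left, computed from the kernel, is brought into the
    form of the right-hand side by the dressing transformation. *)
Lemma soliton_coef_jets n : (0 < n)%N ->
  soliton_coef kappa (fun i => state i 0) n =
  \sum_(j < n.+1) kdv_weight R n j * iter (j + n) (jschr (jet_of potential)) (monomial_jet R j) 0%N.
Proof.
move=> n0; rewrite -[LHS](@kdv_weight_dress R N kappa (fun i => jet_of (state i)) n n0).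
apply: eq_bigr => j _; congr (_ * _).
rewrite (iter_schr jet_state_eigen (fun i => jderiv_sinh_jet _) (fun i => jderiv_cosh_jet _) _ jet_potential).
  by rewrite addnC.
by move=> i m; rewrite /sinh_jet oddM.
Qed.

End soliton_jets.

(** * Density of the jets of reflectionless potentials *)

Section small_solitons.
Variables (R : realType) (N : nat) (kappa g : 'I_N -> R).
Hypothesis kappa_gt0 : forall i, 0 < kappa i.

Let gam (d : R) : 'I_N -> R := fun i => d * g i.
Let X (d : R) (i : 'I_N) : jet R := jet_of (state kappa (gam d) i).
Let B (d : R) (i j : 'I_N) : jet R := jet_of (fun x => resolvent kappa (gam d) x i j).

Lemma jderiv_state_jet d i :
  jderiv (X d i) = jconst (kappa i) * X d i -
    jconst 2 * \sum_(j < N) B d i j * (jconst (kappa j) * X d j).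
Proof.
rewrite -(jet_of_derive (is_derive_state (gam d) kappa_gt0 i)).
rewrite (_ : dstate _ _ _ = (fun x => kappa i * state kappa (gam d) i x +
  - 2 * \sum_(j < N) resolvent kappa (gam d) x i j * (kappa j * state kappa (gam d) j x))); last first.
  by apply/funext => x; rewrite /dstate mulNr.
have sg := @soliton_gen_derive R N kappa (gam d) kappa_gt0.
have ps k := pc_state kappa (gam d) k.
have pr k := pc_resolvent kappa (gam d) i k.
have p1 k := pc_mul (pc_cst _ (kappa k)) (ps k).
rewrite (jet_of_add sg (p1 i) (pc_mul (pc_cst _ (- 2)) (pc_dressed kappa (gam d) i))).
rewrite (jet_of_mul sg (pc_cst _ (kappa i)) (ps i)) jet_of_cst.
rewrite (jet_of_mul sg (pc_cst _ (- 2)) (pc_dressed kappa (gam d) i)) jet_of_cst.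
rewrite (jet_of_sum sg (fun k => pc_mul (pc_resolvent kappa (gam d) i k) (p1 k))).
have -> : jconst (- 2) = - jconst 2 :> jet R by apply/funext => -[|m] //; rewrite jetNE /= oppr0.
rewrite mulNr; congr (_ - _ * _); apply: eq_bigr => j _.
by rewrite (jet_of_mul sg (pr j) (p1 j)) (jet_of_mul sg (pc_cst _ (kappa j)) (ps j)) jet_of_cst.
Qed.

Lemma jderiv_resolvent_jet d i j : jderiv (B d i j) = X d i * X d j.
Proof.
have sg := @soliton_gen_derive R N kappa (gam d) kappa_gt0.
rewrite -(jet_of_derive (is_derive_resolvent (gam d) kappa_gt0 i j)).
exact: (jet_of_mul sg (pc_state kappa (gam d) i) (pc_state kappa (gam d) j)).
Qed.

Lemma potential_jetE d : jet_of (potential kappa (gam d)) =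
  jconst 4 * \sum_(i < N) jconst (kappa i) * (X d i * X d i).
Proof.
have sg := @soliton_gen_derive R N kappa (gam d) kappa_gt0.
have ps k := pc_state kappa (gam d) k.
rewrite (_ : potential _ _ = (fun x => 4 * \sum_(i < N) kappa i * (state kappa (gam d) i x * state kappa (gam d) i x))); last first.
  by apply/funext => x; congr (_ * _); apply: eq_bigr => i _; rewrite expr2.
have p1 k := pc_mul (pc_cst _ (kappa k)) (pc_mul (ps k) (ps k)).
rewrite (jet_of_mul sg (pc_cst _ 4) (pc_sum p1)) jet_of_cst (jet_of_sum sg p1); congr (_ * _).
apply: eq_bigr => i _.
by rewrite (jet_of_mul sg (pc_cst _ (kappa i)) (pc_mul (ps i) (ps i))) jet_of_cst (jet_of_mul sg (ps i) (ps i)).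
Qed.

Lemma cvg_resolvent0 i j :
  B d i j 0%N @[d --> (0 : R)^'+] --> ((i == j)%:R : R).
Proof.
apply: cvg_at_right_filter.
pose A (d : R) := soliton_mx kappa (gam d) 0.
have uA d : A d \in unitmx by exact: soliton_mx_unit.
have AE d k l : A d k l = (k == l)%:R + d * d * (g k * g l / (kappa k + kappa l)).
  by rewrite !mxE /expo !mulr0 expR0 !mulr1 /gam; congr (_ + _); ring.
have dA (x : R) k l : derivable (fun d => A d k l) x 1.
  rewrite (_ : (fun d => _) = (fun d => (k == l)%:R + d * d * (g k * g l / (kappa k + kappa l)))).
    have h := derive_add (is_derive_cst ((k == l)%:R : R) x 1)
     (derive_mulr (g k * g l / (kappa k + kappa l)) (derive_mul (is_derive_id x 1) (is_derive_id x 1))).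
    by case: h.
  by apply/funext => d; rewrite AE.
have c : {for 0, continuous (fun d => invmx (A d) i j)}.
  apply: differentiable_continuous; apply/derivable1_diffP.
  exact: (@derivable_invmx _ _ _ _ uA (dA 0)).
have -> : (i == j)%:R = invmx (A 0) i j.
  rewrite (_ : A 0 = 1%:M) ?invmx1 ?mxE //.
  by apply/matrixP => k l; rewrite AE !mul0r addr0 mxE.
exact: c.
Qed.

(** To leading order in the amplitude d, B is the identity and chi_i is
    d g_i exp (- kappa_i x).  Derivatives follow by induction from the equations
    B' = chi chi^T and chi' = K chi - 2 B K chi, which need no control of the
    limit away from the base point. *)
Lemma cvg_state_resolvent k :
  (forall i, X d i k / d @[d --> (0 : R)^'+] --> g i * (- kappa i) ^+ k) /\
  (forall i j, B d i j k @[d --> (0 : R)^'+] --> (((i == j) && (k == 0%N))%:R : R)).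
Proof.
elim/ltn_ind: k => -[_|k IH].
  split=> [i|i j]; last by rewrite andbT; exact: cvg_resolvent0.
  have : \sum_(j < N) B d i j 0%N * g j @[d --> (0 : R)^'+] --> \sum_(j < N) (i == j)%:R * g j.
    apply: cvg_big => [|j _]; first exact: add_continuous.
    by apply: cvgM; [exact: cvg_resolvent0|exact: cvg_cst].
  have -> : \sum_(j < N) (i == j)%:R * g j = g i.
    rewrite (bigD1 i) //= eqxx mul1r big1 ?addr0 // => j ji.
    by rewrite eq_sym (negbTE ji) mul0r.
  rewrite expr0 mulr1; apply: cvg_trans; apply: near_eq_cvg; near=> d.
  have d0 : d != 0 by rewrite gt_eqF//; near: d; exact: nbhs_right_gt.
  rewrite /X /jet_of /= stateE mulr_suml; apply: eq_bigr => j _.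
  by rewrite /expo mulr0 expR0 mulr1 /gam /B /jet_of /=; field.
have IX a i : (a <= k)%N -> X d i a / d @[d --> (0 : R)^'+] --> g i * (- kappa i) ^+ a.
  by move=> ak; have [h _] := IH a ak; exact: h.
have IB a i j : (a <= k)%N -> B d i j a @[d --> (0 : R)^'+] --> (((i == j) && (a == 0%N))%:R : R).
  by move=> ak; have [_ h] := IH a ak; exact: h.
split=> [i|i j].
  have : kappa i * (X d i k / d) - 2 * \sum_(j < N) \sum_(a < k.+1)
      'C(k, a)%:R * B d i j a * (kappa j * (X d j (k - a)%N / d)) @[d --> (0 : R)^'+] -->
    kappa i * (g i * (- kappa i) ^+ k) - 2 * \sum_(j < N) \sum_(a < k.+1)
      'C(k, a)%:R * ((i == j) && (a == 0%N :> nat))%:R * (kappa j * (g j * (- kappa j) ^+ (k - a))).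
    apply: cvgB.
      by apply: cvgM; [exact: cvg_cst|exact: IX].
    apply: cvgM; first exact: cvg_cst.
    apply: cvg_big => [|j _]; first exact: add_continuous.
    apply: cvg_big => [|a _]; first exact: add_continuous.
    apply: cvgM.
      by apply: cvgM; [exact: cvg_cst|apply: IB; rewrite -ltnS].
    by apply: cvgM; [exact: cvg_cst|apply: IX; rewrite leq_subr].
  rewrite [\sum_(j < N) \sum_(a < k.+1) 'C(k, a)%:R * _%:R * _](_ : _ = kappa i * (g i * (- kappa i) ^+ k)); last first.
    rewrite (bigD1 i) //= eqxx [X in _ + X]big1 ?addr0; last first.
      move=> j ji; rewrite big1 // => a _.
      by rewrite eq_sym (negbTE ji) /= mulr0 mul0r.
    rewrite big_ord_recl bin0 /= subn0 !mul1r big1 ?addr0 // => a _.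
    by rewrite mulr0 mul0r.
  rewrite (_ : _ - _ = g i * (- kappa i) ^+ k.+1); last by rewrite exprS; ring.
  apply: cvg_trans; apply: near_eq_cvg; near=> d.
  rewrite -[X d i k.+1]/(jderiv (X d i) k) jderiv_state_jet jetDE jetNE !jconstM jet_sumE.
  rewrite mulrBl mulrA; congr (_ - _); rewrite -mulrA; congr (_ * _).
  rewrite mulr_suml; apply: eq_bigr => j _; rewrite jmulE mulr_suml; apply: eq_bigr => a _.
  by rewrite jconstM -!mulrA.
rewrite andbF.
have : d * d * \sum_(a < k.+1) 'C(k, a)%:R * (X d i a / d) * (X d j (k - a)%N / d) @[d --> (0 : R)^'+] -->
   0 * 0 * \sum_(a < k.+1) 'C(k, a)%:R * (g i * (- kappa i) ^+ a) * (g j * (- kappa j) ^+ (k - a)).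
  have c0 : d @[d --> (0 : R)^'+] --> (0 : R) by apply: cvg_at_right_filter; exact: cvg_id.
  apply: cvgM; first exact: cvgM.
  apply: cvg_big => [|a _]; first exact: add_continuous.
  apply: cvgM; last by apply: IX; rewrite leq_subr.
  by apply: cvgM; [exact: cvg_cst|apply: IX; rewrite -ltnS].
rewrite mulr0 mul0r; apply: cvg_trans; apply: near_eq_cvg; near=> d.
have d0 : d != 0 by rewrite gt_eqF//; near: d; exact: nbhs_right_gt.
rewrite -[B d i j k.+1]/(jderiv (B d i j) k) jderiv_resolvent_jet jmulE mulr_sumr.
by apply: eq_bigr => a _; field.
Unshelve. all: by end_near. Qed.

(** U is quadratic in the states, whence the rates - 2 kappa_i. *)
Lemma cvg_potential_jet k :
  jet_of (potential kappa (gam d)) k / d ^+ 2 @[d --> (0 : R)^'+] -->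
  \sum_(i < N) 4 * kappa i * g i ^+ 2 * (- 2 * kappa i) ^+ k.
Proof.
have : 4 * \sum_(i < N) kappa i * \sum_(a < k.+1) 'C(k, a)%:R * (X d i a / d) * (X d i (k - a)%N / d)
    @[d --> (0 : R)^'+] -->
  4 * \sum_(i < N) kappa i * \sum_(a < k.+1) 'C(k, a)%:R * (g i * (- kappa i) ^+ a) * (g i * (- kappa i) ^+ (k - a)).
  apply: cvgM; first exact: cvg_cst.
  apply: cvg_big => [|i _]; first exact: add_continuous.
  apply: cvgM; first exact: cvg_cst.
  apply: cvg_big => [|a _]; first exact: add_continuous.
  apply: cvgM; last exact: (cvg_state_resolvent _).1.
  by apply: cvgM; [exact: cvg_cst|exact: (cvg_state_resolvent _).1].
have -> : 4 * \sum_(i < N) kappa i * \sum_(a < k.+1) 'C(k, a)%:R * (g i * (- kappa i) ^+ a) * (g i * (- kappa i) ^+ (k - a)) =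
  \sum_(i < N) 4 * kappa i * g i ^+ 2 * (- 2 * kappa i) ^+ k.
  rewrite mulr_sumr; apply: eq_bigr => i _.
  rewrite (_ : - 2 * kappa i = - kappa i + - kappa i); last by ring.
  rewrite exprDn 3!mulr_sumr; apply: eq_bigr => a _.
  by rewrite -mulr_natl; ring.
apply: cvg_trans; apply: near_eq_cvg; near=> d.
have d0 : d != 0 by rewrite gt_eqF//; near: d; exact: nbhs_right_gt.
rewrite potential_jetE jconstM jet_sumE -mulrA; congr (_ * _).
rewrite mulr_suml; apply: eq_bigr => i _; rewrite jconstM -mulrA; congr (_ * _).
rewrite jmulE mulr_suml; apply: eq_bigr => a _.
by field.
Unshelve. all: by end_near. Qed.

End small_solitons.

Section expansion_uniqueness.
Variable R : realType.

Lemma heat_expansion_unique (f : R -> R) (a b : nat -> R) :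
  heat_expansion f a -> heat_expansion f b -> a =1 b.
Proof.
move=> ha hb n; elim/ltn_ind: n => n IH.
have h : b n - a n @[t --> (0 : R)^'+] --> (0 : R).
  rewrite -[X in _ --> X](subrr 0).
  apply: cvg_trans (cvgB (ha n) (hb n)); apply: near_eq_cvg; near=> t.
  have tn : t ^+ n != 0.
    by rewrite expf_neq0 // gt_eqF//; near: t; exact: nbhs_right_gt.
  rewrite ?fctE /= 2!big_ord_recr /= (eq_bigr (fun i : 'I_n => b i * t ^+ i)) => [|i _]; last by rewrite IH.
  by move: (\sum_(i < n) _) (Num.sqrt _ * _) => S F; field.
have e : b n - a n = 0.
  by rewrite -(cvg_lim (@Rhausdorff R) h) lim_cst //; exact: Rhausdorff.
by apply/eqP; rewrite eq_sym -subr_eq0 e.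
Unshelve. all: by end_near. Qed.
End expansion_uniqueness.

Section density.
Variable R : realType.
Local Notation mono := (monalg.cmonom nat).
Implicit Types (P : jetpoly R) (v w : nat -> R) (m : mono).

(** The coefficients may lie in any ring, so that the same substitution serves
    numbers and polynomials in an auxiliary variable. *)
Definition monval (S : comNzRingType) (v : nat -> S) (m : mono) : S :=
  \prod_(k <- finsupp m) v k ^+ m k.

Lemma monvalEw (S : comNzRingType) (v : nat -> S) m (d : {fset nat}) :
  (finsupp m `<=` d)%fset -> monval v m = \prod_(k <- d) v k ^+ m k.
Proof.
move=> md; rewrite /monval (big_fset_incl _ md) //= => k _.
by rewrite -monalg.cmE_eq0 => /eqP ->.
Qed.

Lemma monval_mmorphism (S : comNzRingType) (v : nat -> S) : monalg.mmorphism (monval v).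
Proof.
split=> [m1 m2|]; last by rewrite /monval monalg.mdom1 big_seq_fset0.
have s1 : (finsupp m1 `<=` finsupp (monalg.mul m1 m2))%fset.
  by rewrite monalg.mdomD fsubsetUl.
have s2 : (finsupp m2 `<=` finsupp (monalg.mul m1 m2))%fset.
  by rewrite monalg.mdomD fsubsetUr.
rewrite (monvalEw v s1) (monvalEw v s2) /monval -big_split /=.
by apply: eq_bigr => k _; rewrite monalg.cmM exprD.
Qed.

HB.instance Definition _ (S : comNzRingType) (v : nat -> S) :=
  monalg.isMultiplicative.Build mono S (monval v) (monval_mmorphism v).

(** The evaluation of a differential polynomial at a jet, as a ring morphism. *)
Definition jet_hom v : jetpoly R -> R := monalg.mmap idfun (monval v).

HB.instance Definition _ v := GRing.RMorphism.on (jet_hom v).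

Lemma jet_hom_var v k : jet_hom v (jetvar R k) = v k.
Proof.
rewrite /jet_hom monalg.mmapU /= mul1r /monval monalg.mdomU big_seq_fset1.
by rewrite monalg.cmUU expr1.
Qed.

Lemma jet_hom_scale v (c : R) P : jet_hom v (c *: P) = c * jet_hom v P.
Proof. exact: monalg.mmapZ. Qed.

(** The restriction of P to a polynomial curve of jets. *)
Definition jet_poly (V : nat -> {poly R}) P : {poly R} :=
  \sum_(m <- monalg.msupp P) (monalg.mcoeff m P)%:P * monval V m.

Lemma jet_homE v P : jet_hom v P = \sum_(m <- monalg.msupp P) monalg.mcoeff m P * monval v m.
Proof. by []. Qed.

Lemma horner_jet_poly (V : nat -> {poly R}) P (t : R) :
  (jet_poly V P).[t] = jet_hom (fun k => (V k).[t]) P.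
Proof.
rewrite /jet_poly horner_sum jet_homE; apply: eq_bigr => m _.
rewrite hornerM hornerC /monval horner_prod; congr (_ * _).
by apply: eq_bigr => k _; rewrite horner_exp.
Qed.

Lemma poly_eq0_large (q : {poly R}) (t0 : R) : (forall t, t0 <= t -> q.[t] = 0) -> q = 0.
Proof.
move=> h; apply/eqP; apply: contraT => q0.
have := @max_poly_roots _ q (map (fun i : nat => t0 + i%:R) (iota 0 (size q))) q0.
rewrite size_map size_iota ltnn; apply.
  by apply/allP => x /mapP [i _ ->]; apply/eqP; apply: h; rewrite lerDl.
rewrite map_inj_uniq ?iota_uniq // => i j /addrI /eqP.
by rewrite eqr_nat => /eqP.
Qed.

Lemma base_expansion_inj (D K : nat) (a b : nat -> nat) :
  (forall k, a k < D)%N -> (forall k, b k < D)%N ->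
  (\sum_(k < K) a k * D ^ k = \sum_(k < K) b k * D ^ k)%N -> forall k, (k < K)%N -> a k = b k.
Proof.
elim: K a b => [|K IH] a b aD bD; first by [].
rewrite 2!big_ord_recl expn0 !muln1.
have e (c : nat -> nat) : (\sum_(i < K) c (lift ord0 i) * D ^ lift ord0 i = D * \sum_(i < K) c i.+1 * D ^ i)%N.
  by rewrite big_distrr /=; apply: eq_bigr => i _; rewrite /bump /= add1n expnS mulnCA.
rewrite !e => eq.
have D0 : (0 < D)%N by exact: leq_ltn_trans (aD 0%N).
have e0 : a 0%N = b 0%N.
  have := congr1 (fun x => x %% D)%N eq.
  by rewrite /= ![(_ + D * _)%N]addnC ![(D * _)%N]mulnC !modnMDl !modn_small.
move=> [|k] kK //.
move: eq; rewrite e0 => /addnI /eqP; rewrite eqn_pmul2l // => /eqP eq.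
by apply: (IH (fun k => a k.+1) (fun k => b k.+1)).
Qed.

Definition index_bound P : nat :=
  (\sum_(m <- monalg.msupp P) \sum_(k <- finsupp m) k).+1.

Lemma index_boundP P m k : m \in monalg.msupp P -> k \in finsupp m -> (k < index_bound P)%N.
Proof.
move=> mP km; rewrite ltnS (big_fsetD1 m) //= (big_fsetD1 k) //=.
by rewrite -addnA leq_addr.
Qed.

Definition degree_bound P : nat := (\sum_(m <- monalg.msupp P) monalg.mdeg m).+1.

Lemma degree_boundP P m k : m \in monalg.msupp P -> (m k < degree_bound P)%N.
Proof.
move=> mP; rewrite ltnS (big_fsetD1 m) //=.
apply: leq_trans (leq_addr _ _); rewrite /monalg.mdeg.
case: (finsuppP m k) => [//|km]; rewrite (big_fsetD1 k) //=; exact: leq_addr.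
Qed.

Lemma monval_ord (S : comNzRingType) (v : nat -> S) m K :
  (forall k, k \in finsupp m -> (k < K)%N) -> monval v m = \prod_(k < K) v k ^+ m k.
Proof.
move=> mK; rewrite -(big_mkord xpredT (fun k => v k ^+ m k)).
rewrite (bigID (fun k => k \in finsupp m)) /= [X in _ * X]big1 ?mulr1; last first.
  by move=> k; rewrite -monalg.cmE_eq0 => /eqP ->.
rewrite -big_filter /monval; apply: perm_big; apply: uniq_perm.
- exact: fset_uniq.
- by rewrite filter_uniq // iota_uniq.
move=> k; rewrite mem_filter mem_index_iota /=.
by case: (boolP (k \in _)) => //= /mK ->.
Qed.

(** Kronecker substitution: replacing U_k by X^(D^k), where D exceeds all
    exponents, sends distinct monomials of P to distinct powers of X. *)
Lemma jet_hom_eq0 P : (forall v, jet_hom v P = 0) -> P = 0.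
Proof.
move=> h; pose D := degree_bound P; pose K := index_bound P.
pose V k : {poly R} := 'X^(D ^ k)%N.
pose e m := (\sum_(k < K) m k * D ^ k)%N.
have q0 : jet_poly V P = 0.
  by apply: (@poly_eq0_large _ 0) => t _; rewrite horner_jet_poly h.
apply/eqP; rewrite -monalg.msupp_eq0; apply/eqP/fsetP => m0; rewrite in_fset0.
apply/negbTE/negP => m0P.
have eE m : m \in monalg.msupp P -> monval V m = 'X^(e m).
  move=> mP; rewrite (monval_ord _ (fun k => @index_boundP P m k mP)) /e -prodrXr.
  by apply: eq_bigr => k _; rewrite /V -exprM mulnC.
have /eqP := congr1 (fun q : {poly R} => q`_(e m0)) q0; rewrite coef0; apply/negP.
rewrite /jet_poly coef_sum (big_fsetD1 m0) //= big_seq big1 ?addr0.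
  by rewrite coefCM eE // coefXn eqxx mulr1 monalg.mcoeff_neq0.
move=> m; rewrite in_fsetD1 => /andP[mm0 mP].
rewrite coefCM eE // coefXn; case: eqP => [ee|_]; last by rewrite mulr0.
case/eqP: mm0; apply/eqP/monalg.cmP => k.
have [kK|kK] := ltnP k K.
  by apply/esym; apply: (@base_expansion_inj D K m0 m) => // k'; exact: degree_boundP.
have out m' : m' \in monalg.msupp P -> m' k = 0%N.
  move=> m'P; apply/eqP; rewrite monalg.cmE_eq0; apply/negP => /(index_boundP m'P).
  by rewrite ltnNge kK.
by rewrite !out.
Qed.

Lemma jet_hom_eq v w P : (forall k, (k < index_bound P)%N -> v k = w k) ->
  jet_hom v P = jet_hom w P.
Proof.
move=> vw; rewrite !jet_homE big_seq [in RHS]big_seq; apply: eq_bigr => m mP.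
congr (_ * _); rewrite /monval big_seq [in RHS]big_seq; apply: eq_bigr => k km.
by rewrite vw // (index_boundP mP).
Qed.

(** As far as P sees it, any jet v is a combination of the vectors of powers of
    the z_i, with coefficients a_i, by inverting a Vandermonde matrix.  Along the line
    a_i + t all coefficients are positive for large t, so P vanishes on the
    whole line, in particular at t = 0. *)
Lemma jet_hom_cone_eq0 P (z : 'I_(index_bound P) -> R) : injective z ->
  (forall c : 'I_(index_bound P) -> R, (forall i, 0 < c i) ->
     jet_hom (fun k => \sum_i c i * z i ^+ k) P = 0) -> P = 0.
Proof.
move=> zinj h; apply: jet_hom_eq0 => v.
set N := index_bound P in z zinj h *.
pose M : 'M[R]_N := Vandermonde N (\row_i z i).
have uM : M \in unitmx.
  rewrite unitmxE unitfE det_Vandermonde prodf_seq_neq0; apply/allP => i _ /=.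
  rewrite prodf_seq_neq0; apply/allP => j _; apply/implyP => ij /=.
  rewrite !mxE subr_eq0; apply: contraTneq ij => /zinj ->.
  by rewrite ltnn.
pose a : 'cV[R]_N := invmx M *m \col_k v k.
have aE (k : nat) : (k < N)%N -> \sum_i a i 0 * z i ^+ k = v k.
  move=> kN; have : (M *m a) (Ordinal kN) 0 = v k by rewrite mulmxA mulmxV // mul1mx mxE.
  by rewrite mxE => <-; apply: eq_bigr => i _; rewrite !mxE mulrC.
(* The line through the coefficients of v in the direction (1, ..., 1). *)
pose V k : {poly R} := \sum_i (a i 0)%:P * (z i ^+ k)%:P + 'X * (\sum_i (z i ^+ k)%:P).
have VE k t : (V k).[t] = \sum_i (a i 0 + t) * z i ^+ k.
  rewrite /V hornerD hornerM hornerX !horner_sum mulr_sumr -big_split /=.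
  by apply: eq_bigr => i _; rewrite hornerM !hornerC mulrDl.
have V0 : jet_poly V P = 0.
  apply: (@poly_eq0_large _ (1 + \sum_i `|a i 0|)) => t ht; rewrite horner_jet_poly.
  rewrite (@jet_hom_eq _ (fun k => \sum_i (a i 0 + t) * z i ^+ k)) ?h // => i.
  rewrite -ltrBlDl sub0r; apply: lt_le_trans ht.
  rewrite (bigD1 i) //= addrA ltr_wpDr ?sumr_ge0 //.
  by rewrite ltr_pwDl // -normrN ler_norm.
rewrite -(@jet_hom_eq (fun k => (V k).[0])).
  by rewrite -horner_jet_poly V0 horner0.
by move=> k kN; rewrite VE -(aE k kN); apply: eq_bigr => i _; rewrite addr0.
Qed.

Lemma mcoeff_sumU (r : seq mono) (p : pred mono) (F : mono -> R) m0 : uniq r ->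
  monalg.mcoeff m0 (\sum_(m <- r | p m) monalg.mkmalgU m (F m) : jetpoly R) =
  if (m0 \in r) && p m0 then F m0 else 0.
Proof.
elim: r => [|m r IH] /=; first by rewrite big_nil monalg.mcoeff0.
move=> /andP[mr ur]; rewrite big_cons in_cons; move: IH.
have [<-|mm0] := eqVneq m m0 => IH; last first.
  by case: (p m); rewrite ?monalg.mcoeffD ?monalg.mcoeffU ?(negbTE mm0) ?add0r IH.
case: ifP => pm; last by rewrite IH // pm !andbF.
by rewrite monalg.mcoeffD monalg.mcoeffU eqxx IH // (negbTE mr) addr0.
Qed.

(** Divide P by t ^ (2 d) along solitons of amplitude t -> 0, d being the least
    degree of a monomial of P: in the limit the homogeneous part of degree d is
    evaluated at the leading terms of the jets, which fill a cone. *)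
Lemma jet_hom_soliton_eq0 P :
  (forall N (kappa gamma : 'I_N -> R), (forall i, 0 < kappa i) ->
     jet_hom (jet_of (potential kappa gamma)) P = 0) -> P = 0.
Proof.
move=> h; apply/eqP; apply: contraT => Pn0.
have ex : exists d, has (fun m => monalg.mdeg m == d) (monalg.msupp P).
  move: Pn0; rewrite -monalg.msupp_eq0 => /fset0Pn [m mP].
  by exists (monalg.mdeg m); apply/hasP; exists m.
pose d := ex_minn ex.
have [m0 m0P /eqP m0d] : exists2 m, m \in monalg.msupp P & monalg.mdeg m == d.
  by rewrite /d; case: ex_minnP => ? /hasP.
have dmin m : m \in monalg.msupp P -> (d <= monalg.mdeg m)%N.
  by move=> mP; rewrite /d; case: ex_minnP => n _; apply; apply/hasP; exists m.
pose Q : jetpoly R := \sum_(m <- monalg.msupp P | monalg.mdeg m == d)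
   monalg.mkmalgU m (monalg.mcoeff m P).
have QE v : jet_hom v Q = \sum_(m <- monalg.msupp P | monalg.mdeg m == d)
    monalg.mcoeff m P * monval v m.
  by rewrite /Q raddf_sum /=; apply: eq_bigr => m _; rewrite /jet_hom monalg.mmapU.
suff Q0 : Q = 0.
  have : monalg.mcoeff m0 Q = monalg.mcoeff m0 P.
    by rewrite /Q mcoeff_sumU ?fset_uniq // m0P m0d eqxx.
  by rewrite Q0 monalg.mcoeff0 => /esym/eqP; rewrite monalg.mcoeff_eq0 m0P.
(* Any distinct positive numbers would do. *)
pose kap (i : 'I_(index_bound Q)) : R := i.+1%:R.
have kap0 i : 0 < kap i by rewrite ltr0n.
apply: (@jet_hom_cone_eq0 Q (fun i => - 2 * kap i)).
  move=> i j /(mulfI _) => /(_ _)/eqP; rewrite oppr_eq0 pnatr_eq0 => /(_ isT).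
  by rewrite eqr_nat eqSS => /eqP /val_inj.
move=> c c0.
(* Chosen so that the limit of the jets has the prescribed coefficients c. *)
pose g i := Num.sqrt (c i / (4 * kap i)).
have gE i : 4 * kap i * g i ^+ 2 = c i.
  rewrite sqr_sqrtr ?divr_ge0 ?mulr_ge0 ?(ltW (kap0 i)) ?(ltW (c0 i)) //.
  by rewrite mulrC divfK // mulf_neq0 // gt_eqF.
pose w k := \sum_i c i * (- 2 * kap i) ^+ k.
pose J (t : R) : nat -> R := jet_of (potential kap (fun i => t * g i)).
have cJ k : J t k / t ^+ 2 @[t --> (0 : R)^'+] --> w k.
  rewrite /w; under eq_bigr => i _ do rewrite -gE.
  exact: cvg_potential_jet.
have : \sum_(m <- monalg.msupp P) monalg.mcoeff m P * (t ^+ 2) ^+ (monalg.mdeg m - d) *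
     monval (fun k => J t k / t ^+ 2) m @[t --> (0 : R)^'+] -->
   \sum_(m <- monalg.msupp P) monalg.mcoeff m P * (0 ^+ 2) ^+ (monalg.mdeg m - d) * monval w m.
  have c2 n : (t ^+ 2) ^+ n @[t --> (0 : R)^'+] --> ((0 : R) ^+ 2) ^+ n.
    rewrite -exprM (_ : (fun t : R => _) = (fun t : R => t ^+ (2 * n))).
      by apply: cvg_at_right_filter; exact: exprn_continuous.
    by apply/funext => t; rewrite exprM.
  apply: cvg_big => [|m _]; first exact: add_continuous.
  apply: cvgM.
    by apply: cvgM; [exact: cvg_cst|exact: c2].
  apply: cvg_big => [|k _]; first exact: mul_continuous.
  exact: (@continuous_cvg _ _ _ _ _ _ (fun x : R => x ^+ m k) _ (@exprn_continuous R (m k) _) (cJ k)).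
set L := (X in _ --> X) => cL.
have L0 : L = 0.
  have : (0 : R) @[t --> (0 : R)^'+] --> L.
    apply: cvg_trans cL; apply: near_eq_cvg; near=> t.
    have t0 : t != 0 by rewrite gt_eqF//; near: t; exact: nbhs_right_gt.
    apply: (@mulfI _ ((t ^+ 2) ^+ d)); first by rewrite !expf_neq0.
    rewrite mulr0 -[RHS](h _ kap (fun i => t * g i) kap0) jet_homE mulr_sumr.
    rewrite big_seq [in RHS]big_seq; apply: eq_bigr => m mP.
    rewrite -mulrA mulrCA; congr (_ * _); rewrite mulrA -exprD subnKC ?dmin //.
    rewrite /monalg.mdeg -prodrXr /monval -big_split /=; apply: eq_bigr => k _.
    by rewrite -exprMn mulrC divfK // expf_neq0.
  by move=> /(cvg_lim (@Rhausdorff R)) <-; rewrite lim_cst //; exact: Rhausdorff.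
apply: etrans L0; rewrite QE /L [LHS]big_mkcond big_seq [RHS]big_seq; apply: eq_bigr => m mP.
rewrite expr0n /= expr0n subn_eq0; have := dmin m mP.
case: (ltngtP d (monalg.mdeg m)) => //= _ _; first by rewrite mulr0 mul0r.
by rewrite mulr1.
Unshelve. all: by end_near. Qed.

End density.

(** * The formula for the KdV hierarchy *)

(* binom(n + 1/2, j + 1/2) is binom(n + 1/2, n - j), and the condition
   k_1 + ... + k_p = 2 (n - p) is written without subtraction, so that there is
   no such k when p > n. *)
Theorem theorem5p2p2 (R : realType) (h : nat -> jetpoly R)
    (hh : heat_coefficients h) (n : nat) (hn : (1 <= n)%N) :
  kdv_poly h n =
  ((2 * n)`!%:R / (2 * n`!%:R)) *:
  \sum_(j < n.+1)
    (gbinom (n%:R + 1 / 2 : R) (n - j)%N *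
     ((-1) ^+ j * (2 * j)`!%:R / (4 ^+ j * j`!%:R * (j + n)`!%:R))) *:
    \sum_(1 <= p < (j + n).+1)
      \sum_(k : {ffun 'I_p -> 'I_(2 * n).+1} |
             (\sum_(i < p) k i + 2 * p == 2 * n)%N)
        (Ccoef (j + n) (fun i : 'I_p => nat_of_ord (k i)))%:R *:
        \prod_(i < p) jetvar R (k i).
Proof.
rewrite /kdv_poly; congr (_ *: _).
(* It suffices to compare both sides on the jets of soliton potentials. *)
apply/eqP; rewrite -subr_eq0; apply/eqP; apply: jet_hom_soliton_eq0 => N kappa gamma k0.
set v := jet_of _.
rewrite rmorphB rmorph_sum /=.
have -> : jet_hom v (h n) = soliton_coef kappa (fun i => state kappa gamma i 0) n.
  have H := hker_fundamental (is_derive_state gamma k0) (is_derive_dstate gamma k0)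
    (@ddstate_continuous R N kappa gamma k0) (state_eigen gamma k0) (state_potential gamma k0).
  have e1 := hh _ _ (@potential_smooth R N kappa gamma k0) H 0.
  have e2 := @hker_expansion R N kappa (state kappa gamma) 0 k0.
  exact: (heat_expansion_unique e1 e2 n).
rewrite (@soliton_coef_jets R N kappa gamma k0 n hn).
apply/eqP; rewrite subr_eq0; apply/eqP; apply: eq_bigr => j _.
rewrite schr_monomial // jet_hom_scale /kdv_weight rmorph_sum /=.
rewrite [in RHS](eq_bigr (fun p => \sum_(k : {ffun 'I_p -> 'I_(2 * n).+1} | (\sum_(i < p) k i + 2 * p == 2 * n)%N)
      (Ccoef (j + n) (fun i : 'I_p => nat_of_ord (k i)))%:R * \prod_(i < p) v (k i))) => [|p _]; last first.
  rewrite rmorph_sum; apply: eq_bigr => k _.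
  rewrite [LHS]jet_hom_scale rmorph_prod; congr (_ * _); apply: eq_bigr => i _.
  exact: jet_hom_var.
by rewrite !mulrA; congr (_ * _); ring.
Qed.
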